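(* KEP (the statement that every separable unital $C^*$-algebra embeds unitally into $\mathcal{O}_2^\omega$) implies that the theory of unital $C^*$-algebras does not have a model companion.
   Context: All $C^*$-algebras and embeddings are unital (with $1\ne 0$). $\mathcal{O}_2$ is the Cuntz algebra (universal $C^*$-algebra generated by two isometries $v_1,v_2$ with $v_1v_1^*+v_2v_2^*=1$); $\omega$ is a nonprincipal ultrafilter on $\mathbb{N}$ and $\mathcal{O}_2^\omega$ is the $C^*$-algebra ultrapower. KEP (Kirchberg's Embedding Problem) is the statement that every separable $C^*$-algebra embeds into $\mathcal{O}_2^\omega$; its unital and nonunital versions are equivalent. Formulas in the language of unital $C^*$-algebras (continuous logic) are built from expressions $\|t(x)\|$, $t$ a $*$-polynomial with complex coefficients, by applying continuous functions $\mathbb{R}^k\to\mathbb{R}$ and the quantifiers $\sup$ and $\inf$ over variables ranging over closed balls of integer radius. A theory is a set of conditions $\sigma=0$, $\sigma$ a sentence (formula without free variables), and its models are the structures satisfying them. A model $A$ of a theory $T$ is an existentially closed model of $T$ if for every model $B$ of $T$ with $A\subseteq B$, every quantifier-free formula $\varphi(v,w)$, every $n\ge1$ and every finite tuple $a$ from $A$, $\inf\{\varphi(a,b): b\in A_{\le n}\}=\inf\{\varphi(a,c): c\in B_{\le n}\}$, where $(\cdot)_{\le n}$ denotes tuples all of whose coordinates have norm at most $n$. A theory $T$ is model-complete if all of its models are existentially closed models of $T$. A model-complete theory $T$ is the model companion of a theory $T_0$ if every model of $T$ embeds in a model of $T_0$ and every model of $T_0$ embeds in a model of $T$. *)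

(* Defs.v *)
From HB Require Import structures.
From mathcomp Require Import all_boot all_order all_algebra.
From mathcomp Require Import generic_quotient ring_quotient complex lra.
From mathcomp Require Import mathcomp_extra boolp classical_sets functions reals.
From mathcomp Require Import topology normedtype sequences.

Set Implicit Arguments.
Unset Strict Implicit.
Unset Printing Implicit Defensive.

Import Order.TTheory GRing.Theory Num.Theory.
Import numFieldNormedType.Exports.
Import ComplexField.

Local Open Scope classical_set_scope.
Local Open Scope ring_scope.
Local Open Scope complex_scope.
Local Open Scope quotient_scope.

Definition cauchy_for (R : realType) (A : zmodType) (N : A -> R)
    (u : nat -> A) : Prop :=
  forall e : R, 0 < e -> exists K : nat, forall m n : nat,
    (K <= m)%N -> (K <= n)%N -> N (u m - u n) < e.

Definition cvg_for (R : realType) (A : zmodType) (N : A -> R)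
    (u : nat -> A) (l : A) : Prop :=
  (fun n => N (u n - l)) @ \oo --> (0 : R).

(* [algType] is built on non-trivial rings, hence 1 != 0. *)
Record cstarAlg (R : realType) := CStarAlg {
  cstar_sort :> algType R[i];
  star : cstar_sort -> cstar_sort;
  cnorm : cstar_sort -> R;
  starK : involutive star;
  starD : {morph star : x y / x + y};
  starZ : forall (c : R[i]) (x : cstar_sort),
    star (c *: x) = conjc c *: star x;
  starM : forall x y : cstar_sort, star (x * y) = star y * star x;
  cnorm_eq0 : forall x : cstar_sort, cnorm x = 0 -> x = 0;
  cnormD : forall x y : cstar_sort, cnorm (x + y) <= cnorm x + cnorm y;
  cnormZ : forall (c : R[i]) (x : cstar_sort),
    cnorm (c *: x) = Normc.normc c * cnorm x;
  cnormM : forall x y : cstar_sort, cnorm (x * y) <= cnorm x * cnorm y;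
  cnorm_star : forall x : cstar_sort, cnorm (star x * x) = cnorm x ^+ 2;
  cnorm_complete : forall u : nat -> cstar_sort,
    cauchy_for cnorm u -> exists l : cstar_sort, cvg_for cnorm u l
}.

Arguments star {R A} x : rename.
Arguments cnorm {R A} x : rename.

Section CStarBasics.
Variables (R : realType) (A : cstarAlg R).
Implicit Types x y : A.

Lemma cnorm0 : cnorm (0 : A) = 0.
Proof. by rewrite -(scale0r (0 : A)) cnormZ Normc.normc0 mul0r. Qed.

Lemma cnormN x : cnorm (- x) = cnorm x.
Proof. by rewrite -scaleN1r cnormZ normcN Normc.normc1 mul1r. Qed.

Lemma cnorm_ge0 x : 0 <= cnorm x.
Proof.
have := cnormD x (- x); rewrite subrr cnorm0 cnormN -mulr2n.
by rewrite pmulrn_lge0.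
Qed.

Lemma cnormB x y : cnorm (x - y) = cnorm (y - x).
Proof. by rewrite -cnormN opprB. Qed.

Lemma cnorm_dist x y : `|cnorm x - cnorm y| <= cnorm (x - y).
Proof.
rewrite ler_norml lerNl opprB !lerBlDr; apply/andP; split.
  by rewrite cnormB; have := cnormD (y - x) x; rewrite subrK.
by have := cnormD (x - y) y; rewrite subrK.
Qed.

Lemma star0 : star (0 : A) = 0.
Proof. by rewrite -(scale0r (0 : A)) starZ rmorph0 !scale0r. Qed.

Lemma starN x : star (- x) = - star x.
Proof. by apply/eqP; rewrite -addr_eq0 -starD addNr star0. Qed.

Lemma star1 : star (1 : A) = 1.
Proof. by rewrite -[LHS]mulr1 -[X in _ * X]starK -starM mulr1 starK. Qed.

Lemma cnorm_star_eq x : cnorm (star x) = cnorm x.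
Proof.
have le y : cnorm y <= cnorm (star y).
  have [y0|y0] := eqVneq (cnorm y) 0; first by rewrite y0 cnorm_ge0.
  have yp : 0 < cnorm y by rewrite lt_neqAle eq_sym y0 cnorm_ge0.
  by rewrite -(ler_pM2r yp) -expr2 -cnorm_star cnormM.
by apply/eqP; rewrite eq_le le andbT -{2}(starK x) le.
Qed.

Lemma cnorm1_neq0 : cnorm (1 : A) != 0.
Proof. by apply/eqP => /cnorm_eq0/eqP; rewrite oner_eq0. Qed.

Lemma cnorm1 : cnorm (1 : A) = 1.
Proof.
apply: (mulfI cnorm1_neq0); rewrite mulr1 -expr2 -cnorm_star.
by rewrite star1 mulr1.
Qed.

End CStarBasics.

Section Morphisms.
Variables (R : realType) (A B : cstarAlg R).

Definition is_star_hom (f : A -> B) : Prop :=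
  [/\ linear f, monoid_morphism f & {morph f : x / star x}].

(* Identifies A with a C*-subalgebra of B containing the unit of B: the norm of
   A is the restriction of that of B, as for embeddings of metric structures. *)
Definition is_embedding (f : A -> B) : Prop :=
  is_star_hom f /\ (forall x : A, cnorm (f x) = cnorm x).

Definition embeds : Prop := exists f : A -> B, is_embedding f.

End Morphisms.

Definition separable (R : realType) (A : cstarAlg R) : Prop :=
  exists s : nat -> A,
    forall (x : A) (e : R), 0 < e -> exists n, cnorm (x - s n) < e.

Definition cuntz_pair (R : realType) (A : cstarAlg R) (v1 v2 : A) : Prop :=
  [/\ star v1 * v1 = 1, star v2 * v2 = 1 & v1 * star v1 + v2 * star v2 = 1].

(* The universal property of the C*-algebra generated by a Cuntz pair; it
   determines A up to isomorphism. *)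
Definition is_cuntz2 (R : realType) (A : cstarAlg R) : Prop :=
  exists v1 v2 : A, cuntz_pair v1 v2 /\
    forall (B : cstarAlg R) (w1 w2 : B), cuntz_pair w1 w2 ->
      exists! f : A -> B, [/\ is_star_hom f, f v1 = w1 & f v2 = w2].

Definition nonprincipal (U : set_system nat) : Prop :=
  forall n : nat, U <> principal_filter n.

Section LInfinity.
Variables (R : realType) (A : cstarAlg R).

Let fun_scalerAl (a : R[i]) (u v : nat -> A) : a *: (u * v) = a *: u * v.
Proof. by apply/funext => n; exact: scalerAl. Qed.

Let fun_scalerAr (a : R[i]) (u v : nat -> A) : a *: (u * v) = u * (a *: v).
Proof. by apply/funext => n; exact: scalerAr. Qed.

HB.instance Definition _ :=
  GRing.Lmodule_isLalgebra.Build R[i] (nat -> A) fun_scalerAl.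
HB.instance Definition _ :=
  GRing.Lalgebra_isAlgebra.Build R[i] (nat -> A) fun_scalerAr.

Definition bounded_seq : {pred nat -> A} :=
  fun x => `[< exists M : R, forall n, cnorm (x n) <= M >].

Lemma bounded_seq_subalg : subalg_closed bounded_seq.
Proof.
split.
- by apply/asboolP; exists 1 => n; rewrite cnorm1.
- move=> c x y /asboolP[M xM] /asboolP[N yN]; apply/asboolP.
  exists (Normc.normc c * M + N) => n.
  apply: (le_trans (cnormD _ _)); apply: lerD => //.
  by rewrite cnormZ ler_wpM2l//; case: c => a b; exact: sqrtr_ge0.
- move=> x y /asboolP[M xM] /asboolP[N yN]; apply/asboolP.
  exists (M * N) => n; apply: (le_trans (cnormM _ _)).
  by apply: ler_pM => //; exact: cnorm_ge0.
Qed.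

HB.instance Definition _ :=
  GRing.isSubalgClosed.Build R[i] (nat -> A) bounded_seq bounded_seq_subalg.

Record linf := Linf { linf_val :> nat -> A; linfP : linf_val \in bounded_seq }.

HB.instance Definition _ := [isSub for linf_val].
HB.instance Definition _ := [Choice of linf by <:].
HB.instance Definition _ := [SubChoice_isSubAlgebra of linf by <:].

End LInfinity.

Section UltraLimit.
Variables (R : realType) (U : set_system nat) (UU : UltraFilter U).

Lemma ultra_bounded_cvg (u : nat -> R) :
  (exists M, forall n, `|u n| <= M) -> cvg (u @ U).
Proof.
move=> [M uM].
have cK : compact `[- M, M] by exact: segment_compact.
have UK : (u @ U) [set` `[- M, M]].
  by apply: (@filterE _ U) => n /=; rewrite in_itv/= -ler_norml.
have [p [_ Fp]] := cK _ _ UK.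
apply/cvg_ex; exists p => V pV.
have [//|UVc] := in_ultra_setVsetC (u @^-1` V) UU.
have uVc : (u @ U) (~` V) by [].
by have [x []] := Fp _ _ uVc pV.
Qed.

End UltraLimit.

Section Ultrapower.
Variables (R : realType) (A : cstarAlg R).
Variables (U : set_system nat) (UU : UltraFilter U).
Local Notation L := (linf A).
Implicit Types x y z : L.

Lemma linf_bounded x : exists M, forall n, cnorm (x n) <= M.
Proof. by have /asboolP := linfP x. Qed.

Lemma linf_cvg x : cvg ((fun n => cnorm (x n)) @ U).
Proof.
apply: ultra_bounded_cvg; have [M xM] := linf_bounded x.
by exists M => n; rewrite ger0_norm ?cnorm_ge0.
Qed.

Definition null_seq (_ : UltraFilter U) : {pred linf A} :=
  fun x => `[< (fun n => cnorm (x n)) @ U --> (0 : R) >].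

Lemma null_seqP x :
  reflect ((fun n => cnorm (x n)) @ U --> (0 : R)) (x \in null_seq UU).
Proof. exact: asboolP. Qed.

Lemma squeeze0 (u v : nat -> R) : (forall n, 0 <= u n <= v n) ->
  v @ U --> (0 : R) -> u @ U --> (0 : R).
Proof.
move=> uv; apply: (@squeeze_cvgr _ U _ R (fun=> 0) v u).
- exact: filterE.
- exact: cvg_cst.
Qed.

Lemma null_seq_zmod : zmod_closed (null_seq UU).
Proof.
split.
- apply/null_seqP; rewrite (_ : (fun n => _) = cst 0); first exact: cvg_cst.
  by apply/funext => n /=; rewrite cnorm0.
- move=> x y /null_seqP x0 /null_seqP y0; apply/null_seqP.
  have xy0 : (fun n => cnorm (x n) + cnorm (y n)) @ U --> (0 : R).
    by rewrite -[X in _ --> X]addr0; exact: cvgD.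
  apply: (squeeze0 _ xy0) => n; rewrite cnorm_ge0/=.
  by rewrite -(cnormN (y n)); exact: cnormD.
Qed.

HB.instance Definition _ :=
  GRing.isZmodClosed.Build (linf A) (null_seq UU) null_seq_zmod.

Lemma null_seqMl x y : y \in null_seq UU -> x * y \in null_seq UU.
Proof.
move=> /null_seqP y0; apply/null_seqP; have [M xM] := linf_bounded x.
have My0 : (fun n => M * cnorm (y n)) @ U --> (0 : R).
  by rewrite -[X in _ --> X](mulr0 M); apply: cvgMr.
apply: (squeeze0 _ My0) => n; rewrite cnorm_ge0/=.
by apply: (le_trans (cnormM _ _)); rewrite ler_wpM2r ?cnorm_ge0.
Qed.

Lemma null_seqMr x y : x \in null_seq UU -> x * y \in null_seq UU.
Proof.
move=> /null_seqP x0; apply/null_seqP; have [M yM] := linf_bounded y.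
have Mx0 : (fun n => M * cnorm (x n)) @ U --> (0 : R).
  by rewrite -[X in _ --> X](mulr0 M); apply: cvgMr.
apply: (squeeze0 _ Mx0) => n; rewrite cnorm_ge0/= mulrC.
by apply: (le_trans (cnormM _ _)); rewrite ler_wpM2l ?cnorm_ge0.
Qed.

Definition ultra : Type := Quotient.quot (null_seq UU).

HB.instance Definition _ := GRing.Zmodule.on ultra.

Definition upi (x : L) : ultra := \pi_(Quotient.quot (null_seq UU)) x.
Definition urepr (q : ultra) : L := repr (q : Quotient.quot (null_seq UU)).

Lemma ureprK q : upi (urepr q) = q.
Proof. exact: reprK. Qed.

Lemma upi_eq x y : upi x = upi y <-> x - y \in null_seq UU.
Proof. by split => [/eqP|h]; [|apply/eqP]; rewrite -Quotient.idealrBE. Qed.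

Lemma upiD x y : upi (x + y) = upi x + upi y.
Proof. exact: Quotient.pi_add. Qed.

Lemma upiN x : upi (- x) = - upi x.
Proof. exact: Quotient.pi_opp. Qed.

Lemma upiB x y : upi (x - y) = upi x - upi y.
Proof. by rewrite upiD upiN. Qed.

Lemma upi0 : upi 0 = 0.
Proof. by rewrite -(subrr 0) upiB subrr. Qed.

Lemma urepr_upi x : urepr (upi x) - x \in null_seq UU.
Proof. by apply/upi_eq; exact: ureprK. Qed.

Definition uone : ultra := upi 1.
Definition umul (p q : ultra) : ultra := upi (urepr p * urepr q).
Definition uscale (c : R[i]) (q : ultra) : ultra := upi (c *: urepr q).

Lemma upiM x y : upi (x * y) = umul (upi x) (upi y).
Proof.
apply/esym/upi_eq.
rewrite -(subrK (x * urepr (upi y)) (_ * _)) -mulrBl -addrA -mulrBr.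
by apply: rpredD; [apply: null_seqMr|apply: null_seqMl]; exact: urepr_upi.
Qed.

Lemma upiZ c x : upi (c *: x) = uscale c (upi x).
Proof.
apply/esym/upi_eq; rewrite -scalerBr -mulr_algl.
by apply: null_seqMl; exact: urepr_upi.
Qed.

Lemma ultra_ind (P : ultra -> Prop) : (forall x, P (upi x)) -> forall q, P q.
Proof. by move=> h q; rewrite -(ureprK q). Qed.

Lemma umulA : associative umul.
Proof.
by elim/ultra_ind => x; elim/ultra_ind => y; elim/ultra_ind => z;
  rewrite -!upiM mulrA.
Qed.

Lemma umul1 : left_id uone umul.
Proof. by elim/ultra_ind => x; rewrite -upiM mul1r. Qed.

Lemma umulr1 : right_id uone umul.
Proof. by elim/ultra_ind => x; rewrite -upiM mulr1. Qed.

Lemma umulDl : left_distributive umul +%R.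
Proof.
by elim/ultra_ind => x; elim/ultra_ind => y; elim/ultra_ind => z;
  rewrite -upiD -!upiM mulrDl upiD.
Qed.

Lemma umulDr : right_distributive umul +%R.
Proof.
by elim/ultra_ind => x; elim/ultra_ind => y; elim/ultra_ind => z;
  rewrite -upiD -!upiM mulrDr upiD.
Qed.

Lemma uone_neq0 : uone != 0.
Proof.
apply/eqP; rewrite -upi0 => /upi_eq; rewrite subr0 => /null_seqP h.
have h1 : (fun n => cnorm ((1 : L) n)) @ U --> (1 : R).
  rewrite (_ : (fun n => _) = cst 1); first exact: cvg_cst.
  by apply/funext => n /=; rewrite cnorm1.
have e := cvg_unique (@Rhausdorff R) h1 h.
by move: (oner_neq0 R); rewrite e eqxx.
Qed.

HB.instance Definition _ := GRing.Zmodule_isNzRing.Build ultra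
  umulA umul1 umulr1 umulDl umulDr uone_neq0.

Lemma uscaleA a b q : uscale a (uscale b q) = uscale (a * b) q.
Proof. by elim/ultra_ind: q => x; rewrite -!upiZ scalerA. Qed.

Lemma uscale1 : left_id 1 uscale.
Proof. by elim/ultra_ind => x; rewrite -upiZ scale1r. Qed.

Lemma uscaleDr : right_distributive uscale +%R.
Proof.
by move=> c; elim/ultra_ind => x; elim/ultra_ind => y;
  rewrite -upiD -!upiZ scalerDr upiD.
Qed.

Lemma uscaleDl q : {morph uscale^~ q : a b / a + b}.
Proof. by elim/ultra_ind: q => x a b; rewrite -!upiZ scalerDl upiD. Qed.

HB.instance Definition _ := GRing.Zmodule_isLmodule.Build R[i] ultra
  uscaleA uscale1 uscaleDr uscaleDl.

Lemma uscaleAl c (p q : ultra) : c *: (p * q) = c *: p * q.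
Proof.
elim/ultra_ind: p => x; elim/ultra_ind: q => y.
by rewrite -[_ * _]upiM -[LHS]upiZ scalerAl upiM upiZ.
Qed.

HB.instance Definition _ := GRing.Lmodule_isLalgebra.Build R[i] ultra uscaleAl.

Lemma uscaleAr c (p q : ultra) : c *: (p * q) = p * (c *: q).
Proof.
elim/ultra_ind: p => x; elim/ultra_ind: q => y.
by rewrite -[_ * _]upiM -[LHS]upiZ scalerAr upiM upiZ.
Qed.

HB.instance Definition _ := GRing.Lalgebra_isAlgebra.Build R[i] ultra uscaleAr.

Lemma lstar_subproof x : (fun n => star (x n)) \in bounded_seq (A := A).
Proof.
have [M xM] := linf_bounded x.
by apply/asboolP; exists M => n; rewrite cnorm_star_eq.
Qed.

Definition lstar x : L := Linf (lstar_subproof x).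

Definition ustar (q : ultra) : ultra := upi (lstar (urepr q)).
Definition unorm (q : ultra) : R := lim ((fun n => cnorm (urepr q n)) @ U).

Lemma linfP_eq x y : (forall n, x n = y n) -> x = y.
Proof. by move=> h; apply/val_inj/funext. Qed.

Lemma upi_star x : ustar (upi x) = upi (lstar x).
Proof.
apply/upi_eq; have /null_seqP := urepr_upi x; set y := urepr _ => xy.
apply/null_seqP; rewrite (_ : (fun n => _) = fun n => cnorm ((y - x) n))//.
apply/funext => n; rewrite -[RHS]cnorm_star_eq; congr cnorm.
by rewrite /= starD starN.
Qed.

Lemma unorm_cvg x : (fun n => cnorm (x n)) @ U --> unorm (upi x).
Proof.
have /null_seqP := urepr_upi x; rewrite /unorm; set y := urepr _ => xy.
have d0 : (fun n => cnorm (x n) - cnorm (y n)) @ U --> (0 : R).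
  apply/norm_cvg0P; apply: (squeeze0 _ xy) => n.
  by rewrite normr_ge0/= cnormB; exact: cnorm_dist.
rewrite (_ : (fun n => cnorm (x n)) =
  (fun n => (cnorm (x n) - cnorm (y n)) + cnorm (y n))); last first.
  by apply/funext => n; rewrite subrK.
by rewrite -[X in _ --> X]add0r; apply: cvgD => //; exact: linf_cvg.
Qed.

Arguments unorm_cvg : clear implicits.

Lemma unormP x (l : R) : (fun n => cnorm (x n)) @ U --> l -> unorm (upi x) = l.
Proof. exact/(cvg_unique (@Rhausdorff R))/unorm_cvg. Qed.

Lemma unorm_le x (M : R) :
  (\forall n \near U, cnorm (x n) <= M) -> unorm (upi x) <= M.
Proof.
exact: (ler_cvg_to (unorm_cvg x) (cvg_cst M)).
Qed.

Lemma unorm_ge0 (q : ultra) : 0 <= unorm q.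
Proof.
elim/ultra_ind: q => x; apply: (ler_cvg_to (@cvg_cst R 0 nat U _) (unorm_cvg x)).
by apply: (@filterE _ U) => n; exact: cnorm_ge0.
Qed.

Lemma ustarK : involutive ustar.
Proof.
elim/ultra_ind => x; rewrite !upi_star; congr upi.
by apply: linfP_eq => n; rewrite /= starK.
Qed.

Lemma ustarD : {morph ustar : p q / p + q}.
Proof.
elim/ultra_ind => x; elim/ultra_ind => y; rewrite -upiD !upi_star -upiD.
by congr upi; apply: linfP_eq => n; rewrite /= starD.
Qed.

Lemma ustarZ c (q : ultra) : ustar (c *: q) = conjc c *: ustar q.
Proof.
elim/ultra_ind: q => x; rewrite -[c *: _]upiZ !upi_star -[RHS]upiZ.
by congr upi; apply: linfP_eq => n; rewrite /= starZ.
Qed.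

Lemma ustarM (p q : ultra) : ustar (p * q) = ustar q * ustar p.
Proof.
elim/ultra_ind: p => x; elim/ultra_ind: q => y.
rewrite -[_ * _]upiM !upi_star -[RHS]upiM.
by congr upi; apply: linfP_eq => n; rewrite /= starM.
Qed.

Lemma unorm_eq0 (q : ultra) : unorm q = 0 -> q = 0.
Proof.
elim/ultra_ind: q => x x0; rewrite -upi0; apply/upi_eq.
by rewrite subr0; apply/null_seqP; rewrite -x0; exact: unorm_cvg.
Qed.

Lemma unormD (p q : ultra) : unorm (p + q) <= unorm p + unorm q.
Proof.
elim/ultra_ind: p => x; elim/ultra_ind: q => y; rewrite -upiD.
apply: (ler_cvg_to (unorm_cvg _) (cvgD (unorm_cvg x) (unorm_cvg y))).
by apply: (@filterE _ U) => n; exact: cnormD.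
Qed.

Lemma unormZ c (q : ultra) : unorm (c *: q) = Normc.normc c * unorm q.
Proof.
elim/ultra_ind: q => x; rewrite -[_ *: _]upiZ; apply: unormP.
rewrite (_ : (fun n => _) = fun n => Normc.normc c * cnorm (x n)).
  by apply: cvgMr; exact: unorm_cvg.
by apply/funext => n; exact: cnormZ.
Qed.

Lemma unormM (p q : ultra) : unorm (p * q) <= unorm p * unorm q.
Proof.
elim/ultra_ind: p => x; elim/ultra_ind: q => y; rewrite -[_ * _]upiM.
apply: (ler_cvg_to (unorm_cvg _) (cvgM (unorm_cvg x) (unorm_cvg y))).
by apply: (@filterE _ U) => n; exact: cnormM.
Qed.

Lemma unorm_star (q : ultra) : unorm (ustar q * q) = unorm q ^+ 2.
Proof.
elim/ultra_ind: q => x; rewrite upi_star -[_ * _]upiM; apply: unormP.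
rewrite (_ : (fun n => _) = fun n => cnorm (x n) * cnorm (x n)).
  by rewrite expr2; apply: cvgM; exact: unorm_cvg.
by apply/funext => n; rewrite -expr2; exact: cnorm_star.
Qed.

Lemma unorm_complete (u : nat -> ultra) :
  cauchy_for unorm u -> exists l : ultra, cvg_for unorm u l.
Proof.
move=> uC.
pose d k : R := 2^-1 ^+ k.
have d_gt0 k : 0 < d k by rewrite exprn_gt0// invr_gt0.
have dS k : d k.+1 = d k / 2 by rewrite /d exprSr.
have [phi phiP] := choice (fun k => uC _ (d_gt0 k)).
pose psi k := (\sum_(i < k.+1) phi i)%N.
have le_psi k : (phi k <= psi k)%N by rewrite /psi big_ord_recr leq_addl.
have psiS k : (psi k <= psi k.+1)%N by rewrite /psi [leqRHS]big_ord_recr leq_addr.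
pose x k : L := urepr (u (psi k)).
have upix k : upi (x k) = u (psi k) by exact: ureprK.
pose y := fix y k : nat -> A := if k is k'.+1 then
  fun n => if cnorm (x k n - y k' n) < d k' then x k n else y k' n
  else x 0%N.
have ySE k n : y k.+1 n =
  if cnorm (x k.+1 n - y k n) < d k then x k.+1 n else y k n by [].
have dy k n : cnorm (y k.+1 n - y k n) <= d k.
  by rewrite ySE; case: ifPn => [/ltW//|_]; rewrite subrr cnorm0 ltW.
have xy k : \forall n \near U, y k n = x k n.
  elim: k => [|k IHk]; first exact: filterE.
  have lt_d : unorm (upi (x k.+1 - x k)) < d k.
    by rewrite upiB !upix; apply: phiP; rewrite ?(leq_trans (le_psi k)).
  have h : \forall n \near U, cnorm ((x k.+1 - x k) n) < d k.
    exact: (cvgr_lt _ (unorm_cvg _) _ lt_d).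
  by apply: filterS2 IHk h => n e hn; rewrite ySE e hn.
have dyj k j n : cnorm (y (k + j)%N n - y k n) <= 2 * d k - 2 * d (k + j)%N.
  elim: j => [|j IHj]; first by rewrite addn0 !subrr cnorm0.
  rewrite addnS -(subrK (y (k + j)%N n) (y _.+1 n)) -addrA.
  apply: (le_trans (cnormD _ _)); apply: (le_trans (lerD (dy _ _) IHj)).
  rewrite dS; lra.
have dy2 k m n : (k <= m)%N -> cnorm (y m n - y k n) <= 2 * d k.
  move=> km; rewrite -(subnKC km); apply: (le_trans (dyj _ _ _)).
  by rewrite gerBl mulr_ge0// ltW.
have d_small e : 0 < e -> exists k, 4 * d k < e.
  move=> e0.
  have /cvgrPdist_lt : d @ \oo --> (0 : R).
    by apply: cvg_expr; rewrite ger0_norm ?invr_ge0// invf_lt1// ltr1n.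
  move=> /(_ (e / 4)) [|N _ /(_ N (leqnn N))]; first by rewrite divr_gt0.
  rewrite sub0r normrN ger0_norm ?ltW// ltr_pdivlMr// mulrC => h.
  by exists N.
have yC n : cauchy_for cnorm (y ^~ n).
  move=> e /d_small[k ke]; exists k => m m' km km'.
  rewrite -(subrK (y k n) (y m n)) -addrA; apply: le_lt_trans ke.
  apply: (le_trans (cnormD _ _)); rewrite [cnorm (y k n - _)]cnormB.
  by apply: (le_trans (lerD (dy2 _ _ _ km) (dy2 _ _ _ km'))); rewrite -mulrDl -natrD.
have [z zP] := choice (fun n => cnorm_complete (yC n)).
have zy k n : cnorm (z n - y k n) <= 2 * d k.
  have h : (fun m => cnorm (y m n - z n) + 2 * d k) @ \oo --> 0 + 2 * d k.
    by apply: cvgD; [exact: zP|exact: cvg_cst].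
  rewrite -[leRHS]add0r; apply: (ler_cvg_to (cvg_cst _) h).
  exists k => // m /= km; rewrite (cnormB (y m n)).
  have := cnormD (z n - y m n) (y m n - y k n); rewrite addrA subrK => /le_trans.
  by apply; rewrite lerD2l; exact: dy2.
have zB : z \in bounded_seq (A := A).
  have [M xM] := linf_bounded (x 0%N); apply/asboolP; exists (2 * d 0%N + M) => n.
  rewrite -(subrK (y 0%N n) (z n)); apply: (le_trans (cnormD _ _)).
  exact: lerD (zy 0%N n) (xM n).
pose w : L := Linf zB; exists (upi w).
have uw k : unorm (u (psi k) - upi w) <= 2 * d k.
  rewrite -upix -upiB; apply: unorm_le; apply: filterS (xy k) => n e.
  have -> : (x k - w) n = x k n - z n by [].
  by rewrite -e cnormB; exact: zy.
apply/cvgrPdist_lt => e /d_small[k ke]; exists (psi k) => // m /= km.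
rewrite sub0r normrN; apply: le_lt_trans ke.
rewrite ger0_norm ?unorm_ge0// -(subrK (u (psi k)) (u m)) -addrA.
apply: (le_trans (unormD _ _)).
have h1 : unorm (u m - u (psi k)) <= 2 * d k.
  apply: (@le_trans _ _ (d k)).
    by apply/ltW/phiP; rewrite ?(leq_trans (le_psi k)).
  by rewrite mulr_natl mulr2n lerDl ltW.
by apply: (le_trans (lerD h1 (uw k))); rewrite -mulrDl -natrD.
Qed.

Definition ultrapower : cstarAlg R :=
  CStarAlg ustarK ustarD ustarZ ustarM unorm_eq0 unormD unormZ unormM
    unorm_star unorm_complete.

End Ultrapower.

Definition KEP (R : realType) (O2 : cstarAlg R) (U : set_system nat)
    (UU : UltraFilter U) : Prop :=
  forall A : cstarAlg R, separable A -> embeds A (ultrapower O2 UU).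

(* *-polynomials over the complex numbers in n non-commuting variables *)
Inductive starpoly (R : realType) (n : nat) : Type :=
| SVar of 'I_n
| SConst of R[i]
| SAdd of starpoly R n & starpoly R n
| SMul of starpoly R n & starpoly R n
| SStar of starpoly R n.

(* [formula R n] has its free variables among n ones; [FSup r phi] and
   [FInf r phi] bind variable 0 of phi, which ranges over the closed ball of
   radius r. *)
Inductive formula (R : realType) : nat -> Type :=
| FNorm n of starpoly R n : formula R n
| FConn n k (h : 'rV[R]_k -> R) of continuous h & ('I_k -> formula R n) :
    formula R n
| FSup n of nat & formula R n.+1 : formula R n
| FInf n of nat & formula R n.+1 : formula R n.

Fixpoint quantifier_free (R : realType) n (phi : formula R n) : Prop :=
  match phi with
  | FNorm _ _ => True
  | FConn _ _ _ _ args => forall i, quantifier_free (args i)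
  | FSup _ _ _ | FInf _ _ _ => False
  end.

Section Semantics.
Variables (R : realType) (A : cstarAlg R).

Fixpoint speval n (t : starpoly R n) (e : n.-tuple A) : A :=
  match t with
  | SVar i => tnth e i
  | SConst c => c%:A
  | SAdd t1 t2 => speval t1 e + speval t2 e
  | SMul t1 t2 => speval t1 e * speval t2 e
  | SStar t1 => star (speval t1 e)
  end.

Definition cball (r : nat) : set A := [set x | cnorm x <= r%:R].

(* The sets below are non-empty and bounded, since formulas are bounded on
   bounded sets; hence [sup] and [inf] do not take their default values. *)
Fixpoint feval n (phi : formula R n) : n.-tuple A -> R :=
  match phi with
  | FNorm _ t => fun e => cnorm (speval t e)
  | FConn _ _ h _ args => fun e => h (\row_i feval (args i) e)
  | FSup _ r psi => fun e => sup [set feval psi [tuple of x :: e] | x in cball r]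
  | FInf _ r psi => fun e => inf [set feval psi [tuple of x :: e] | x in cball r]
  end.

Definition tball (n m : nat) : set (m.-tuple A) :=
  [set b | forall i, cball n (tnth b i)].

End Semantics.

Arguments cball {R} A r.
Arguments tball {R} A n {m}.

Definition sentence (R : realType) : Type := formula R 0.

(* The sentence s stands for the condition s = 0. The structures are the
   unital C*-algebras. *)
Definition theory (R : realType) : Type := set (sentence R).

Definition models (R : realType) (T : theory R) (A : cstarAlg R) : Prop :=
  forall s : sentence R, T s -> feval s ([tuple] : 0.-tuple A) = 0.

Definition cstar_theory (R : realType) : theory R :=
  [set s | forall A : cstarAlg R, feval s ([tuple] : 0.-tuple A) = 0].

Arguments cstar_theory R : clear implicits.

Lemma models_cstar_theory (R : realType) (A : cstarAlg R) :
  models (cstar_theory R) A.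
Proof. by move=> s; exact. Qed.

(* An inclusion of A in B is rendered by an embedding f : A -> B. *)
Definition existentially_closed (R : realType) (T : theory R)
    (A : cstarAlg R) : Prop :=
  models T A /\
  forall (B : cstarAlg R) (f : A -> B), models T B -> is_embedding f ->
  forall (p q : nat) (phi : formula R (p + q)), quantifier_free phi ->
  forall (n : nat) (a : p.-tuple A), (0 < n)%N ->
    inf [set feval phi [tuple of a ++ b] | b in tball A n] =
    inf [set feval phi [tuple of map f a ++ c] | c in tball B n].

Definition model_complete (R : realType) (T : theory R) : Prop :=
  forall A : cstarAlg R, models T A -> existentially_closed T A.

Definition model_companion (R : realType) (T T0 : theory R) : Prop :=
  [/\ model_complete T,
      forall A : cstarAlg R, models T A ->
        exists B : cstarAlg R, models T0 B /\ embeds A B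
    & forall A : cstarAlg R, models T0 A ->
        exists B : cstarAlg R, models T B /\ embeds A B].

(* Main.v *)
(* A companion T has a model M containing O_2, hence all matrix algebras, and the
   ultrapower A of M is a model of T by Los's theorem. The identity, clock, chirp
   and Fourier matrices of size n form a quantum expander; let a_1, ..., a_4 in A
   be their limits. The trace on each matrix algebra extends to a map on M, so
   |1 - sum_i (a_i^* y_i a_i - y_i)| >= 1 for all y_i in A. On the other hand the
   spectral gap bounds |sum_i c_i (x) a_i| by a constant C < 4 for all contractive
   matrices c_i. By a Hahn-Banach argument in each GNS space of A, this bound
   yields contractions y_i on these spaces with
   |1 - sum_i (a_i^* y_i a_i - y_i)| < 1, in a C*-algebra B containing A.
   Since B embeds in a model of T, A is not existentially closed. *)

From HB Require Import structures.
From mathcomp Require Import all_boot all_order all_algebra.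
From mathcomp Require Import generic_quotient ring_quotient complex ring lra.
From mathcomp Require Import mathcomp_extra boolp classical_sets functions reals.
From mathcomp Require Import topology normedtype sequences trigo spectral zify.
Require Import Defs.

Set Implicit Arguments.
Unset Strict Implicit.
Unset Printing Implicit Defensive.

Import Order.TTheory GRing.Theory Num.Theory.
Import numFieldNormedType.Exports.
Import ComplexField.

Local Open Scope classical_set_scope.
Local Open Scope ring_scope.
Local Open Scope complex_scope.

(** * The Hahn-Banach theorem *)

(** The two estimates pull in opposite directions, and the ultrapower reconciles them. At a fixed
    size [n] no constant below 4 is possible: if [c_i] is the entrywise conjugate of [a_i], then
    [sum_i c_i (x) a_i] multiplies the maximally entangled vector by 4. Against coefficients with at
    most [n / 4] columns the spectral gap does yield such a constant. Along the ultrafilter this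
    restriction disappears, while the trace estimate, valid at every size, survives. Passing from
    the bound to the [y_i] is a duality. The bound says that a gauge on families of quadratic
    expressions is nonnegative at 0. A linear functional below this gauge sends rank-one forms to
    positive forms on the GNS space, and the [y_i] are these forms divided by [4 C]. Positivity of
    [1 - sum_i (a_i^* y_i a_i - y_i)] then turns the norm estimate into a one-sided inequality
    between quadratic forms. *)

Section HahnBanach.
Variables (R : realType) (V : lmodType R[i]) (D : set V).
Hypothesis D_add : forall x y, D x -> D y -> D (x + y).
Hypothesis D_scale : forall (t : R) x, D x -> D (t%:C *: x).

Let D0 x : D x -> D 0.
Proof. by move=> /(D_scale 0); rewrite scale0r. Qed.

Let DN x : D x -> D (- x).
Proof. by move=> /(D_scale (-1)); rewrite rmorphN1 scaleN1r. Qed.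

Definition sublinear (p : V -> R) : Prop :=
  (forall x y, D x -> D y -> p (x + y) <= p x + p y) /\
  (forall (t : R) x, 0 < t -> D x -> p (t%:C *: x) = t * p x).

Lemma sublinear0 p : sublinear p -> D 0 -> p 0 = 0.
Proof.
move=> [_ ph] D00; have := ph 2 0 (ltr0n _ 2) D00; rewrite scaler0; lra.
Qed.

Lemma sublinear_opp_ge p x : sublinear p -> D x -> - p (- x) <= p x.
Proof.
move=> ps Dx; have := ps.1 _ _ Dx (DN Dx).
rewrite subrr (sublinear0 ps); [lra | exact: D0 Dx].
Qed.

Lemma inf_scale (S : set R) (c : R) : 0 < c -> has_inf S ->
  inf [set c * x | x in S] = c * inf S.
Proof.
move=> c0 [[x0 Sx0] [l Sl]]; apply/eqP; rewrite eq_le; apply/andP; split.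
  rewrite -ler_pdivrMl//; apply: lb_le_inf; first by exists x0.
  move=> x Sx; rewrite ler_pdivrMl//; apply: ge_inf.
    by exists (c * l) => _ [y Sy <-]; rewrite ler_pM2l//; exact: Sl.
  by exists x.
apply: lb_le_inf; first by exists (c * x0), x0.
move=> _ [x Sx <-]; rewrite ler_pM2l//; apply: ge_inf => //.
by exists l.
Qed.

(** The witness is [m y], the infimum over [t >= 0] of [q (y + t h) - t q h]; the values [t = 0] and
    [t = 1] give the two bounds. The second bound makes a minimal sublinear functional
    superadditive, and at [x = - h] it pins down the value at [h] of linear functionals below
    [m]. *)
Lemma sublinear_shift (q : V -> R) h : sublinear q -> D h ->
  exists m : V -> R, [/\ sublinear m, forall x, D x -> m x <= q x &
    forall x, D x -> m x <= q (x + h) - q h].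
Proof.
move=> qs Dh.
pose E y := [set q (y + t%:C *: h) - t * q h | t in [set t : R | 0 <= t]].
have Dyt y (t : R) : D y -> D (y + t%:C *: h).
  by move=> Dy; apply: D_add => //; exact: D_scale.
have qth (t : R) : 0 <= t -> q (t%:C *: h) = t * q h.
  rewrite le_eqVlt => /predU1P[<-|t0]; last exact: qs.2.
  by rewrite scale0r mul0r (sublinear0 qs)//; exact: D0 Dh.
have Eq y : D y -> E y (q y).
  by move=> Dy; exists 0 => //=; rewrite scale0r addr0 mul0r subr0.
have Elb y : D y -> has_inf (E y).
  move=> Dy; split; first by exists (q y); exact: Eq.
  exists (- q (- y)) => _ [t /= t0 <-].
  have := qs.1 _ _ (Dyt y t Dy) (DN Dy).
  rewrite addrAC subrr add0r qth//; lra.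
pose m y := inf (E y).
have m_le y t : D y -> 0 <= t -> m y <= q (y + t%:C *: h) - t * q h.
  by move=> Dy t0; apply: ge_inf; [exact: (Elb y Dy).2|exists t].
have le_m y c : D y -> (forall t, 0 <= t -> c <= q (y + t%:C *: h) - t * q h) ->
    c <= m y.
  move=> Dy hc; apply: lb_le_inf; first exact: (Elb y Dy).1.
  by move=> _ [t /= t0 <-]; exact: hc.
exists m; split.
- split=> [y z Dy Dz|c y c0 Dy].
    rewrite -lerBlDr; apply: (le_m) => // t t0; rewrite lerBlDr -lerBlDl.
    apply: (le_m) => // s s0; rewrite lerBlDr.
    apply: le_trans (m_le _ (t + s) (D_add Dy Dz) (addr_ge0 t0 s0)) _.
    have := qs.1 _ _ (Dyt y t Dy) (Dyt z s Dz).
    rewrite addrACA -scalerDl -rmorphD mulrDl/=; lra.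
  rewrite /m (_ : E (c%:C *: y) = [set c * z | z in E y]).
    by apply: inf_scale => //; exact: Elb.
  have cE t : 0 <= t -> q (c%:C *: y + (c * t)%:C *: h) - (c * t) * q h =
      c * (q (y + t%:C *: h) - t * q h).
    by move=> t0; rewrite rmorphM -scalerA -scalerDr qs.2//; [ring|exact: Dyt].
  apply/seteqP; split=> [_ [t /= t0 <-]|_ [_ [t /= t0 <-] <-]].
    have tE : t = c * (t / c) by rewrite mulrC divfK// gt_eqF.
    exists (q (y + (t / c)%:C *: h) - (t / c) * q h).
      by exists (t / c) => //=; rewrite divr_ge0// ltW.
    by rewrite -cE -?tE// divr_ge0// ltW.
  by exists (c * t); [rewrite /= mulr_ge0// ltW|exact: cE].
- by move=> y Dy; apply: ge_inf; [exact: (Elb y Dy).2|exact: Eq].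
- move=> y Dy; apply: le_trans (m_le y 1 Dy ler01) _.
  by rewrite mul1r rmorph1 scale1r.
Qed.

(** Zorn's lemma yields a minimal sublinear functional below [p]; since its shifts lie below it,
    minimality and [sublinear_shift] make it additive. *)
Lemma hahn_banach (p : V -> R) : sublinear p ->
  exists L : V -> R, [/\ forall x, D x -> L x <= p x,
    forall x y, D x -> D y -> L (x + y) = L x + L y &
    forall (t : R) x, D x -> L (t%:C *: x) = t * L x].
Proof.
move=> ps.
pose T := {q : V -> R | sublinear q /\ forall x, D x -> q x <= p x}.
have Tp : sublinear p /\ forall x, D x -> p x <= p x by [].
(* The order is reversed, so that maximal elements are minimal functionals; as it compares on [D]
   only, it is merely a preorder. *)
pose r (q1 q2 : T) : bool := `[< forall x, D x -> sval q2 x <= sval q1 x >].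
have [||A Atot|[q [qs qp]] qmin] :=
  @ZL_preorder T (exist _ p Tp) r.
- by move=> t; apply/asboolP.
- move=> q1 q2 q3 /asboolP h1 /asboolP h2; apply/asboolP => x Dx.
  by apply: le_trans (h2 x Dx) (h1 x Dx).
- have [[q0 Aq0]|A0] := pselect (exists q0, A q0); last first.
    by exists (exist _ p Tp) => s As; case: A0; exists s.
  pose E x := [set sval q x | q in A].
  have Elb x : D x -> has_inf (E x).
    move=> Dx; split; first by exists (sval q0 x), q0.
    exists (- p (- x)) => _ [[q [qs qp]] Aq <-] /=.
    apply: le_trans (sublinear_opp_ge qs Dx); rewrite lerN2.
    exact/qp/DN.
  pose m x := inf (E x).
  have m_le q x : A q -> D x -> m x <= sval q x.
    by move=> Aq Dx; apply: ge_inf; [exact: (Elb x Dx).2|exists q].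
  have le_m x c : D x -> (forall q, A q -> c <= sval q x) -> c <= m x.
    move=> Dx h; apply: lb_le_inf; first exact: (Elb x Dx).1.
    by move=> _ [q Aq <-]; exact: h.
  have ms : sublinear m /\ forall x, D x -> m x <= p x.
    split; last first.
      by move=> x Dx; apply: le_trans (m_le _ _ Aq0 Dx) _; exact: (svalP q0).2.
    split=> [x y Dx Dy|t x t0 Dx].
      have h q1 q2 : A q1 -> A q2 -> m (x + y) <= sval q1 x + sval q2 y.
        move=> A1 A2; have [/asboolP h|/asboolP h] := Atot _ _ A1 A2.
          apply: le_trans (m_le _ _ A2 (D_add Dx Dy)) _.
          apply: le_trans ((svalP q2).1.1 _ _ Dx Dy) _.
          by rewrite lerD2r; exact: h.
        apply: le_trans (m_le _ _ A1 (D_add Dx Dy)) _.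
        apply: le_trans ((svalP q1).1.1 _ _ Dx Dy) _.
        by rewrite lerD2l; exact: h.
      rewrite -lerBlDr; apply: (le_m) => // q1 A1; rewrite lerBlDr -lerBlDl.
      by apply: (le_m) => // q2 A2; rewrite lerBlDl; exact: h.
    rewrite /m (_ : E (t%:C *: x) = [set t * z | z in E x]).
      by apply: inf_scale => //; exact: Elb.
    apply/seteqP; split=> [_ [q Aq <-]|_ [_ [q Aq <-] <-]].
      by exists (sval q x); [exists q|rewrite (svalP q).1.2].
    by exists q => //; rewrite (svalP q).1.2.
  by exists (exist _ m ms) => q Aq; apply/asboolP => x Dx; exact: m_le.
have key x h : D x -> D h -> q x + q h <= q (x + h).
  move=> Dx Dh; have [m [ms mq mh]] := sublinear_shift qs Dh.
  have mp : sublinear m /\ forall y, D y -> m y <= p y.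
    by split=> // y Dy; exact: le_trans (mq _ Dy) (qp _ Dy).
  have /asboolP/(_ x Dx)/= : r (exist _ m mp) (exist _ q (conj qs qp)).
    by apply: qmin; apply/asboolP => y Dy; exact: mq.
  by move=> /le_trans /(_ (mh x Dx)); rewrite lerBrDr.
have q_add x y : D x -> D y -> q (x + y) = q x + q y.
  by move=> Dx Dy; apply/eqP; rewrite eq_le qs.1// key.
have qN x : D x -> q (- x) = - q x.
  move=> Dx; have := q_add _ _ Dx (DN Dx).
  by rewrite subrr (sublinear0 qs (D0 Dx)); lra.
exists q; split=> // t x Dx; have [t0|t0|->] := ltgtP t 0.
- have := qN _ (D_scale (- t) Dx); rewrite (qs.2 (- t))// ?oppr_gt0//.
  by rewrite rmorphN scaleNr opprK => ->; rewrite mulNr opprK.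
- exact: qs.2.
- by rewrite scale0r mul0r (sublinear0 qs (D0 Dx)).
Qed.

(** A linear functional below the shift of [p] by [h] satisfies [L (- h) <= - p h], the missing
    inequality at [h]. *)
Lemma hahn_banach_at (p : V -> R) h : sublinear p -> D h ->
  exists L : V -> R, [/\ forall x, D x -> L x <= p x,
    forall x y, D x -> D y -> L (x + y) = L x + L y,
    forall (t : R) x, D x -> L (t%:C *: x) = t * L x & L h = p h].
Proof.
move=> ps Dh; have [m [ms mp mh]] := sublinear_shift ps Dh.
have [L [Lm LD LZ]] := hahn_banach ms.
have Lp x : D x -> L x <= p x by move=> Dx; exact: le_trans (Lm _ Dx) (mp _ Dx).
exists L; split=> //; apply/eqP; rewrite eq_le Lp//=.
have := le_trans (Lm _ (DN Dh)) (mh _ (DN Dh)).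
rewrite addNr (sublinear0 ps (D0 Dh)).
have := LZ (-1) h Dh; rewrite rmorphN1 scaleN1r => ->; lra.
Qed.

End HahnBanach.

(** * Real scalars and elementary growth estimates *)

Section RealScalars.
Variable R : realType.

Lemma normc_real (t : R) : Normc.normc t%:C = `|t|.
Proof. by rewrite /= expr0n addr0 sqrtr_sqr. Qed.

Lemma scalerrA (V : lmodType R[i]) (s t : R) (x : V) :
  s%:C *: (t%:C *: x) = (s * t)%:C *: x.
Proof. by rewrite scalerA -rmorphM. Qed.

Lemma scale1rr (V : lmodType R[i]) (x : V) : (1 : R)%:C *: x = x.
Proof. by rewrite rmorph1 scale1r. Qed.

Lemma scalerDlr (V : lmodType R[i]) (s t : R) (x : V) :
  (s + t)%:C *: x = s%:C *: x + t%:C *: x.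
Proof. by rewrite -scalerDl -rmorphD. Qed.

Lemma scaleNrr (V : lmodType R[i]) (t : R) (x : V) :
  (- t)%:C *: x = - (t%:C *: x).
Proof. by rewrite -scaleNr -rmorphN. Qed.

Lemma scalerBlr (V : lmodType R[i]) (s t : R) (x : V) :
  (s - t)%:C *: x = s%:C *: x - t%:C *: x.
Proof. by rewrite scalerDlr scaleNrr. Qed.

(** A linear factor is lost when roots are extracted. Only the exponents [2 ^ p] occur, for which
    the C*-identity computes the norm of a power of a self-adjoint element. If [x = T (1 + d)], the
    square of Bernoulli's inequality makes [(1 + d)^(2N)] grow quadratically in [N], against a
    linear factor. *)
Lemma le_of_pow2_growth (x T K : R) : 0 <= T ->
  (forall p, x ^+ (2 ^ p)%N <= K * (2 ^ p)%:R * T ^+ (2 ^ p)%N) -> x <= T.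
Proof.
move=> T0 h; rewrite leNgt; apply/negP => Tx.
have [T0'|Tpos] := eqVneq T 0.
  by have := h 0%N; rewrite expn0 !expr1 T0' mulr0; rewrite T0' in Tx; lra.
have {}Tpos : 0 < T by rewrite lt_neqAle eq_sym Tpos.
pose d := x / T - 1.
have d0 : 0 < d by rewrite /d subr_gt0 ltr_pdivlMr// mul1r.
have xE : x = T * (1 + d) by rewrite /d addrC subrK mulrC divfK// gt_eqF.
have bern n : 1 + n%:R * d <= (1 + d) ^+ n.
  elim: n => [|n IHn]; first by rewrite mul0r addr0 expr0.
  rewrite exprS; apply: le_trans (ler_wpM2l _ IHn); last lra.
  rewrite -natr1 -subr_ge0.
  rewrite (_ : _ - _ = n%:R * d ^+ 2); last by ring.
  by rewrite mulr_ge0// sqr_ge0.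
have {h} key p : (2 ^ p)%:R * d ^+ 2 <= 2 * K.
  have := h p.+1; rewrite xE exprMn mulrC ler_pM2r ?exprn_gt0//.
  rewrite expnS mulnC exprM => {}h; set N := (2 ^ p)%N in h *.
  have N0 : 0 < N%:R :> R by rewrite ltr0n expn_gt0.
  have : (N%:R * d) ^+ 2 <= K * (N * 2)%:R.
    have dp : 0 <= 1 + d by lra.
    apply: le_trans h; rewrite ler_sqr ?nnegrE; first by apply: le_trans _ (bern N); lra.
      by rewrite mulr_ge0// ltW.
    by rewrite exprn_ge0.
  rewrite natrM (_ : (_ * _) ^+ 2 = N%:R * (N%:R * d ^+ 2)); last by ring.
  by rewrite (_ : K * _ = N%:R * (2 * K)) ?ler_pM2l//; ring.
have := archi_boundP (normr_ge0 (2 * K / d ^+ 2)); set n := Num.bound _ => hn.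
have d2 : 0 < d ^+ 2 by rewrite exprn_gt0.
have := key n; apply/negP; rewrite -ltNge -ltr_pdivrMr//.
apply: le_lt_trans (ler_norm _) _; apply: lt_trans hn _.
by rewrite ltr_nat ltn_expl.
Qed.

Lemma expr_small (q e : R) : 0 <= q < 1 -> 0 < e ->
  exists N, forall n, (N <= n)%N -> q ^+ n < e.
Proof.
move=> /andP[q0 q1] e0.
have /cvgrPdist_lt : (fun n => q ^+ n) @ \oo --> (0 : R).
  by apply: cvg_expr; rewrite ger0_norm.
move=> /(_ e e0) [N _ hN]; exists N => n Nn; have := hN n Nn.
by rewrite sub0r normrN ger0_norm// exprn_ge0.
Qed.

Lemma le0_of_le_small (x K : R) : (forall e, 0 < e -> x <= K * e) -> x <= 0.
Proof.
move=> h; rewrite leNgt; apply/negP => x0.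
have K1 : 0 < `|K| + 1 by rewrite ltr_wpDl.
have := h (x / (`|K| + 1) / 2) _; rewrite !divr_gt0// => /(_ isT).
have -> : K * (x / (`|K| + 1) / 2) = (K / (`|K| + 1)) * (x / 2).
  by field; rewrite gt_eqF.
have : K / (`|K| + 1) <= 1 by rewrite ler_pdivrMr// mul1r; have := ler_norm K; lra.
nra.
Qed.

End RealScalars.

(** * States on C*-algebras *)

Section Positivity.
Variables (R : realType) (A : cstarAlg R).
Implicit Types x y z h k : A.

Definition sa x : Prop := star x = x.

Lemma cnormZr (t : R) x : cnorm (t%:C *: x) = `|t| * cnorm x.
Proof. by rewrite cnormZ normc_real. Qed.

Lemma cnorm_scalar (t : R) : cnorm (t%:C%:A : A) = `|t|.
Proof. by rewrite cnormZr cnorm1 mulr1. Qed.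

Lemma starZr (t : R) x : star (t%:C *: x) = t%:C *: star x.
Proof. by rewrite starZ conjc_real. Qed.

Lemma starB x y : star (x - y) = star x - star y.
Proof. by rewrite starD starN. Qed.

Lemma star_scalar (t : R) : star (t%:C%:A : A) = t%:C%:A.
Proof. by rewrite starZr star1. Qed.

Lemma star_exp x n : star (x ^+ n) = star x ^+ n.
Proof.
by elim: n => [|n IHn]; rewrite ?expr0 ?star1// exprS starM IHn exprSr.
Qed.

Lemma sa0 : sa 0. Proof. exact: star0. Qed.
Lemma sa1 : sa 1. Proof. exact: star1. Qed.
Lemma saD x y : sa x -> sa y -> sa (x + y).
Proof. by move=> hx hy; rewrite /sa starD hx hy. Qed.
Lemma saN x : sa x -> sa (- x). Proof. by move=> hx; rewrite /sa starN hx. Qed.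
Lemma saB x y : sa x -> sa y -> sa (x - y).
Proof. by move=> hx hy; rewrite /sa starB hx hy. Qed.
Lemma saZ (t : R) x : sa x -> sa (t%:C *: x).
Proof. by move=> hx; rewrite /sa starZr hx. Qed.
Lemma sa_scalar (t : R) : sa (t%:C%:A). Proof. exact: star_scalar. Qed.
Lemma saM x y : sa x -> sa y -> GRing.comm x y -> sa (x * y).
Proof. by move=> hx hy xy; rewrite /sa starM hx hy xy. Qed.
Lemma saX x n : sa x -> sa (x ^+ n).
Proof. by move=> hx; rewrite /sa star_exp hx. Qed.
Lemma sa_sq x : sa (star x * x). Proof. by rewrite /sa starM starK. Qed.
Hint Resolve sa0 sa1 sa_scalar sa_sq : core.

Lemma comm_scalar (c : R[i]) x : GRing.comm x (c%:A).
Proof. by rewrite /GRing.comm -scalerAr mulr1 -scalerAl mul1r. Qed.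

Lemma commZ (c : R[i]) x y : GRing.comm x y -> GRing.comm x (c *: y).
Proof. by move=> xy; rewrite /GRing.comm -scalerAr xy -scalerAl. Qed.

Lemma cnorm_sa_pow x p : sa x -> cnorm (x ^+ (2 ^ p)%N) = cnorm x ^+ (2 ^ p)%N.
Proof.
move=> hx; elim: p => [|p IHp]; first by rewrite expn0 !expr1.
have -> : (2 ^ p.+1 = 2 ^ p + 2 ^ p)%N by rewrite expnS mul2n -addnn.
rewrite !exprD -{1}(saX (2 ^ p) hx) cnorm_star IHp expr2//.
Qed.

(** The element [u = s + i k] satisfies [u^* u = rho^2], and [s] is its real part. *)
Lemma cnorm_cos (s k : A) (rho : R) : 0 <= rho -> sa s -> sa k -> GRing.comm s k ->
  s * s + k * k = (rho ^+ 2)%:C%:A -> cnorm s <= rho.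
Proof.
move=> r0 hs hk sk e; pose u := s + 'i *: k.
have su : star u = s - 'i *: k.
  rewrite starD starZ hs hk (_ : conjc 'i = - 'i) ?scaleNr//.
  by apply/eqP; rewrite eq_complex /= oppr0 !eqxx.
have uu : star u * u = (rho ^+ 2)%:C%:A.
  rewrite su -e mulrDr !mulrBl -!scalerAl -!scalerAr -sk scalerA.
  rewrite (_ : 'i * 'i = -1); last by rewrite -expr2 sqr_i.
  by rewrite scaleN1r opprK addrA subrK.
have nu : cnorm u = rho.
  apply/eqP; rewrite -(@eqrXn2 _ 2)// ?cnorm_ge0// -cnorm_star uu.
  by rewrite cnorm_scalar ger0_norm ?sqr_ge0.
have : cnorm (2%:C *: s) <= 2 * rho.
  rewrite (_ : 2%:C *: s = u + star u).
    by apply: le_trans (cnormD _ _) _; rewrite cnorm_star_eq nu; lra.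
  by rewrite su /u addrACA subrr addr0 rmorphMn rmorph1 mulr2n scalerDl !scale1r.
by rewrite cnormZr ger0_norm// ler_pM2l.
Qed.

(** Fixed-point iteration for [l = (c + l^2) / 2], which says that [(1 - l)^2 = 1 - c]. On the ball
    of radius [rho] the map is Lipschitz with constant [rho < 1]. The iterates are polynomials in
    [c], whence the commutation clause. *)
Lemma sqrt_one_minus (c : A) (rho : R) : sa c -> cnorm c <= rho -> rho < 1 ->
  exists s, [/\ sa s, s * s = 1 - c & forall z, GRing.comm z c -> GRing.comm z s].
Proof.
move=> hc cr r1; have r0 : 0 <= rho by apply: le_trans cr; exact: cnorm_ge0.
pose y := fix y n : A := if n is n'.+1 then (2^-1)%:C *: (c + y n' * y n') else 0.
have yS n : y n.+1 = (2^-1)%:C *: (c + y n * y n) by [].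
have ysa n : sa (y n).
  by elim: n => [|n IHn] //=; apply: saZ; apply: saD => //; exact: saM.
have half0 : `|2^-1 : R| = 2^-1 by rewrite ger0_norm// invr_ge0.
have yn n : cnorm (y n) <= rho.
  elim: n => [|n IHn]; first by rewrite /= cnorm0.
  rewrite yS cnormZr half0.
  have := cnormD c (y n * y n); have := cnormM (y n) (y n).
  have := cnorm_ge0 (y n); nra.
have sqB (u v : A) : u * u - v * v = (u - v) * u + v * (u - v).
  by rewrite mulrBl mulrBr addrA subrK.
have nsqB (u v : A) M : cnorm u <= M -> cnorm v <= M ->
    cnorm (u * u - v * v) <= 2 * M * cnorm (u - v).
  move=> uM vM; rewrite sqB; apply: le_trans (cnormD _ _) _.
  have := cnormM (u - v) u; have := cnormM v (u - v).
  have := cnorm_ge0 (u - v); have := cnorm_ge0 u; have := cnorm_ge0 v; nra.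
have yd n : cnorm (y n.+1 - y n) <= rho ^+ n * rho.
  elim: n => [|n IHn].
    by rewrite expr0 mul1r /= subr0 mulr0 addr0 cnormZr half0; have := cnorm_ge0 c; lra.
  rewrite (_ : y n.+2 - _ = (2^-1)%:C *: (y n.+1 * y n.+1 - y n * y n)); last first.
    by rewrite [X in _ - X]yS [y n.+2]yS -scalerBr opprD addrACA subrr add0r.
  rewrite cnormZr half0.
  have := nsqB _ _ _ (yn n.+1) (yn n).
  rewrite exprS; have := cnorm_ge0 (y n.+1 - y n); nra.
have ydk n j : cnorm (y (n + j)%N - y n) * (1 - rho) <= rho ^+ n * rho * (1 - rho ^+ j).
  elim: j => [|j IHj]; first by rewrite addn0 expr0 !subrr cnorm0 mul0r mulr0.
  have := cnormD (y (n + j).+1 - y (n + j)%N) (y (n + j)%N - y n).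
  rewrite addrA subrK -addnS; have := yd (n + j)%N; rewrite -addnS.
  rewrite exprD exprS.
  move=> h1 h2; have r1' : 0 <= 1 - rho by lra.
  have := ler_wpM2r r1' h1; have := ler_wpM2r r1' h2. lra.
have yC (e : R) : 0 < e -> exists K, forall n, (K <= n)%N -> cnorm (y n - y K) < e.
  move=> e0; have r1' : 0 < 1 - rho by lra.
  have [||K hK] := @expr_small _ rho (e * (1 - rho)); rewrite ?r0 ?mulr_gt0//.
  exists K => n Kn; rewrite -(subnKC Kn) -(ltr_pM2r r1').
  apply: le_lt_trans (ydk _ _) _; apply: le_lt_trans (hK K (leqnn K)).
  have := exprn_ge0 K r0; have := exprn_ge0 (n - K) r0.
  move=> h1 h2; rewrite -[leRHS]mulr1 -mulrA; apply: ler_wpM2l => //.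
  nra.
have yCauchy : cauchy_for cnorm y.
  move=> e e0; have [K hK] := yC (e / 2) (divr_gt0 e0 (ltr0n _ 2)).
  exists K => m n Km Kn; have := hK m Km; have := hK n Kn.
  rewrite [in X in X -> _]cnormB.
  have := cnormD (y m - y K) (y K - y n); rewrite addrA subrK; lra.
have [l yl0] := cnorm_complete yCauchy.
have yl (e : R) : 0 < e -> exists n, cnorm (y n - l) < e /\ cnorm (y n.+1 - l) < e.
  move=> e0; move/cvgrPdist_lt : yl0 => /(_ e e0) [N _ hN]; exists N.
  split; [have := hN N (leqnn N)|have := hN N.+1 (leqnSn N)];
    by rewrite sub0r normrN ger0_norm// cnorm_ge0.
have eq0 (x : A) (K : R) : (forall e, 0 < e -> cnorm x <= K * e) -> x = 0.
  by move=> h; apply: cnorm_eq0; apply/eqP; rewrite eq_le cnorm_ge0 (le0_of_le_small h).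
have lsa : sa l.
  apply/eqP; rewrite -subr_eq0; apply/eqP; apply: (eq0 _ 2) => e /yl[n [h _]].
  have := cnormD (star l - y n) (y n - l); rewrite addrA subrK.
  rewrite -{1}(ysa n) -starB cnorm_star_eq cnormB; lra.
have lcomm (z : A) : GRing.comm z c -> GRing.comm z l.
  move=> zc; have zy n : GRing.comm z (y n).
    elim: n => [|n IHn]; first exact: commr0.
    by apply: commZ; apply: commrD => //; exact: commrM.
  apply/eqP; rewrite -subr_eq0; apply/eqP.
  apply: (eq0 _ (2 * cnorm z)) => e /yl[n [h _]].
  have -> : z * l - l * z = (y n - l) * z - z * (y n - l).
    by rewrite mulrBl mulrBr zy opprB [RHS]addrC addrA subrK.
  have := cnormD ((y n - l) * z) (- (z * (y n - l))); rewrite cnormN.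
  have := cnormM (y n - l) z; have := cnormM z (y n - l).
  have := cnorm_ge0 z; nra.
have lE : c + l * l = 2%:C *: l.
  apply/eqP; rewrite -subr_eq0; apply/eqP.
  pose M := rho + cnorm l.
  apply: (eq0 _ (2 * M + 2)) => e /yl[n [h1 h2]].
  have y2 : 2%:C *: y n.+1 = c + y n * y n.
    by rewrite yS scalerrA mulfV ?pnatr_eq0// scale1rr.
  have -> : c + l * l - 2%:C *: l = (l * l - y n * y n) + 2%:C *: (y n.+1 - l).
    rewrite scalerBr y2 addrA; congr (_ - _).
    by rewrite [LHS]addrC [in RHS](addrC c) addrA subrK.
  apply: le_trans (cnormD _ _) _; rewrite cnormZr ger0_norm//.
  have M0 : 0 <= M by rewrite addr_ge0// cnorm_ge0.
  have := @nsqB l (y n) M _ _; rewrite lerDr r0 => /(_ isT).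
  have -> : cnorm (y n) <= M by rewrite /M; have := yn n; have := cnorm_ge0 l; lra.
  rewrite cnormB => /(_ isT); have := cnorm_ge0 (y n - l); nra.
exists (1 - l); split.
- exact: saB.
- rewrite mulrBl !mulrBr !mul1r mulr1.
  have -> : 1 - l - (l - l * l) = 1 - (2%:C *: l - l * l).
    by rewrite rmorphMn rmorph1 scaler_nat mulr2n !opprD !opprK !addrA.
  by rewrite -lE addrK.
- by move=> z zc; apply: commrB; [exact: commr1|exact: lcomm].
Qed.

End Positivity.

(** * The maximum of the spectrum and positive elements *)

Section Mu.
Variables (R : realType) (A : cstarAlg R).
Implicit Types x y z h k : A.

(* [mu h] is the maximum of the spectrum of a self-adjoint [h]. *)
Definition mu h : R :=
  inf [set cnorm (r%:C%:A + h) - r | r in [set r : R | 0 <= r]].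

Let mu_set_inf h :
  has_inf [set cnorm (r%:C%:A + h) - r | r in [set r : R | 0 <= r]].
Proof.
split; first by exists (cnorm ((0 : R)%:C%:A + h) - 0), 0 => //=.
exists (- cnorm h) => _ [r /= r0 <-].
have := cnormD (r%:C%:A + h) (- h).
by rewrite addrK cnormN cnorm_scalar ger0_norm//; lra.
Qed.

Lemma mu_le h r : 0 <= r -> mu h <= cnorm (r%:C%:A + h) - r.
Proof. by move=> r0; apply: ge_inf; [exact: (mu_set_inf h).2|exists r]. Qed.

Lemma le_mu h c : (forall r, 0 <= r -> c <= cnorm (r%:C%:A + h) - r) -> c <= mu h.
Proof.
move=> hc; apply: lb_le_inf; first exact: (mu_set_inf h).1.
by move=> _ [r /= r0 <-]; exact: hc.
Qed.

Lemma mu_lt h c : mu h < c -> exists2 r, 0 <= r & cnorm (r%:C%:A + h) < r + c.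
Proof.
move=> hc; apply: contrapT => hn; move: hc; apply/negP; rewrite -leNgt.
apply: le_mu => r r0; rewrite leNgt; apply/negP => h1; apply: hn; exists r => //.
by move: h1; lra.
Qed.

Lemma mu_le_cnorm h : mu h <= cnorm h.
Proof. by have := mu_le h (lexx 0); rewrite subr0 scale0r add0r. Qed.

Lemma mu_sub h r s : 0 <= r -> r <= s ->
  cnorm (s%:C%:A + h) - s <= cnorm (r%:C%:A + h) - r.
Proof.
move=> r0 rs; have := cnormD ((s - r)%:C%:A : A) (r%:C%:A + h).
rewrite addrA -scalerDl -rmorphD subrK cnorm_scalar ger0_norm ?subr_ge0//; lra.
Qed.

Lemma mu_add h k : mu (h + k) <= mu h + mu k.
Proof.
rewrite -lerBlDr; apply: le_mu => r r0; rewrite lerBlDr -lerBlDl.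
apply: le_mu => s s0; rewrite lerBlDl.
apply: le_trans (mu_le _ (addr_ge0 r0 s0)) _.
have := cnormD (r%:C%:A + h) (s%:C%:A + k).
rewrite addrACA -scalerDl -rmorphD; lra.
Qed.

Lemma mu_scale t h : 0 < t -> mu (t%:C *: h) = t * mu h.
Proof.
move=> t0; rewrite /mu -inf_scale//.
have e r : cnorm ((t * r)%:C%:A + t%:C *: h) - t * r = t * (cnorm (r%:C%:A + h) - r).
  by rewrite -scalerrA -scalerDr cnormZr gtr0_norm// mulrBr.
congr inf; apply/seteqP; split=> [_ [r /= r0 <-]|_ [_ [r /= r0 <-] <-]].
  have tE : r = t * (r / t) by rewrite mulrC divfK// gt_eqF.
  exists (cnorm ((r / t)%:C%:A + h) - r / t); last by rewrite -e -tE.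
  by exists (r / t) => //=; rewrite divr_ge0// ltW.
by exists (t * r); [rewrite /= mulr_ge0// ltW|exact: e].
Qed.

Lemma mu0 : mu 0 = 0.
Proof.
have := @mu_scale 2 0 (ltr0n _ 2); rewrite scaler0; lra.
Qed.

Lemma mu_opp h : 0 <= mu h + mu (- h).
Proof. by rewrite -mu0 -(subrr h); exact: mu_add. Qed.

Lemma mu_shift h t : mu (h + t%:C%:A) = mu h + t.
Proof.
have le k s : mu (k + s%:C%:A) <= mu k + s.
  rewrite -lerBlDr; apply: le_mu => r r0; rewrite lerBlDr.
  pose r' := Num.max 0 (r - s).
  have r'0 : 0 <= r' by rewrite le_max lexx.
  have rs : r - s <= r' by rewrite le_max lexx orbT.
  apply: le_trans (mu_le _ r'0) _.
  have rr : r <= r' + s by lra.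
  have := mu_sub k r0 rr; rewrite rmorphD scalerDl addrAC -addrA -addrA; lra.
apply/eqP; rewrite eq_le le/=.
have := le (h + t%:C%:A) (- t); rewrite rmorphN scaleNr addrK; lra.
Qed.

Lemma mu_scalar t : mu (t%:C%:A) = t.
Proof. by rewrite -[X in mu X]add0r mu_shift mu0 add0r. Qed.

(** Positivity of [h] reads [mu (- h) <= 0]. Then [h + e] is [r + e] times [1 - c] with [c] of norm
    at most [(r + e / 2) / (r + e)]; the summand [e] keeps this below 1, as [sqrt_one_minus]
    requires. *)
Lemma pos_sqrt h (e : R) : sa h -> mu (- h) <= 0 -> 0 < e ->
  exists k, [/\ sa k, k * k = h + e%:C%:A & forall z, GRing.comm z h -> GRing.comm z k].
Proof.
move=> hh h0 e0; have [|r r0 hr] := @mu_lt (- h) (e / 2); first by lra.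
have re : 0 < r + e by lra.
pose c := (r + e)^-1%:C *: (r%:C%:A - h).
have csa : sa c by apply: saZ; apply: saB => //; exact: sa_scalar.
have [|||s [hs ss sc]] := @sqrt_one_minus _ _ c ((r + e / 2) / (r + e)).
- by [].
- rewrite /c cnormZr gtr0_norm ?invr_gt0// mulrC ler_pM2r ?invr_gt0//; lra.
- rewrite ltr_pdivrMr//; lra.
pose q := Num.sqrt (r + e).
have qq : q * q = r + e by rewrite -expr2 sqr_sqrtr// ltW.
exists (q%:C *: s); split.
- exact: saZ.
- rewrite -scalerAl -scalerAr scalerrA qq ss scalerBr /c scalerrA mulfV ?gt_eqF//.
  by rewrite scale1rr scalerDlr opprB addrAC addrCA subrr addr0 addrC.
- move=> z zh; apply: commZ; apply: sc; apply: commZ; apply: commrB => //.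
  exact: comm_scalar.
Qed.

(** With commuting roots [u^2 = l + e - h] and [v^2 = l + e + h], one has
    [h^2 + (u v)^2 = (l + e)^2], and [cnorm_cos] applies. *)
Lemma cnorm_le_mu h (l : R) : sa h -> 0 <= l -> mu h <= l -> mu (- h) <= l ->
  cnorm h <= l.
Proof.
move=> hh l0 h1 h2; apply/ler_addgt0Pr => e e0.
have [||//|u [hu uu uc]] := @pos_sqrt (l%:C%:A - h) e.
- by apply: saB => //; exact: sa_scalar.
- by rewrite opprB -scaleNr -rmorphN mu_shift; lra.
have [||//|v [hv vv vc]] := @pos_sqrt (l%:C%:A + h) e.
- by apply: saD => //; exact: sa_scalar.
- by rewrite opprD addrC -scaleNr -rmorphN mu_shift; lra.
have hcomm c : GRing.comm h (c%:A + h).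
  by apply: commrD => //; exact: comm_scalar.
have hcommN c : GRing.comm h (c%:A - h).
  by apply: commrB => //; exact: comm_scalar.
have hu' : GRing.comm h u by apply: uc.
have hv' : GRing.comm h v by apply: vc.
have uv : GRing.comm v u.
  apply: uc; apply: commrB; first exact: comm_scalar.
  exact: commr_sym.
apply: (@cnorm_cos _ _ h (u * v)) => //.
- by rewrite addr_ge0// ltW.
- exact/saM/commr_sym.
- exact: commrM.
have -> : u * v * (u * v) = u * u * (v * v).
  by rewrite !mulrA -(mulrA u v u) uv -!mulrA.
rewrite uu vv; set b := (l + e)%:C%:A : A.
have -> : l%:C%:A - h + e%:C%:A = b - h by rewrite addrAC /b scalerDlr.
have -> : l%:C%:A + h + e%:C%:A = b + h by rewrite addrAC /b scalerDlr.
rewrite mulrBl !mulrDr (_ : b * h = h * b); last by rewrite /b comm_scalar.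
rewrite opprD [b * b + _ + _]addrA addrK [LHS]addrC subrK /b.
by rewrite -scalerAl mul1r scalerrA -expr2.
Qed.

(** After scaling to [k'] of norm below 1, [1 - k'^2] is a square [s^2] with [|s| <= 1] by
    [cnorm_cos]; hence [|rho^2 - k^2| <= rho^2]. *)
Lemma mu_sq k : sa k -> mu (- (k * k)) <= 0.
Proof.
move=> hk; pose rho := cnorm k + 1.
have rho1 : 1 <= rho by rewrite lerDr cnorm_ge0.
have rho0 : 0 < rho by lra.
pose k' := rho^-1%:C *: k.
have hk' : sa k' by exact: saZ.
have nk' : cnorm k' <= cnorm k / rho.
  by rewrite cnormZr gtr0_norm ?invr_gt0// mulrC.
have nk1 : cnorm k / rho < 1 by rewrite ltr_pdivrMr//; rewrite /rho; lra.
have kk : cnorm (k' * k') <= cnorm k / rho.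
  apply: le_trans (cnormM _ _) _; have := cnorm_ge0 k'; nra.
have [|s [hs ss sc]] := sqrt_one_minus _ kk nk1; first exact: saM.
have s1 : cnorm s <= 1.
  apply: (@cnorm_cos _ _ s k') => //.
    by apply/commr_sym/sc; exact: commrM.
  by rewrite ss subrK expr1n scale1rr.
have e : (rho ^+ 2)%:C *: (s * s) = (rho ^+ 2)%:C%:A - k * k.
  rewrite ss scalerBr /k' -scalerAl -scalerAr !scalerrA -mulrA expr2 -mulrA.
  by rewrite (mulrA rho rho^-1) mulfV ?gt_eqF// mul1r mulfV ?gt_eqF// scale1rr.
have := mu_le (- (k * k)) (sqr_ge0 rho); rewrite -e cnormZr ger0_norm ?sqr_ge0//.
have ss1 : cnorm (s * s) <= 1.
  by apply: le_trans (cnormM _ _) _; have := cnorm_ge0 s; nra.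
have := ler_wpM2l (sqr_ge0 rho) ss1; rewrite mulr1; lra.
Qed.

(** With roots [u] and [v] of [h + d] and [k + d], the product is the square of [u v] minus the
    small term [d (h + k + d)]. *)
Lemma mu_pos_mul h k : sa h -> sa k -> GRing.comm h k ->
  mu (- h) <= 0 -> mu (- k) <= 0 -> mu (- (h * k)) <= 0.
Proof.
move=> hh hk hc h0 k0; apply/ler_addgt0Pr => e e0; rewrite add0r.
pose M := cnorm h + cnorm k + 1.
have M1 : 1 <= M by rewrite lerDr addr_ge0// cnorm_ge0.
pose d := Num.min 1 (e / (M + 1)).
have d0 : 0 < d by rewrite lt_min ltr01 divr_gt0//; lra.
have d1 : d <= 1 by rewrite ge_min lexx.
have dM : d * (M + 1) <= e.
  by rewrite -ler_pdivlMr ?ge_min ?lexx ?orbT//; lra.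
have [u [hu uu uc]] := pos_sqrt hh h0 d0.
have [v [hv vv vc]] := pos_sqrt hk k0 d0.
have vu : GRing.comm v u.
  by apply/uc/commr_sym/vc.
have e1 : - (h * k) = - ((u * v) * (u * v)) + (d%:C *: (h + k + d%:C%:A)).
  have -> : u * v * (u * v) = u * u * (v * v).
    by rewrite !mulrA -(mulrA u v u) vu -!mulrA.
  rewrite uu vv mulrDl !mulrDr -!scalerAl !mul1r -!scalerAr mulr1 !scalerDr.
  rewrite -!addrA; set Y := _ *: h + _.
  by rewrite opprD -addrA addNr addr0.
rewrite e1; apply: le_trans (mu_add _ _) _.
have := mu_sq (saM hu hv (commr_sym vu)); rewrite mu_scale//.
have := mu_le_cnorm (h + k + d%:C%:A).
have := cnormD (h + k) (d%:C%:A); have := cnormD h k.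
rewrite cnorm_scalar gtr0_norm// /M in dM *; nra.
Qed.

(** The spectra of [z^* z] and [z z^*] agree away from 0, whence the condition [0 <= b]. The [n]-th
    power of [r + sg z z^*] is [r^n + sg z q z^*], where [q] is a polynomial in [z^* z] of norm at
    most [n T^(n - 1)]; the growth lemma then bounds the norm by [T]. *)
Lemma mu_swap z (sg b : R) : 0 <= b -> mu (sg%:C *: (star z * z)) <= b ->
  mu (sg%:C *: (z * star z)) <= b.
Proof.
move=> b0 hb; apply/ler_addgt0Pr => e e0.
have [|r r0 hr] := @mu_lt (sg%:C *: (star z * z)) (b + e); first by lra.
pose w := r%:C%:A + sg%:C *: (star z * z).
pose w' := r%:C%:A + sg%:C *: (z * star z).
have w'sa : sa w'.
  apply: saD; first exact: sa_scalar.
  by apply: saZ; rewrite /sa starM starK.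
pose T := r + (b + e); have T0 : 0 < T by rewrite /T; lra.
have rT : r <= T by rewrite /T; lra.
have wT : cnorm w <= T by exact: ltW.
have /choice[q qP] : forall n, exists q : A,
    w' ^+ n = (r ^+ n)%:C%:A + sg%:C *: (z * q * star z) /\
    cnorm q * T <= n%:R * T ^+ n.
  elim=> [|n [q [qE qN]]].
    by exists 0; rewrite expr0 expr0 mulr0 mul0r scaler0 addr0 scale1rr cnorm0 !mul0r.
  exists ((r ^+ n)%:C%:A + w * q); split.
    rewrite exprS qE /w' mulrDl !mulrDr; set Q := z * q * star z.
    have -> : r%:C%:A * (r ^+ n)%:C%:A = (r ^+ n.+1)%:C%:A :> A.
      by rewrite -scalerAl mul1r scalerrA -exprS.
    have -> : r%:C%:A * (sg%:C *: Q) = sg%:C *: (r%:C *: Q).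
      by rewrite -scalerAl mul1r !scalerrA mulrC.
    have -> : sg%:C *: (z * star z) * (r ^+ n)%:C%:A = sg%:C *: ((r ^+ n)%:C *: (z * star z)).
      by rewrite -scalerAl -scalerAr mulr1.
    rewrite -scalerAl -addrA; congr (_ + _); rewrite -!scalerDr; congr (_ *: _).
    rewrite mulrDl -[z * _%:A]scalerAr mulr1 -[(_ *: z) * _]scalerAl addrCA; congr (_ + _).
    rewrite /w mulrDl -scalerAl mul1r mulrDr mulrDl -scalerAr -scalerAl; congr (_ + _).
      by rewrite -scalerAr -scalerAl.
    by rewrite -scalerAr -scalerAl /Q !mulrA.
  have h1 := cnormD ((r ^+ n)%:C%:A) (w * q).
  rewrite cnorm_scalar ger0_norm ?exprn_ge0// in h1.
  have h2 := cnormM w q.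
  have h3 : r ^+ n <= T ^+ n by rewrite lerXn2r ?nnegrE// ltW.
  rewrite -natr1 exprSr; have := cnorm_ge0 q; have := exprn_ge0 n (ltW T0).
  set u := T ^+ n in h3 qN *; set a := cnorm (_ + _) in h1 *.
  set c := cnorm (w * q) in h1 h2; set d := cnorm q in h2 qN *.
  move=> u0 d0; have h4 : c <= T * d by apply: le_trans h2 _; rewrite ler_wpM2r.
  have h5 : a <= u + T * d by lra.
  have : a * T <= (u + T * d) * T by rewrite ler_pM2r.
  have : T * (d * T) <= T * (n%:R * u) by rewrite ler_pM2l.
  lra.
have : cnorm w' <= T.
  pose K := 1 + `|sg| * (cnorm z ^+ 2) / T.
  apply: (@le_of_pow2_growth _ _ _ K); first exact: ltW.
  move=> p; set N := (2 ^ p)%N; rewrite -cnorm_sa_pow// -/N.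
  have [-> qN] := qP N.
  apply: le_trans (cnormD _ _) _; rewrite cnorm_scalar ger0_norm ?exprn_ge0//.
  rewrite cnormZr.
  have N1 : 1 <= N%:R :> R by rewrite ler1n expn_gt0.
  have h3 : r ^+ N <= T ^+ N by rewrite lerXn2r ?nnegrE// ltW.
  have h4 : cnorm (z * q N * star z) <= cnorm z ^+ 2 * cnorm (q N).
    apply: le_trans (cnormM _ _) _; rewrite cnorm_star_eq expr2 mulrAC.
    by apply: ler_wpM2r; [exact: cnorm_ge0|exact: cnormM].
  have h5 : cnorm (q N) <= N%:R * T ^+ N / T by rewrite ler_pdivlMr.
  have h6 : `|sg| * cnorm (z * q N * star z) <= `|sg| * (cnorm z ^+ 2 * (N%:R * T ^+ N / T)).
    apply: ler_wpM2l => //; apply: le_trans h4 _; apply: ler_wpM2l => //.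
    exact: sqr_ge0.
  have h7 : T ^+ N <= N%:R * T ^+ N by rewrite ler_peMl// exprn_ge0// ltW.
  apply: le_trans (lerD h3 h6) _; apply: le_trans (lerD h7 (lexx _)) _.
  rewrite /K le_eqVlt; apply/orP; left; apply/eqP; field; exact: lt0r_neq0.
have := mu_le (sg%:C *: (z * star z)) r0; rewrite -/w' /T; lra.
Qed.

End Mu.

Section States.
Variables (R : realType) (A : cstarAlg R).
Implicit Types x y z h k g : A.

(* With [h = star y * y], [lam = mu (- h)] and [M = cnorm h], the element [g] has
   spectrum in [0, 1], attaining 1 where [h] is [- lam], while [g <= q < 1]
   where [h >= 0]; so [g ^+ n] localizes [y] near the negative part of [h]. *)
Lemma mu_star_mul y : mu (- (star y * y)) <= 0.
Proof.
rewrite leNgt; apply/negP; set h := star y * y; set lam := mu (- h) => lam0.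
have hh : sa h by exact: sa_sq.
set M := cnorm h; have hM : mu h <= M by exact: mu_le_cnorm.
have lamM : lam <= M by rewrite /M -cnormN; exact: mu_le_cnorm.
have M0 : 0 < M by lra.
have ML : 0 < M + lam by lra.
pose g := (M + lam)^-1%:C *: (M%:C%:A - h).
have hg : sa g by apply: saZ; apply: saB => //; exact: sa_scalar.
have gE : (M + lam)%:C *: g = M%:C%:A - h.
  by rewrite /g scalerrA mulfV ?gt_eqF// scale1rr.
have hE : h = M%:C%:A - (M + lam)%:C *: g by rewrite gE opprB addrC subrK.
have mug : mu g = 1.
  by rewrite /g mu_scale ?invr_gt0// [_ - h]addrC mu_shift -/lam [lam + _]addrC mulVf ?gt_eqF.
have muNg : mu (- g) <= 0.
  rewrite /g -scalerN mu_scale ?invr_gt0// opprB -scaleNr -rmorphN mu_shift.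
  by rewrite pmulr_rle0 ?invr_gt0//; lra.
have g1 : cnorm g <= 1 by apply: cnorm_le_mu; rewrite ?mug//; lra.
have gn1 n : cnorm (g ^+ n) <= 1.
  elim: n => [|n IHn]; first by rewrite expr0 cnorm1.
  rewrite exprS; apply: le_trans (cnormM _ _) _.
  have := cnorm_ge0 g; have := cnorm_ge0 (g ^+ n); nra.
have gn1' n : 1 <= cnorm (g ^+ n).
  have gp : 1 <= cnorm (g ^+ (2 ^ n)%N).
    by rewrite cnorm_sa_pow// exprn_ege1// -mug mu_le_cnorm.
  apply: le_trans gp _; rewrite -(subnK (ltnW (ltn_expl n (ltnSn 1)))) exprD.
  apply: le_trans (cnormM _ _) _.
  by have := gn1 (2 ^ n - n)%N; have := cnorm_ge0 (g ^+ n); nra.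
pose q := M / (M + lam).
have q0 : 0 <= q by rewrite divr_ge0 ?ltW.
have q1 : q < 1 by rewrite /q ltr_pdivrMr//; lra.
have qM : (M + lam) * q = M by rewrite /q mulrC divfK// gt_eqF.
have hE' : h = (M + lam)%:C *: (q%:C%:A - g).
  by rewrite scalerBr scalerrA qM.
have comg (c : R[i]) : GRing.comm g (c%:A) by exact: comm_scalar.
have gsq : GRing.comm g (q%:C%:A - g) by apply: commrB.
have hqg : sa (q%:C%:A - g) by apply: saB => //; exact: sa_scalar.
have posX n : mu (- g ^+ n) <= 0.
  elim: n => [|n IHn].
    rewrite expr0 (_ : - 1 = (- 1)%:C%:A :> A) ?mu_scalar ?lerN10//.
    by rewrite scaleNrr scale1rr.
  by rewrite exprS; apply: mu_pos_mul => //; [exact: saX|exact: commrX].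
(* This is [(q^n - t^n) (q - t) >= 0] for [t >= 0]. It bounds [g^n (q - g)] by [q^n (q - g)]. *)
have pos1 n : mu (- (((q ^+ n)%:C%:A - g ^+ n) * (q%:C%:A - g))) <= 0.
  elim: n => [|n IHn].
    by rewrite !expr0 scale1rr subrr mul0r oppr0 mu0.
  have -> : ((q ^+ n.+1)%:C%:A - g ^+ n.+1) * (q%:C%:A - g) =
      q%:C *: (((q ^+ n)%:C%:A - g ^+ n) * (q%:C%:A - g)) +
      g ^+ n * ((q%:C%:A - g) * (q%:C%:A - g)).
    rewrite mulrA scalerAl -mulrDl; congr (_ * _).
    rewrite mulrBr [g ^+ n.+1]exprSr -[_ * _%:A]scalerAr mulr1 scalerBr scalerrA -exprS.
    by rewrite addrA subrK.
  rewrite opprD; apply: le_trans (mu_add _ _) _.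
  have h1 : mu (- (q%:C *: (((q ^+ n)%:C%:A - g ^+ n) * (q%:C%:A - g)))) <= 0.
    have [q00|qn0] := eqVneq q 0; first by rewrite q00 scale0r oppr0 mu0.
    have qp : 0 < q by rewrite lt_neqAle eq_sym qn0.
    by rewrite -scalerN mu_scale// pmulr_rle0.
  have h2 : mu (- (g ^+ n * ((q%:C%:A - g) * (q%:C%:A - g)))) <= 0.
    apply: mu_pos_mul => //; [exact: saX|exact: saM| |exact: mu_sq].
    by apply: commrM; apply/commr_sym/commrX/commr_sym.
  lra.
have [|N hN] := @expr_small _ q (lam / (M + lam)) _ (divr_gt0 lam0 ML).
  by rewrite q0 q1.
pose n := N; pose F := g ^+ n; pose z := y * F.
have hF : sa F by exact: saX.
have zz : star z * z = h * g ^+ (n + n).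
  rewrite /z starM hF mulrA -(mulrA F) -/h exprD [RHS]mulrA; congr (_ * _).
  have gh : GRing.comm g h by rewrite hE'; exact: commZ.
  exact: commr_sym (commrX n (commr_sym gh)).
(* Since [h = (M + lam) (q - g)] and [g >= 0], the element [z^* z = h g^(2n)] is at most
   [(M + lam) q^(2n) (q - g) <= eps]. The choice of [N] makes [eps < lam]. *)
pose eps := (M + lam) * q ^+ (n + n).+1.
have w1 : mu (star z * z) <= eps.
  have -> : star z * z = eps%:C%:A - (M + lam)%:C *: (
      ((q ^+ (n + n))%:C%:A - g ^+ (n + n)) * (q%:C%:A - g) + (q ^+ (n + n))%:C *: g).
    have -> : eps%:C%:A = (M + lam)%:C *: (q ^+ (n + n).+1)%:C%:A :> A.
      by rewrite scalerrA.
    rewrite zz hE' -[(_ *: (_ - _)) * _]scalerAl -scalerBr; congr (_ *: _).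
    rewrite [(_ - g ^+ _) * _]mulrBl -[_%:A * _]scalerAl mul1r scalerBr scalerrA -exprSr.
    rewrite addrAC subrK opprB [RHS]addrC subrK.
    exact: (commrX _ (commr_sym gsq)).
  rewrite addrC mu_shift -lerBrDr subrr -scalerN mu_scale// pmulr_rle0//.
  rewrite opprD; apply: le_trans (mu_add _ _) _.
  have := pos1 (n + n)%N.
  have : mu (- ((q ^+ (n + n))%:C *: g)) <= 0.
    have [q00|qn0] := eqVneq (q ^+ (n + n)) 0; first by rewrite q00 scale0r oppr0 mu0.
    by rewrite -scalerN mu_scale ?pmulr_rle0// lt_neqAle eq_sym qn0 exprn_ge0.
  lra.
(* The sum [z^* z + z z^*] is half the sum of two squares of self-adjoint elements. Hence
   [z z^* >= - eps], and [mu_swap] transfers this lower bound to [z^* z]. *)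
have w2 : mu (- (z * star z + star z * z)) <= 0.
  have e : 2%:C *: (z * star z + star z * z) =
      (z + star z) * (z + star z) + ('i *: (z - star z)) * ('i *: (z - star z)).
    rewrite -scalerAl -scalerAr scalerA (_ : 'i * 'i = -1); last by rewrite -expr2 sqr_i.
    rewrite scaleN1r !mulrBl !mulrBr !mulrDl !mulrDr (scalerDlr 1 1) scale1rr.
    set a := z * z; set b := z * star z; set c := star z * z; set d := star z * star z.
    have -> : a + b + (c + d) = (b + c) + (a + d) by rewrite (addrC a) addrACA.
    have -> : a - b - (c - d) = (a + d) - (b + c).
      by rewrite opprB addrACA -opprD.
    by rewrite opprB [RHS]addrACA subrr addr0.
  have -> : - (z * star z + star z * z) = 2^-1%:C *: - (2%:C *: (z * star z + star z * z)).
    by rewrite scalerN scalerrA mulVf ?pnatr_eq0// scale1rr.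
  rewrite mu_scale ?invr_gt0// pmulr_rle0 ?invr_gt0// e opprD.
  apply: le_trans (mu_add _ _) _.
  have s1 : sa (z + star z) by rewrite /sa starD starK addrC.
  have s2 : sa ('i *: (z - star z)).
    rewrite /sa starZ starB starK (_ : conjc 'i = - 'i) ?scaleNr -?scalerN ?opprB//.
    by apply/eqP; rewrite eq_complex /= oppr0 !eqxx.
  by have := mu_sq s1; have := mu_sq s2; lra.
have eps0 : 0 <= eps by rewrite mulr_ge0 ?exprn_ge0// ltW.
have w3 : mu (- (z * star z)) <= eps.
  have := mu_add (- (z * star z + star z * z)) (star z * z).
  rewrite [X in mu X <= _](_ : _ = - (z * star z)); first by lra.
  by rewrite opprD subrK.
have w4 : mu (- (star z * z)) <= eps.
  have := @mu_swap _ _ (star z) (-1) eps eps0.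
  by rewrite starK rmorphN1 !scaleN1r; apply.
have w5 : cnorm (star z * z) <= eps by apply: cnorm_le_mu => //; exact: sa_sq.
(* Source of the contradiction: in [(M + lam) g^(2n + 1) = M g^(2n) - z^* z] the left side has norm
   at least [M + lam], the right side at most [M + eps]. *)
have : M + lam <= M + eps.
  have -> : M + lam = (M + lam) * 1 by rewrite mulr1.
  apply: le_trans (ler_wpM2l (ltW ML) (gn1' (n + n).+1)) _.
  rewrite -[X in X * _](gtr0_norm ML) -cnormZr.
  have -> : (M + lam)%:C *: g ^+ (n + n).+1 = M%:C *: g ^+ (n + n) - star z * z.
    rewrite zz exprS scalerAl gE mulrBl -scalerAl mul1r.
    by [].
  apply: le_trans (cnormD _ _) _; rewrite cnormN cnormZr gtr0_norm//.
  by have := gn1 (n + n)%N; nra.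
rewrite lerD2l /eps => h1.
have h2 : q ^+ (n + n).+1 < lam / (M + lam) by apply: hN; rewrite -addnS leq_addr.
move: h2; rewrite ltr_pdivlMr// mulrC; lra.
Qed.

Lemma mu_star_mul_cnorm y : mu (star y * y) = cnorm y ^+ 2.
Proof.
rewrite -cnorm_star; apply/eqP; rewrite eq_le mu_le_cnorm/=.
have h1 := mu_star_mul y; have h2 := mu_opp (star y * y).
apply: cnorm_le_mu => //; [exact: sa_sq|lra|lra].
Qed.

Definition is_state (f : A -> R[i]) : Prop :=
  [/\ forall x y, f (x + y) = f x + f y, forall c x, f (c *: x) = c * f x,
      f 1 = 1, forall x, f (star x) = conjc (f x) & forall x, 0 <= f (star x * x)].

(** Hahn-Banach for the map sending [y] to [mu] of its real part, exact at [star x * x]. This map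
    vanishes on skew-adjoint elements, so [L] is invariant under [star]; its values at [1] and [- 1]
    give [L 1 = 1]; positivity is [mu_star_mul]. The state is the complex-linear functional with
    real part [L]. *)
Lemma exists_state x : exists2 f, is_state f & f (star x * x) = (cnorm x ^+ 2)%:C.
Proof.
pose re y := (2^-1)%:C *: (y + star y).
have reD y z : re (y + z) = re y + re z by rewrite /re starD addrACA scalerDr.
have reZ (t : R) y : re (t%:C *: y) = t%:C *: re y.
  by rewrite /re starZr -scalerDr !scalerrA mulrC.
have re_sa y : sa y -> re y = y.
  move=> hy; rewrite /re hy -[X in _ *: (X + _)]scale1rr -[X in _ *: (_ + X)]scale1rr.
  by rewrite -scalerDlr scalerrA mulVf ?scale1rr// (pnatr_eq0 _ 2).
pose p y := mu (re y).
have ps : sublinear setT p.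
  split=> [y z _ _|t y t0 _]; first by rewrite /p reD mu_add.
  by rewrite /p reZ mu_scale.
have [||L [Lp LD LZ Lx]] :=
  @hahn_banach_at R A setT _ _ p (star x * x) ps I; try by [].
have {}Lp y : L y <= p y by exact: Lp.
have {}LD y z : L (y + z) = L y + L z by exact: LD.
have {}LZ (t : R) y : L (t%:C *: y) = t * L y by exact: LZ.
have LN y : L (- y) = - L y.
  by have := LZ (-1) y; rewrite rmorphN1 scaleN1r mulN1r.
have Lskew y : star y = - y -> L y = 0.
  move=> hy; apply/eqP; rewrite eq_le -[X in _ && X]lerN2 oppr0 -LN.
  have p0 z : star z = - z -> p z = 0.
    by move=> hz; rewrite /p /re hz subrr scaler0 mu0.
  by rewrite -{1}(p0 y)// -(p0 (- y)) ?starN ?hy// !Lp.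
have Lstar y : L (star y) = L y.
  apply/esym/eqP; rewrite -subr_eq0 -LN -LD; apply/eqP/Lskew.
  by rewrite starB starK opprB.
have conji : conjc 'i = - 'i :> R[i].
  by apply/eqP; rewrite eq_complex /= oppr0 !eqxx.
have sti y : star ('i *: y) = - ('i *: star y) by rewrite starZ conji scaleNr.
pose f y : R[i] := L y +i* - L ('i *: y).
have saf y : sa y -> f y = (L y)%:C.
  by move=> hy; rewrite /f (Lskew ('i *: y)) ?oppr0// sti hy.
have L1 : L 1 = 1.
  apply/eqP; rewrite eq_le -[X in _ && X]lerN2 -LN.
  have := Lp 1; have := Lp (- 1); rewrite /p !re_sa; try exact: sa1.
    have -> : (- 1 : A) = (- 1)%:C%:A by rewrite scaleNrr scale1rr.
    rewrite mu_scalar => ->; have -> : (1 : A) = (1 : R)%:C%:A by rewrite scale1rr.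
    by rewrite mu_scalar => ->.
  by apply/saN/sa1.
exists f; last first.
  rewrite saf ?Lx; last exact: sa_sq.
  by rewrite /p re_sa ?mu_star_mul_cnorm//; exact: sa_sq.
split.
- by move=> y z; rewrite /f scalerDr !LD opprD.
- move=> [a b] y; rewrite /f.
  have e : (a +i* b) *: y = a%:C *: y + b%:C *: ('i *: y).
    rewrite scalerA -scalerDl; congr (_ *: _).
    by apply/eqP; rewrite eq_complex /=; apply/andP; split; apply/eqP; ring.
  have e' : 'i *: ((a +i* b) *: y) = a%:C *: ('i *: y) + (- b)%:C *: y.
    rewrite !scalerA -scalerDl; congr (_ *: _).
    by apply/eqP; rewrite eq_complex /=; apply/andP; split; apply/eqP; ring.
  rewrite e' e !LD !LZ.
  by apply/eqP; rewrite eq_complex /=; apply/andP; split; apply/eqP; ring.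
- by rewrite saf ?L1//; exact: sa1.
- move=> y; rewrite /f Lstar; apply/eqP; rewrite eq_complex /= eqxx/=.
  by rewrite -[_ *: star y]opprK -sti LN Lstar.
- move=> y; rewrite saf; last exact: sa_sq.
  rewrite ler0c -lerN2 oppr0 -LN; apply: le_trans (Lp _) _.
  rewrite /p re_sa; first exact: mu_star_mul.
  by apply/saN/sa_sq.
Qed.

Lemma exists_state1 : exists f : A -> R[i], is_state f.
Proof. by have [f hf _] := exists_state 1; exists f. Qed.

End States.

(** * Semi-inner products and the algebra of bounded forms *)

Section ComplexNorm.
Variable R : realType.
Implicit Types c d : R[i].
Notation nc := (@Normc.normc R).

Lemma normc_ge0 c : 0 <= nc c.
Proof. by case: c => a b; exact: sqrtr_ge0. Qed.

Lemma normc_conj c : nc (conjc c) = nc c.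
Proof. by case: c => a b /=; rewrite sqrrN. Qed.

Lemma mulc_conj c : c * conjc c = (nc c ^+ 2)%:C.
Proof.
case: c => a b; rewrite /= sqr_sqrtr ?addr_ge0 ?sqr_ge0//.
by apply/eqP; rewrite eq_complex /=; apply/andP; split; apply/eqP; ring.
Qed.

Lemma normcE c : nc c ^+ 2 = complex.Re c ^+ 2 + complex.Im c ^+ 2.
Proof. by case: c => a b /=; rewrite sqr_sqrtr// addr_ge0 ?sqr_ge0. Qed.

Lemma Re_le_normc c : complex.Re c <= nc c.
Proof.
apply: le_trans (ler_norm _) _; rewrite -ler_sqr ?nnegrE ?normc_ge0//.
by rewrite normcE real_normK ?num_real// lerDl sqr_ge0.
Qed.

Lemma normc_le_ReIm c : nc c <= `|complex.Re c| + `|complex.Im c|.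
Proof.
rewrite -ler_sqr ?nnegrE ?normc_ge0 ?addr_ge0// normcE.
rewrite sqrrD !real_normK ?num_real// -addrA [X in _ <= _ + X]addrC lerD2l lerDl.
by rewrite mulrn_wge0// mulr_ge0.
Qed.

Lemma Re_le_norm_normc c : `|complex.Re c| <= nc c.
Proof.
rewrite -ler_sqr ?nnegrE ?normc_ge0//.
by rewrite normcE real_normK ?num_real// lerDl sqr_ge0.
Qed.

Lemma Im_le_norm_normc c : `|complex.Im c| <= nc c.
Proof.
rewrite -ler_sqr ?nnegrE ?normc_ge0//.
by rewrite normcE real_normK ?num_real// lerDr sqr_ge0.
Qed.

Lemma normcB c d : nc (c - d) = nc (d - c).
Proof. by rewrite -normcN opprB. Qed.

Lemma normc_dist3 c d e : nc (c - e) <= nc (c - d) + nc (d - e).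
Proof. by have := le_normcD (c - d) (d - e); rewrite addrA subrK. Qed.

Lemma eq_of_normc_small c d (K : R) :
  (forall e, 0 < e -> nc (c - d) <= K * e) -> c = d.
Proof.
move=> h; apply/eqP; rewrite -subr_eq0; apply/eqP/Normc.eq0_normc/eqP.
by rewrite eq_le normc_ge0 (le0_of_le_small h).
Qed.

Lemma real_complete (u : nat -> R) :
  (forall e, 0 < e -> exists K, forall m n, (K <= m)%N -> (K <= n)%N -> `|u m - u n| < e) ->
  exists l, forall e, 0 < e -> exists K, forall n, (K <= n)%N -> `|u n - l| <= e.
Proof.
move=> uC; pose E := [set x : R | exists K, forall n, (K <= n)%N -> x <= u n].
have near e : 0 < e -> exists K, E (u K - e) /\ forall x, E x -> x <= u K + e.
  move=> e0; have [K hK] := uC e e0; exists K; split.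
    by exists K => n Kn; have := hK n K Kn (leqnn K); rewrite ltr_norml; lra.
  move=> x [L hL]; have := hL (maxn K L) (leq_maxr _ _).
  by have := hK (maxn K L) K (leq_maxl _ _) (leqnn K); rewrite ltr_norml; lra.
have [K0 [E0 ub0]] := near 1 ltr01.
exists (sup E) => e e0; have [K hK] := uC (e / 2) (divr_gt0 e0 (ltr0n _ 2)).
have [L [EL ubL]] := near (e / 2) (divr_gt0 e0 (ltr0n _ 2)).
exists K => n Kn; rewrite ler_norml; apply/andP; split.
  rewrite lerBrDr -lerBrDl opprK; apply: ge_sup; first by exists (u K0 - 1).
  move=> x [M hM]; have := hM (maxn K M) (leq_maxr _ _).
  by have := hK (maxn K M) n (leq_maxl _ _) Kn; rewrite ltr_norml; lra.
have : u n - e <= sup E.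
  apply: ub_le_sup; first by exists (u K0 + 1) => x; exact: ub0.
  by exists K => m Km; have := hK m n Km Kn; rewrite ltr_norml; lra.
lra.
Qed.

Lemma complex_complete (u : nat -> R[i]) :
  (forall e, 0 < e -> exists K, forall m n, (K <= m)%N -> (K <= n)%N -> nc (u m - u n) < e) ->
  exists l, forall e, 0 < e -> exists K, forall n, (K <= n)%N -> nc (u n - l) <= e.
Proof.
move=> uC.
have [a ha] : exists l, forall e, 0 < e -> exists K, forall n, (K <= n)%N ->
    `|complex.Re (u n) - l| <= e.
  apply: (@real_complete (fun n => complex.Re (u n))) => e /uC[K hK].
  exists K => m n Km Kn; apply: le_lt_trans (hK m n Km Kn).
  by rewrite -raddfB; exact: Re_le_norm_normc.
have [b hb] : exists l, forall e, 0 < e -> exists K, forall n, (K <= n)%N ->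
    `|complex.Im (u n) - l| <= e.
  apply: (@real_complete (fun n => complex.Im (u n))) => e /uC[K hK].
  exists K => m n Km Kn; apply: le_lt_trans (hK m n Km Kn).
  by rewrite -raddfB; exact: Im_le_norm_normc.
exists (a +i* b) => e e0.
have [K hK] := ha (e / 2) (divr_gt0 e0 (ltr0n _ 2)).
have [L hL] := hb (e / 2) (divr_gt0 e0 (ltr0n _ 2)).
exists (maxn K L) => n; rewrite geq_max => /andP[Kn Ln].
apply: le_trans (normc_le_ReIm _) _.
have := hK n Kn; have := hL n Ln; case: (u n) => x y /=; lra.
Qed.

End ComplexNorm.

(** * Cauchy-Schwarz and approximate Riesz representation *)

Section SemiInner.
Variables (R : realType) (V : lmodType R[i]).
Notation nc := (@Normc.normc R).

Record semi_inner := SemiInner {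
  ip :> V -> V -> R[i];
  ipDr : forall x y z, ip x (y + z) = ip x y + ip x z;
  ipZr : forall c x y, ip x (c *: y) = c * ip x y;
  ipC : forall x y, ip y x = conjc (ip x y);
  ip_ge0 : forall x, 0 <= ip x x }.

Variable s : semi_inner.
Implicit Types x y z w : V.

Definition nrm x : R := Num.sqrt (complex.Re (s x x)).

Lemma ipDl x y z : s (x + y) z = s x z + s y z.
Proof. by rewrite ipC ipDr rmorphD/= -!ipC. Qed.

Lemma ipZl c x y : s (c *: x) y = conjc c * s x y.
Proof. by rewrite ipC ipZr rmorphM/= -ipC. Qed.

Lemma ipNr x y : s x (- y) = - s x y.
Proof. by rewrite -scaleN1r ipZr mulN1r. Qed.

Lemma ipNl x y : s (- x) y = - s x y.
Proof. by rewrite ipC ipNr rmorphN/= -ipC. Qed.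

Lemma ipBr x y z : s x (y - z) = s x y - s x z.
Proof. by rewrite ipDr ipNr. Qed.

Lemma ip0r x : s x 0 = 0.
Proof. by rewrite -(scale0r 0) ipZr mul0r. Qed.

Lemma ip_Re_ge0 x : 0 <= complex.Re (s x x).
Proof. by have := ip_ge0 s x; rewrite lecE => /andP[]. Qed.

Lemma nrm_ge0 x : 0 <= nrm x. Proof. exact: sqrtr_ge0. Qed.

Lemma sqr_nrm x : nrm x ^+ 2 = complex.Re (s x x).
Proof. by rewrite sqr_sqrtr// ip_Re_ge0. Qed.

Lemma ip_nrm x : s x x = (nrm x ^+ 2)%:C.
Proof.
rewrite sqr_nrm; have := ip_ge0 s x; rewrite lecE => /andP[/eqP/= h _].
by apply/eqP; rewrite eq_complex /= h !eqxx.
Qed.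

Lemma Re_conjc (c : R[i]) : complex.Re (conjc c) = complex.Re c.
Proof. by case: c. Qed.

Lemma sqr_nrmD x y : nrm (x + y) ^+ 2 =
  nrm x ^+ 2 + nrm y ^+ 2 + 2 * complex.Re (s x y).
Proof.
rewrite !sqr_nrm ipDl !ipDr (ipC s x y) !raddfD/= Re_conjc; ring.
Qed.

Lemma nrmZ c x : nrm (c *: x) = nc c * nrm x.
Proof.
rewrite /nrm ipZl ipZr mulrA [conjc c * c]mulrC mulc_conj ip_nrm -rmorphM /=.
by rewrite sqrtrM ?sqr_ge0// sqrtr_sqr ger0_norm ?normc_ge0// -sqr_nrm.
Qed.

(** The optimal choice is [t = 1 / b]; if [b = 0], large [t] force [a = 0]. It serves Cauchy-Schwarz
    and, with [e = d ^+ 2], the estimate for near-minimizers in [approx_riesz]. *)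
Lemma quad_ge (a b e : R) : 0 <= a -> 0 <= b -> 0 <= e ->
  (forall t, 0 <= t -> - e <= - 2 * t * a + t ^+ 2 * a * b) -> a <= e * b.
Proof.
move=> a0 b0 e0 h; have [b00|bn0] := eqVneq b 0.
  rewrite b00 mulr0 leNgt; apply/negP => ap.
  have := h ((e + 1) / a) _; rewrite b00 mulr0 addr0 -!mulrA mulVf ?gt_eqF//.
  by rewrite mulr1 divr_ge0//; [move=> /(_ isT)|]; lra.
have bp : 0 < b by rewrite lt_neqAle eq_sym bn0.
have := h b^-1; rewrite invr_ge0 => /(_ b0).
have -> : - 2 * b^-1 * a + b^-1 ^+ 2 * a * b = - (a / b).
  by field; rewrite gt_eqF.
by rewrite lerN2 ler_pdivrMr.
Qed.

Lemma cauchy_schwarz x y : nc (s x y) <= nrm x * nrm y.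
Proof.
rewrite -ler_sqr ?nnegrE ?normc_ge0 ?mulr_ge0 ?nrm_ge0// exprMn.
apply: quad_ge; rewrite ?sqr_ge0// => t t0.
pose c := (- t)%:C * conjc (s x y).
have := sqr_ge0 (nrm (x + c *: y)); rewrite sqr_nrmD nrmZ ipZr exprMn.
have -> : complex.Re (c * s x y) = - t * nc (s x y) ^+ 2.
  rewrite /c -mulrA [conjc _ * _]mulrC mulc_conj -rmorphM/=. by [].
have -> : nc c ^+ 2 = t ^+ 2 * nc (s x y) ^+ 2.
  by rewrite /c Normc.normcM normc_real normc_conj normrN exprMn real_normK ?num_real.
lra.
Qed.

Lemma nrmD x y : nrm (x + y) <= nrm x + nrm y.
Proof.
rewrite -ler_sqr ?nnegrE ?addr_ge0 ?nrm_ge0// sqr_nrmD sqrrD.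
have := le_trans (Re_le_normc _) (cauchy_schwarz x y); lra.
Qed.

(** Riesz representation up to an error [d]; an exact representer may exist only in the completion
    of [V]. *)
Definition approx (phi : V -> R[i]) z (d : R) : Prop :=
  forall w, nc (s w z - phi w) <= d * nrm w.

(** An exact representer would minimize [|z|^2 - 2 Re (phi z)]; a point within [d^2] of the infimum
    represents [phi] up to [d]. *)
Lemma approx_riesz (phi : V -> R[i]) (K d : R) :
  (forall w w', phi (w + w') = phi w + phi w') ->
  (forall c w, phi (c *: w) = conjc c * phi w) ->
  0 <= K -> (forall w, nc (phi w) <= K * nrm w) -> 0 < d ->
  exists z, approx phi z d.
Proof.
move=> phiD phiZ K0 phiK d0.
pose J z := nrm z ^+ 2 - 2 * complex.Re (phi z).
pose E := [set J z | z in setT].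
have Einf : has_inf E.
  split; first by exists (J 0), 0.
  exists (- K ^+ 2) => _ [z _ <-]; rewrite /J.
  have := le_trans (Re_le_normc _) (phiK z); have := sqr_ge0 (nrm z - K); nra.
have d2 : 0 < d ^+ 2 by rewrite exprn_gt0.
have [_ [z _ <-] hz] := inf_adherent d2 Einf.
exists z => w.
rewrite -ler_sqr ?nnegrE ?normc_ge0 ?mulr_ge0 ?nrm_ge0 ?(ltW d0)// exprMn.
apply: quad_ge; rewrite ?sqr_ge0 ?(ltW d2)// => t t0.
set c := s w z - phi w.
have : inf E <= J (z + ((- t)%:C * c) *: w).
  by apply: ge_inf; [exact: Einf.2|exists (z + ((- t)%:C * c) *: w)].
rewrite /J sqr_nrmD nrmZ phiD phiZ ipZr raddfD/= exprMn.
have -> : nc ((- t)%:C * c) ^+ 2 = t ^+ 2 * nc c ^+ 2.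
  by rewrite Normc.normcM normc_real normrN exprMn real_normK ?num_real.
have -> : complex.Re ((- t)%:C * c * s z w) = - t * complex.Re (c * conjc (s w z)).
  rewrite -mulrA -ipC; case: (c * _) => a b /=; ring.
have -> : complex.Re (conjc ((- t)%:C * c) * phi w) = - t * complex.Re (c * conjc (phi w)).
  rewrite rmorphM/= -[X in X * conjc c * _]/(conjc (- t)%:C) conjc_real -mulrA.
  by case: c => a b; case: (phi w) => e f /=; ring.
have : complex.Re (c * conjc (s w z)) - complex.Re (c * conjc (phi w)) = nc c ^+ 2.
  by rewrite -raddfB -mulrBr -rmorphB /= mulc_conj.
move: hz; rewrite /J.
set a := complex.Re (c * _); set b := complex.Re (c * _).
move=> hz hab hinf.
have : inf E <= nrm z ^+ 2 + t ^+ 2 * nc c ^+ 2 * nrm w ^+ 2 + 2 * (- t * a)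
   - 2 * (complex.Re (phi z) + - t * b) by [].
have -> : a = b + nc c ^+ 2 by lra.
lra.
Qed.

Lemma approx_close (phi : V -> R[i]) z z' (d d' : R) : 0 <= d -> 0 <= d' ->
  approx phi z d -> approx phi z' d' -> nrm (z - z') <= d + d'.
Proof.
move=> d0 d'0 h h'; have [->|n0] := eqVneq (nrm (z - z')) 0; first exact: addr_ge0.
have np : 0 < nrm (z - z') by rewrite lt_neqAle eq_sym n0 nrm_ge0.
rewrite -(ler_pM2r np) -expr2 sqr_nrm; set w := z - z'.
apply: le_trans (Re_le_normc _) _.
rewrite (_ : s w w = (s w z - phi w) - (s w z' - phi w)); last first.
  by rewrite {2}/w ipBr opprB addrA subrK.
apply: le_trans (le_normcD _ _) _; rewrite normcN mulrDl.
exact: lerD (h w) (h' w).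
Qed.

Lemma approx_nrm (phi : V -> R[i]) z (d K : R) : 0 <= d -> 0 <= K ->
  (forall w, nc (phi w) <= K * nrm w) -> approx phi z d -> nrm z <= K + d.
Proof.
move=> d0 K0 hK h; have [->|n0] := eqVneq (nrm z) 0; first exact: addr_ge0.
have np : 0 < nrm z by rewrite lt_neqAle eq_sym n0 nrm_ge0.
rewrite -(ler_pM2r np) -expr2 sqr_nrm.
apply: le_trans (Re_le_normc _) _.
rewrite -(subrK (phi z) (s z z)) mulrDl addrC.
by apply: le_trans (le_normcD _ _) _; apply: lerD.
Qed.

End SemiInner.

(** * Bounded families of sesquilinear forms and their product *)

Section Forms.
Variables (R : realType) (V : lmodType R[i]) (I : Type).
Notation nc := (@Normc.normc R).

Record hfam := HFam {
  hsp :> I -> semi_inner V;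
  hfam_nontrivial : exists i v, 0 < nrm (hsp i) v }.

Variable H : hfam.

Definition sesquilinear (t : V -> V -> R[i]) : Prop :=
  [/\ forall x y z, t x (y + z) = t x y + t x z,
      forall c x y, t x (c *: y) = c * t x y,
      forall x y z, t (x + y) z = t x z + t y z &
      forall c x y, t (c *: x) y = conjc c * t x y].

Definition form_bound (t : I -> V -> V -> R[i]) (K : R) : Prop :=
  forall i x y, nc (t i x y) <= K * nrm (H i) x * nrm (H i) y.

Definition bform_pred : {pred I -> V -> V -> R[i]} := fun t =>
  `[< (forall i, sesquilinear (t i)) /\ exists2 K, 0 <= K & form_bound t K >].

Let lcE c (t u : I -> V -> V -> R[i]) i x y :
  (c *: t + u) i x y = c * t i x y + u i x y.
Proof. by []. Qed.

Lemma bform_submod : submod_closed bform_pred.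
Proof.
split.
  apply/asboolP; split.
    by move=> i; split=> * /=; rewrite ?fctE ?addr0 ?mulr0.
  by exists 0 => // i x y; rewrite !mul0r Normc.normc0.
move=> c t u /asboolP[tS [K K0 tK]] /asboolP[uS [L L0 uL]]; apply/asboolP; split.
  move=> i; have [t1 t2 t3 t4] := tS i; have [u1 u2 u3 u4] := uS i.
  split=> *; rewrite !lcE ?t1 ?u1 ?t2 ?u2 ?t3 ?u3 ?t4 ?u4; ring.
exists (nc c * K + L); first by rewrite addr_ge0// mulr_ge0// normc_ge0.
move=> i x y; rewrite lcE; apply: le_trans (le_normcD _ _) _.
rewrite Normc.normcM !mulrDl; apply: lerD => //.
by rewrite -!mulrA; apply: ler_wpM2l; rewrite ?normc_ge0// mulrA.
Qed.

HB.instance Definition _ :=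
  GRing.isSubmodClosed.Build R[i] (I -> V -> V -> R[i]) bform_pred bform_submod.

(* Bounded families of operators on the semi-inner product spaces [(V, H i)],
   encoded by their sesquilinear forms so that no completion is needed. *)
Record bform := BForm { bform_val :> I -> V -> V -> R[i]; bformP : bform_val \in bform_pred }.

HB.instance Definition _ := [isSub for bform_val].
HB.instance Definition _ := [Choice of bform by <:].
HB.instance Definition _ := [SubChoice_isSubLmodule of bform by <:].

Implicit Types t u v : bform.

Lemma bform_eq t u : (forall i x y, t i x y = u i x y) -> t = u.
Proof.
by move=> h; apply/val_inj/funext => i; apply/funext => x; apply/funext => y; exact: h.
Qed.

Lemma bformD t u i x y : (t + u) i x y = t i x y + u i x y. Proof. by []. Qed.
Lemma bformB t u i x y : (t - u) i x y = t i x y - u i x y. Proof. by []. Qed.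
Lemma bformZ c t i x y : (c *: t) i x y = c * t i x y. Proof. by []. Qed.

Lemma bform_sesq t i : sesquilinear (t i).
Proof. by have /asboolP[h _] := bformP t. Qed.

Lemma bform_bounded t : exists2 K, 0 <= K & form_bound t K.
Proof. by have /asboolP[_ h] := bformP t. Qed.

Definition fnorm t : R := inf [set K : R | 0 <= K /\ form_bound t K].

Lemma fnorm_has_inf t : has_inf [set K : R | 0 <= K /\ form_bound t K].
Proof.
split; first by have [K K0 tK] := bform_bounded t; exists K.
by exists 0 => K [].
Qed.

Lemma fnorm_ge0 t : 0 <= fnorm t.
Proof. by apply: lb_le_inf; [exact: (fnorm_has_inf t).1|move=> K []]. Qed.

Lemma fnorm_le t K : 0 <= K -> form_bound t K -> fnorm t <= K.
Proof. by move=> K0 tK; apply: ge_inf; [exact: (fnorm_has_inf t).2|]. Qed.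

Lemma fnormP t : form_bound t (fnorm t).
Proof.
move=> i x y; apply/ler_addgt0Pr => e e0.
set a := nrm (H i) x; set b := nrm (H i) y.
have a0 : 0 <= a by exact: nrm_ge0.
have b0 : 0 <= b by exact: nrm_ge0.
have ab : 0 < a * b + 1 by rewrite ltr_wpDl// mulr_ge0.
have [K [K0 tK] hK] := inf_adherent (divr_gt0 e0 ab) (fnorm_has_inf t).
apply: le_trans (tK i x y) _; rewrite -/a -/b -!mulrA.
have h : K * (a * b) <= (fnorm t + e / (a * b + 1)) * (a * b).
  by rewrite ler_wpM2r ?mulr_ge0// ltW.
apply: le_trans h _; rewrite mulrDl lerD2l mulrAC ler_pdivrMr// ler_pM2l// lerDl//.
Qed.

(** Here [z] stands, up to [d], for the image of [y] under the operator of [u], a vector of the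
    completion. *)
Definition right_approx u i y z (d : R) : Prop :=
  0 <= d /\ approx (H i) (fun w => u i w y) z d.

Lemma right_approx_ex u i y d : 0 < d -> exists z, right_approx u i y z d.
Proof.
move=> d0; have [u1 u2 u3 u4] := bform_sesq u i.
have [|||||z hz] := @approx_riesz _ _ (H i) (fun w => u i w y) (fnorm u * nrm (H i) y) d.
- by move=> w w'; exact: u3.
- by move=> c w; exact: u4.
- by rewrite mulr_ge0 ?fnorm_ge0 ?nrm_ge0.
- by move=> w; rewrite mulrAC; exact: fnormP.
- by [].
- by exists z; split => //; exact: ltW.
Qed.

Lemma formBr t i x y z : t i x (y - z) = t i x y - t i x z.
Proof.
by have [t1 t2 _ _] := bform_sesq t i; rewrite t1 -scaleN1r t2 mulN1r.
Qed.

Lemma form_close t i x z z' a : nrm (H i) (z - z') <= a ->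
  nc (t i x z - t i x z') <= fnorm t * nrm (H i) x * a.
Proof.
move=> h; rewrite -formBr; apply: le_trans (fnormP _ _ _ _) _.
by apply: ler_wpM2l => //; rewrite mulr_ge0 ?fnorm_ge0 ?nrm_ge0.
Qed.

(** The value of the product form at [(x, y)] is the limit of [t i x z] along approximants [z] of
    [u y] with errors [1 / (n + 1)]. The estimate, valid for every approximant, characterizes the
    product and yields all its algebraic laws. *)
Lemma fmul_ex t u : exists v : I -> V -> V -> R[i], forall i x y z d,
  right_approx u i y z d -> nc (v i x y - t i x z) <= fnorm t * nrm (H i) x * d.
Proof.
suff h : forall p : I * V * V, exists c : R[i], forall z d,
    right_approx u p.1.1 p.2 z d ->
    nc (c - t p.1.1 p.1.2 z) <= fnorm t * nrm (H p.1.1) p.1.2 * d.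
  by have [v vP] := choice h; exists (fun i x y => v (i, x, y)) => i x y z d;
    exact: (vP (i, x, y)).
move=> [[i x] y] /=; set K := fnorm t * nrm (H i) x.
have K0 : 0 <= K by rewrite mulr_ge0 ?fnorm_ge0 ?nrm_ge0.
have dpos n : 0 < n.+1%:R^-1 :> R by rewrite invr_gt0 ltr0Sn.
have [z zP] := choice (fun n => @right_approx_ex u i y _ (dpos n)).
have zz z' d n : right_approx u i y z' d -> nrm (H i) (z n - z') <= n.+1%:R^-1 + d.
  move=> [d0 h]; exact: (approx_close (ltW (dpos n)) d0 (zP n).2 h).
have small (e : R) : 0 < e -> exists N, forall n, (N <= n)%N -> n.+1%:R^-1 < e.
  move=> e0; exists (Num.bound e^-1) => n Nn.
  rewrite -[e]invrK ltf_pV2 ?posrE ?invr_gt0//.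
  apply: le_lt_trans (ler_norm _) _.
  apply: lt_le_trans (archi_boundP (normr_ge0 _)) _.
  rewrite ler_nat; apply: leq_trans _ (leqnSn n); apply: leq_trans Nn.
  by rewrite ger0_norm// invr_ge0 ltW.
have [|c hc] := @complex_complete R (fun n => t i x (z n)).
  move=> e e0; have K1 : 0 < 2 * K + 1 by lra.
  have [N hN] := small _ (divr_gt0 e0 K1); exists N => m n Nm Nn.
  apply: le_lt_trans (form_close t x (zz _ _ m (zP n))) _; rewrite -/K.
  have := hN m Nm; have := hN n Nn; rewrite !ltr_pdivlMr//.
  move: (dpos m) (dpos n); move: (_^-1) (_^-1) => a b; nra.
exists c => z' d hz'; apply/ler_addgt0Pr => e e0.
have K2 : 0 < 2 * (K + 1) by lra.
have [N hN] := small _ (divr_gt0 e0 K2); have [M hM] := hc (e / 2) (divr_gt0 e0 (ltr0n _ 2)).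
pose n := maxn N M.
apply: le_trans (normc_dist3 _ (t i x (z n)) _) _.
have h1 := form_close t x (zz _ _ n hz'); rewrite -/K in h1.
have := hM n (leq_maxr _ _); have := hN n (leq_maxl _ _).
rewrite ltr_pdivlMr// (normcB c); move: h1 (dpos n); move: (_^-1) => b; nra.
Qed.

Definition fmul_fun t u := projT1 (cid (fmul_ex t u)).

Lemma fmul_funP t u i x y z d : right_approx u i y z d ->
  nc (fmul_fun t u i x y - t i x z) <= fnorm t * nrm (H i) x * d.
Proof. by move=> h; exact: (projT2 (cid (fmul_ex t u))). Qed.

End Forms.

Section FormAlgebra.
Variables (R : realType) (V : lmodType R[i]) (I : Type) (H : hfam V I).
Notation nc := (@Normc.normc R).
Notation B := (bform H).
Implicit Types t u v : B.

Let le_small (a b K : R) : (forall d, 0 < d -> a <= b + K * d) -> a <= b.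
Proof.
move=> h; rewrite -subr_le0; apply: (@le0_of_le_small _ _ K) => d d0.
by rewrite lerBlDl; exact: h.
Qed.

Let apx u i y z d : right_approx u i y z d -> forall w, nc (H i w z - u i w y) <= d * nrm (H i) w.
Proof. by case. Qed.

Lemma right_approx_lin u i c y y' z z' d d' :
  right_approx u i y z d -> right_approx u i y' z' d' ->
  right_approx u i (c *: y + y') (c *: z + z') (nc c * d + d').
Proof.
move=> [d0 h] [d'0 h']; split; first by rewrite addr_ge0// mulr_ge0// normc_ge0.
have [u1 u2 u3 u4] := bform_sesq u i.
move=> w; rewrite u1 u2 ipDr ipZr.
rewrite (_ : _ - _ = c * (H i w z - u i w y) + (H i w z' - u i w y')); last by ring.
apply: le_trans (le_normcD _ _) _; rewrite mulrDl; apply: lerD => //.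
by rewrite Normc.normcM -mulrA; apply: ler_wpM2l => //; exact: normc_ge0.
Qed.

Lemma right_approx_nrm u i y z d : right_approx u i y z d ->
  nrm (H i) z <= fnorm u * nrm (H i) y + d.
Proof.
move=> [d0 h]; apply: (approx_nrm d0 _ _ h).
  by rewrite mulr_ge0 ?fnorm_ge0 ?nrm_ge0.
by move=> w; rewrite mulrAC; exact: fnormP.
Qed.

Lemma fmul_bform t u : fmul_fun t u \in bform_pred H.
Proof.
apply/asboolP; split; last first.
  exists (fnorm t * fnorm u); first by rewrite mulr_ge0 ?fnorm_ge0.
  move=> i x y; apply: (@le_small _ _ (2 * (fnorm t * nrm (H i) x))) => d d0.
  have [z hz] := right_approx_ex u i y d0.
  have h1 := fmul_funP t x hz; have h2 := right_approx_nrm hz.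
  have h3 := fnormP t i x z; have h4 := le_normcD (fmul_fun t u i x y - t i x z) (t i x z).
  rewrite subrK in h4.
  have K0 : 0 <= fnorm t * nrm (H i) x by rewrite mulr_ge0 ?fnorm_ge0 ?nrm_ge0.
  have := ler_wpM2l K0 h2; lra.
move=> i; have [t1 t2 t3 t4] := bform_sesq t i.
have lin c x y y' : fmul_fun t u i x (c *: y + y') = c * fmul_fun t u i x y + fmul_fun t u i x y'.
  apply: (@eq_of_normc_small _ _ _ (2 * (fnorm t * nrm (H i) x) * (nc c + 1))) => d d0.
  have [z hz] := right_approx_ex u i y d0; have [z' hz'] := right_approx_ex u i y' d0.
  have h1 := fmul_funP t x hz; have h2 := fmul_funP t x hz'.
  have h3 := fmul_funP t x (right_approx_lin c hz hz').
  apply: le_trans (normc_dist3 _ (t i x (c *: z + z')) _) _.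
  rewrite [X in _ + nc X](_ : _ = - (c * (fmul_fun t u i x y - t i x z)
      + (fmul_fun t u i x y' - t i x z'))); last by rewrite t1 t2; ring.
  rewrite normcN; have := le_normcD (c * (fmul_fun t u i x y - t i x z)) (fmul_fun t u i x y' - t i x z').
  rewrite Normc.normcM; have := ler_wpM2l (normc_ge0 c) h1; lra.
have alin c x x' y : fmul_fun t u i (c *: x + x') y =
    conjc c * fmul_fun t u i x y + fmul_fun t u i x' y.
  pose K := fnorm t * (nrm (H i) (c *: x + x') + nc c * nrm (H i) x + nrm (H i) x').
  apply: (@eq_of_normc_small _ _ _ K) => d d0.
  have [z hz] := right_approx_ex u i y d0.
  have h1 := fmul_funP t x hz; have h2 := fmul_funP t x' hz.
  have h3 := fmul_funP t (c *: x + x') hz.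
  apply: le_trans (normc_dist3 _ (t i (c *: x + x') z) _) _.
  rewrite [X in _ + nc X](_ : _ = - (conjc c * (fmul_fun t u i x y - t i x z)
      + (fmul_fun t u i x' y - t i x' z))); last by rewrite t3 t4; ring.
  rewrite normcN; have := le_normcD (conjc c * (fmul_fun t u i x y - t i x z)) (fmul_fun t u i x' y - t i x' z).
  rewrite Normc.normcM normc_conj; have := ler_wpM2l (normc_ge0 c) h1.
  rewrite /K; lra.
have f0r x : fmul_fun t u i x 0 = 0.
  have := lin 1 x 0 0; rewrite scale1r addr0 mul1r => e.
  by rewrite -(addrK (fmul_fun t u i x 0) (fmul_fun t u i x 0)) -e subrr.
have f0l y : fmul_fun t u i 0 y = 0.
  have := alin 1 0 0 y; rewrite scale1r addr0 conjc1 mul1r => e.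
  by rewrite -(addrK (fmul_fun t u i 0 y) (fmul_fun t u i 0 y)) -e subrr.
split.
- by move=> x y z; have := lin 1 x y z; rewrite scale1r mul1r.
- by move=> c x y; have := lin c x y 0; rewrite !addr0 f0r addr0.
- by move=> x y z; have := alin 1 x y z; rewrite scale1r conjc1 mul1r.
- by move=> c x y; have := alin c x 0 y; rewrite !addr0 f0l addr0.
Qed.

Definition fmul t u : B := BForm (fmul_bform t u).

Lemma fmulP t u i x y z d : right_approx u i y z d ->
  nc (fmul t u i x y - t i x z) <= fnorm t * nrm (H i) x * d.
Proof. exact: fmul_funP. Qed.

Lemma fmul_exact t u i x y z : (forall w, H i w z = u i w y) ->
  fmul t u i x y = t i x z.
Proof.
move=> h; apply: (@eq_of_normc_small _ _ _ 0) => d d0; rewrite mul0r.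
rewrite -(mulr0 (fnorm t * nrm (H i) x)); apply: fmulP; split=> // w.
by rewrite h subrr Normc.normc0 mul0r.
Qed.

Lemma fone_bform : (fun i x y => H i x y) \in bform_pred H.
Proof.
apply/asboolP; split.
  by move=> i; split=> *; rewrite ?ipDr ?ipZr ?ipDl ?ipZl.
by exists 1 => // i x y; rewrite mul1r; exact: cauchy_schwarz.
Qed.

Definition fone : B := BForm fone_bform.

Lemma fmulA : associative fmul.
Proof.
move=> t u v; apply: bform_eq => i x y.
pose K := fnorm t * nrm (H i) x * (2 + fnorm u) + fnorm (fmul t u) * nrm (H i) x.
apply: (@eq_of_normc_small _ _ _ K) => d d0.
have [z hz] := right_approx_ex v i y d0; have [w hw] := right_approx_ex u i z d0.
have hw' : right_approx (fmul u v) i y w (d + fnorm u * d).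
  split; first by rewrite addr_ge0 ?mulr_ge0 ?fnorm_ge0// ltW.
  move=> w'; apply: le_trans (normc_dist3 _ (u i w' z) _) _; rewrite mulrDl.
  apply: lerD; first exact: (apx hw).
  by rewrite normcB mulrAC; exact: fmulP.
have h1 := fmulP t x hw'; have h2 := fmulP (fmul t u) x hz; have h3 := fmulP t x hw.
apply: le_trans (normc_dist3 _ (t i x w) _) _.
have := normc_dist3 (t i x w) (fmul t u i x z) (fmul (fmul t u) v i x y).
by rewrite normcB in h2; rewrite normcB in h3; rewrite /K; lra.
Qed.

Lemma fmul1 : left_id fone fmul.
Proof.
move=> u; apply: bform_eq => i x y; apply: (@eq_of_normc_small _ _ _
  (fnorm fone * nrm (H i) x + nrm (H i) x)) => d d0.
have [z hz] := right_approx_ex u i y d0.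
apply: le_trans (normc_dist3 _ (H i x z) _) _; rewrite mulrDl; apply: lerD.
  exact: (fmulP fone x hz).
by rewrite mulrC; exact: (apx hz).
Qed.

Lemma fmulr1 : right_id fone fmul.
Proof. by move=> t; apply: bform_eq => i x y; exact: fmul_exact. Qed.

Lemma fmulDl : left_distributive fmul +%R.
Proof.
move=> t t' u; apply: bform_eq => i x y.
pose K := (fnorm (t + t') + fnorm t + fnorm t') * nrm (H i) x.
apply: (@eq_of_normc_small _ _ _ K) => d d0.
have [z hz] := right_approx_ex u i y d0.
have h1 := fmulP (t + t') x hz; have h2 := fmulP t x hz; have h3 := fmulP t' x hz.
apply: le_trans (normc_dist3 _ ((t + t') i x z) _) _.
rewrite !bformD [X in _ + nc X](_ : _ = - ((fmul t u i x y - t i x z)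
      + (fmul t' u i x y - t' i x z))); last by ring.
rewrite normcN; have := le_normcD (fmul t u i x y - t i x z) (fmul t' u i x y - t' i x z).
rewrite bformD in h1; rewrite /K; lra.
Qed.

Lemma right_approxD u v i y z z' d d' :
  right_approx u i y z d -> right_approx v i y z' d' ->
  right_approx (u + v) i y (z + z') (d + d').
Proof.
move=> [d0 h] [d'0 h']; split; first exact: addr_ge0.
move=> w; rewrite ipDr bformD opprD addrACA mulrDl.
by apply: le_trans (le_normcD _ _) _; exact: lerD.
Qed.

Lemma right_approxZ c u i y z d :
  right_approx u i y z d -> right_approx (c *: u) i y (c *: z) (nc c * d).
Proof.
move=> [d0 h]; split; first by rewrite mulr_ge0// normc_ge0.
move=> w; rewrite ipZr bformZ -mulrBr Normc.normcM -mulrA.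
by apply: ler_wpM2l => //; exact: normc_ge0.
Qed.

Lemma fmulDr : right_distributive fmul +%R.
Proof.
move=> t u v; apply: bform_eq => i x y; have [t1 _ _ _] := bform_sesq t i.
pose K := 4 * fnorm t * nrm (H i) x.
apply: (@eq_of_normc_small _ _ _ K) => d d0.
have [z hz] := right_approx_ex u i y d0; have [z' hz'] := right_approx_ex v i y d0.
have h1 := fmulP t x (right_approxD hz hz').
have h2 := fmulP t x hz; have h3 := fmulP t x hz'.
apply: le_trans (normc_dist3 _ (t i x (z + z')) _) _.
rewrite bformD t1 [X in _ + nc X](_ : _ = - ((fmul t u i x y - t i x z)
      + (fmul t v i x y - t i x z'))); last by ring.
rewrite normcN; have := le_normcD (fmul t u i x y - t i x z) (fmul t v i x y - t i x z').
rewrite t1 in h1; rewrite /K; lra.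
Qed.

Lemma fone_neq0 : fone != 0.
Proof.
apply/eqP => h; have [i [v vp]] := hfam_nontrivial H.
have : fone i v v = (0 : B) i v v by rewrite h.
rewrite -[LHS]/(H i v v) ip_nrm -[RHS]/(0 : R[i]) => /(congr1 (@complex.Re R)) /=.
by move/eqP; rewrite sqrf_eq0 gt_eqF.
Qed.

HB.instance Definition _ := GRing.Zmodule_isNzRing.Build B
  fmulA fmul1 fmulr1 fmulDl fmulDr fone_neq0.

Lemma fscaleAl (c : R[i]) t u : c *: (t * u) = c *: t * u.
Proof.
apply: bform_eq => i x y; pose K := (nc c * fnorm t + fnorm (c *: t)) * nrm (H i) x.
apply: (@eq_of_normc_small _ _ _ K) => d d0.
have [z hz] := right_approx_ex u i y d0.
have h1 := fmulP t x hz; have h2 := fmulP (c *: t) x hz.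
apply: le_trans (normc_dist3 _ ((c *: t) i x z) _) _.
rewrite [X in nc X + _](_ : _ = c * (fmul t u i x y - t i x z)); last first.
  by rewrite !bformZ mulrBr.
rewrite Normc.normcM; rewrite normcB in h2.
have h3 := ler_wpM2l (normc_ge0 c) h1.
apply: le_trans (lerD h3 h2) _; rewrite /K; lra.
Qed.

HB.instance Definition _ := GRing.Lmodule_isLalgebra.Build R[i] B fscaleAl.

Lemma fscaleAr (c : R[i]) t u : c *: (t * u) = t * (c *: u).
Proof.
apply: bform_eq => i x y; have [_ t2 _ _] := bform_sesq t i.
pose K := 2 * nc c * fnorm t * nrm (H i) x.
apply: (@eq_of_normc_small _ _ _ K) => d d0.
have [z hz] := right_approx_ex u i y d0.
have h1 := fmulP t x hz; have h2 := fmulP t x (right_approxZ c hz).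
apply: le_trans (normc_dist3 _ (t i x (c *: z)) _) _.
rewrite [X in nc X + _](_ : _ = c * (fmul t u i x y - t i x z)); last first.
  by rewrite bformZ t2 mulrBr.
rewrite Normc.normcM; rewrite normcB in h2.
have h3 := ler_wpM2l (normc_ge0 c) h1.
apply: le_trans (lerD h3 h2) _; rewrite /K; lra.
Qed.

HB.instance Definition _ := GRing.Lalgebra_isAlgebra.Build R[i] B fscaleAr.

End FormAlgebra.

Section FormCStar.
Variables (R : realType) (V : lmodType R[i]) (I : Type) (H : hfam V I).
Notation nc := (@Normc.normc R).
Notation B := (bform H).
Implicit Types t u v : B.

Lemma fstar_bform t : (fun i x y => conjc (t i y x)) \in bform_pred H.
Proof.
have [K K0 tK] := bform_bounded t; apply/asboolP; split.
  move=> i; have [t1 t2 t3 t4] := bform_sesq t i.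
  by split=> *; rewrite ?t1 ?t2 ?t3 ?t4 ?rmorphD ?rmorphM/= ?conjcK.
by exists K => // i x y; rewrite normc_conj mulrAC; exact: tK.
Qed.

Definition fstar t : B := BForm (fstar_bform t).

Lemma fstarK : involutive fstar.
Proof. by move=> t; apply: bform_eq => i x y; rewrite /= conjcK. Qed.

Lemma fstarE t i x y : fstar t i x y = conjc (t i y x). Proof. by []. Qed.

Lemma fstarD : {morph fstar : t u / t + u}.
Proof.
by move=> t u; apply: bform_eq => i x y; rewrite bformD !fstarE bformD rmorphD.
Qed.

Lemma fstarZ (c : R[i]) t : fstar (c *: t) = conjc c *: fstar t.
Proof. by apply: bform_eq => i x y; rewrite bformZ !fstarE bformZ rmorphM. Qed.

Lemma fstarM t u : fstar (t * u) = fstar u * fstar t.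
Proof.
apply: bform_eq => i x y.
pose K := fnorm (fstar u) * nrm (H i) x + (fnorm (fstar t) * nrm (H i) y + 1) +
  (fnorm u * nrm (H i) x + 1) + fnorm t * nrm (H i) y.
apply: (@eq_of_normc_small _ _ _ K) => e e0.
(* The bound by 1 keeps the norms of the approximants bounded independently of [e]. *)
pose d := Num.min e 1; have d0 : 0 < d by rewrite lt_min e0 ltr01.
have de : d <= e by rewrite ge_min lexx.
have d1 : d <= 1 by rewrite ge_min lexx orbT.
have [z hz] := right_approx_ex u i x d0.
have [z' hz'] := right_approx_ex (fstar t) i y d0.
have nz := right_approx_nrm hz; have nz' := right_approx_nrm hz'.
have h1 := fmulP t y hz; have h2 := hz'.2 z; have h3 := hz.2 z'.
have h4 := fmulP (fstar u) x hz'.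
rewrite -normc_conj rmorphB /= in h1.
rewrite normcB in h2; rewrite -normc_conj rmorphB /= -ipC in h3.
rewrite normcB in h4.
apply: le_trans (normc_dist3 _ (conjc (t i y z)) _) _.
apply: le_trans (lerD h1 (normc_dist3 _ (H i z z') _)) _.
apply: le_trans (lerD (lexx _) (lerD h2 (normc_dist3 _ (conjc (u i z' x)) _))) _.
apply: le_trans (lerD (lexx _) (lerD (lexx _) (lerD h3 h4))) _.
have a1 : d * nrm (H i) z <= e * (fnorm u * nrm (H i) x + 1).
  by apply: ler_pM; rewrite ?nrm_ge0 ?(ltW d0)//; lra.
have a2 : d * nrm (H i) z' <= e * (fnorm (fstar t) * nrm (H i) y + 1).
  by apply: ler_pM; rewrite ?nrm_ge0 ?(ltW d0)//; lra.
have a3 : fnorm t * nrm (H i) y * d <= fnorm t * nrm (H i) y * e.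
  by apply: ler_wpM2l; rewrite ?mulr_ge0 ?fnorm_ge0 ?nrm_ge0.
have a4 : fnorm (fstar u) * nrm (H i) x * d <= fnorm (fstar u) * nrm (H i) x * e.
  by apply: ler_wpM2l; rewrite ?mulr_ge0 ?fnorm_ge0 ?nrm_ge0.
rewrite /K; lra.
Qed.

Lemma fnorm_eq0 t : fnorm t = 0 -> t = 0.
Proof.
move=> h; apply: bform_eq => i x y; apply/Normc.eq0_normc/eqP.
rewrite eq_le normc_ge0 andbT; apply: le_trans (fnormP t i x y) _.
by rewrite h !mul0r.
Qed.

Lemma fnormD t u : fnorm (t + u) <= fnorm t + fnorm u.
Proof.
apply: fnorm_le; first by rewrite addr_ge0 ?fnorm_ge0.
move=> i x y; rewrite bformD !mulrDl; apply: le_trans (le_normcD _ _) _.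
by apply: lerD; exact: fnormP.
Qed.

Lemma fnormZ_le c t : fnorm (c *: t) <= nc c * fnorm t.
Proof.
apply: fnorm_le; first by rewrite mulr_ge0 ?fnorm_ge0 ?normc_ge0.
move=> i x y; rewrite bformZ Normc.normcM -!mulrA.
by apply: ler_wpM2l; rewrite ?normc_ge0// mulrA; exact: fnormP.
Qed.

Lemma fnormZ c t : fnorm (c *: t) = nc c * fnorm t.
Proof.
apply/eqP; rewrite eq_le fnormZ_le/=; have [->|c0] := eqVneq c 0.
  by rewrite Normc.normc0 mul0r fnorm_ge0.
have cp : 0 < nc c.
  by rewrite lt_neqAle normc_ge0 andbT eq_sym; apply: contra_neq c0 => /Normc.eq0_normc.
rewrite -ler_pdivlMl//; have := fnormZ_le c^-1 (c *: t).
by rewrite scalerA mulVf// scale1r Normc.normcV.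
Qed.

Lemma fnormM t u : fnorm (t * u) <= fnorm t * fnorm u.
Proof.
apply: fnorm_le; first by rewrite mulr_ge0 ?fnorm_ge0.
move=> i x y; apply/ler_addgt0Pr => e e0.
set K := fnorm t * nrm (H i) x.
have K0 : 0 <= K by rewrite mulr_ge0 ?fnorm_ge0 ?nrm_ge0.
have d0 : 0 < e / (2 * K + 1) by rewrite divr_gt0//; lra.
have [z hz] := right_approx_ex u i y d0; set d := e / _ in d0 hz.
have dK : d * (2 * K + 1) = e by rewrite /d divfK// gt_eqF//; lra.
have h1 := fmulP t x hz; have h2 := right_approx_nrm hz.
have h3 := fnormP t i x z; have h4 := le_normcD (fmul t u i x y - t i x z) (t i x z).
rewrite subrK in h4; rewrite -/K in h1 h3.
have := ler_wpM2l K0 h2; rewrite -[(t * u) i x y]/(fmul t u i x y).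
rewrite (_ : fnorm t * fnorm u * nrm (H i) x * nrm (H i) y = K * (fnorm u * nrm (H i) y)).
  lra.
by rewrite /K; ring.
Qed.

Lemma fnorm_fstar t : fnorm (fstar t) = fnorm t.
Proof.
have le u : fnorm (fstar u) <= fnorm u.
  apply: fnorm_le; first exact: fnorm_ge0.
  by move=> i x y; rewrite normc_conj mulrAC; exact: fnormP.
by apply/eqP; rewrite eq_le le -{1}(fstarK t) le.
Qed.

Lemma fnorm_star t : fnorm (fstar t * t) = fnorm t ^+ 2.
Proof.
apply/eqP; rewrite eq_le; apply/andP; split.
  by apply: le_trans (fnormM _ _) _; rewrite fnorm_fstar expr2.
set K := fnorm (fstar t * t); have K0 : 0 <= K by exact: fnorm_ge0.
rewrite -[K]sqr_sqrtr// ler_sqr ?nnegrE ?fnorm_ge0 ?sqrtr_ge0//.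
apply: fnorm_le; first exact: sqrtr_ge0.
move=> i x y; set a := nrm (H i) x; set b := nrm (H i) y.
have a0 : 0 <= a by exact: nrm_ge0.
have b0 : 0 <= b by exact: nrm_ge0.
(* an approximant [z] of [t y] has [nrm z ^ 2 <= K * b ^ 2] up to a small error *)
have key : nc (t i x y) <= Num.sqrt K * b * a.
  apply/ler_addgt0Pr => e e0.
  pose eta := e / (2 * (a + 1)); have a1 : 0 < 2 * (a + 1) by lra.
  have eta0 : 0 < eta by rewrite divr_gt0.
  have etaE : eta * (2 * (a + 1)) = e by rewrite /eta divfK// gt_eqF.
  have F0 : 0 <= fnorm t by exact: fnorm_ge0.
  have Fb : 0 <= fnorm t * b by rewrite mulr_ge0.
  have F1 : 0 < 2 * (fnorm t * b) + 1 by lra.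
  pose d0 := Num.min (eta ^+ 2 / (2 * (fnorm t * b) + 1)) eta.
  pose d := Num.min 1 d0.
  have dp : 0 < d by rewrite !lt_min ltr01 divr_gt0 ?exprn_gt0.
  have d1 : d <= 1 by rewrite ge_min lexx.
  have d2 : d <= eta by rewrite !ge_min lexx !orbT.
  have d3 : d * (2 * (fnorm t * b) + 1) <= eta ^+ 2.
    by rewrite -ler_pdivlMr// !ge_min lexx !orbT.
  have [z hz] := right_approx_ex t i y dp.
  have nz := right_approx_nrm hz; rewrite -/b in nz.
  have z0 := nrm_ge0 (H i) z.
  have h1 := hz.2 z; have h2 := hz.2 x.
  have h3 := fmulP (fstar t) y hz; rewrite fnorm_fstar -/b in h3.
  have h4 : nc (fmul (fstar t) t i y y) <= K * b * b by exact: fnormP.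
  have h5 := normc_dist3 (fstar t i y z) (fmul (fstar t) t i y y) 0.
  rewrite !subr0 normcB in h5.
  have h6 : nc (fstar t i y z) = nc (t i z y) by rewrite /= normc_conj.
  have h7 : nrm (H i) z ^+ 2 <= (Num.sqrt K * b + eta) ^+ 2.
    rewrite sqrrD exprMn (sqr_sqrtr K0).
    have : 0 <= Num.sqrt K * b * eta.
      by apply: mulr_ge0; [exact: mulr_ge0 (sqrtr_ge0 _) b0|exact: ltW].
    have := le_trans (Re_le_normc _) (lexx (nc (H i z z))); rewrite -sqr_nrm.
    have := normc_dist3 (H i z z) (t i z y) 0; rewrite !subr0.
    rewrite h6 in h5.
    have : d * nrm (H i) z <= d * (fnorm t * b + d) by rewrite ler_pM2l.
    have : d * d <= d by rewrite ler_piMr// ltW.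
    rewrite expr2; move: d3 h1 h3 h4 h5; rewrite !expr2 => *; lra.
  have h8 : nrm (H i) z <= Num.sqrt K * b + eta.
    by rewrite -ler_sqr ?nnegrE// addr_ge0 ?(ltW eta0)// mulr_ge0// sqrtr_ge0.
  have h9 := cauchy_schwarz (H i) x z; rewrite -/a in h9 h2.
  have := normc_dist3 (t i x y) (H i x z) 0; rewrite !subr0 normcB.
  have := ler_wpM2l a0 h8; have := ler_wpM2r a0 d2; lra.
by apply: le_trans key _; rewrite mulrAC.
Qed.

Lemma fnorm_complete (w : nat -> B) :
  cauchy_for (@fnorm _ _ _ H) w -> exists l : B, cvg_for (@fnorm _ _ _ H) w l.
Proof.
move=> wC.
have wij i x y e : 0 < e -> exists K, forall m n, (K <= m)%N -> (K <= n)%N ->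
    nc (w m i x y - w n i x y) < e.
  move=> e0; set a := nrm (H i) x; set b := nrm (H i) y.
  have ab : 0 < a * b + 1 by rewrite ltr_wpDl// mulr_ge0 ?nrm_ge0.
  have [K hK] := wC _ (divr_gt0 e0 ab); exists K => m n Km Kn.
  apply: le_lt_trans (fnormP (w m - w n) i x y) _; rewrite -/a -/b.
  have := hK m n Km Kn; rewrite ltr_pdivlMr//; have := fnorm_ge0 (w m - w n).
  have : 0 <= a * b by rewrite mulr_ge0 ?nrm_ge0.
  set c := fnorm _; rewrite -mulrA; move: (a * b) => g; nra.
have /choice[l lP] : forall p : I * V * V, exists c : R[i], forall e, 0 < e ->
    exists K, forall n, (K <= n)%N -> nc (w n p.1.1 p.1.2 p.2 - c) <= e.
  by move=> [[i x] y]; apply: complex_complete => e /wij; exact.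
pose L i x y := l (i, x, y).
have LP i x y e : 0 < e -> exists n, nc (w n i x y - L i x y) <= e /\ (forall m, (n <= m)%N -> nc (w m i x y - L i x y) <= e).
  by move=> e0; have [K hK] := lP (i, x, y) e e0; exists K; split=> [|m]; exact: hK.
have near e : 0 < e -> exists K, forall n, (K <= n)%N -> forall i x y,
    nc (w n i x y - L i x y) <= e * nrm (H i) x * nrm (H i) y.
  move=> e0; have [K hK] := wC _ e0; exists K => n Kn i x y.
  apply/ler_addgt0Pr => d d0; have [m [_ hm]] := LP i x y d d0.
  apply: le_trans (normc_dist3 _ (w (maxn K m) i x y) _) _; apply: lerD.
    apply: le_trans (fnormP (w n - w (maxn K m)) i x y) _.
    rewrite -!mulrA; apply: ler_wpM2r; first by rewrite mulr_ge0 ?nrm_ge0.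
    by apply/ltW/hK => //; exact: leq_maxl.
  by apply: hm; exact: leq_maxr.
have Lb : L \in bform_pred H.
  apply/asboolP; split; last first.
    have [K hK] := near 1 ltr01; exists (1 + fnorm (w K)); first by rewrite addr_ge0 ?fnorm_ge0.
    move=> i x y; rewrite -(subrK (w K i x y) (L i x y)).
    apply: le_trans (le_normcD _ _) _; rewrite !mulrDl; apply: lerD.
      by rewrite normcB; exact: hK.
    exact: fnormP.
  move=> i.
  have lin x y (x' y' : V) c d (x'' y'' : V) : (forall n, w n i x y = c * w n i x' y' + d * w n i x'' y'') ->
      L i x y = c * L i x' y' + d * L i x'' y''.
    move=> h; apply: (@eq_of_normc_small _ _ _ (1 + nc c + nc d)) => e e0.
    have [n1 [_ h1]] := LP i x y e e0; have [n2 [_ h2]] := LP i x' y' e e0.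
    have [n3 [_ h3]] := LP i x'' y'' e e0; pose n := maxn n1 (maxn n2 n3).
    have := h1 n (leq_maxl _ _); have := h2 n (leq_trans (leq_maxl _ _) (leq_maxr _ _)).
    have := h3 n (leq_trans (leq_maxr _ _) (leq_maxr _ _)).
    rewrite h => g3 g2 g1.
    apply: le_trans (normc_dist3 _ (c * w n i x' y' + d * w n i x'' y'') _) _.
    rewrite normcB [X in _ + nc X](_ : _ = c * (w n i x' y' - L i x' y') +
      d * (w n i x'' y'' - L i x'' y'')); last by ring.
    have := le_normcD (c * (w n i x' y' - L i x' y')) (d * (w n i x'' y'' - L i x'' y'')).
    rewrite !Normc.normcM.
    have := ler_wpM2l (normc_ge0 c) g2; have := ler_wpM2l (normc_ge0 d) g3; lra.
  split.
  - move=> x y z; rewrite -[L i x y]mul1r -[X in _ = _ + X]mul1r; apply: lin => n.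
    by have [h _ _ _] := bform_sesq (w n) i; rewrite h !mul1r.
  - move=> c x y; rewrite -[RHS]addr0 -[X in _ = _ + X](mul0r (L i x y)); apply: lin => n.
    by have [_ h _ _] := bform_sesq (w n) i; rewrite h mul0r addr0.
  - move=> x y z; rewrite -[L i x z]mul1r -[X in _ = _ + X]mul1r; apply: lin => n.
    by have [_ _ h _] := bform_sesq (w n) i; rewrite h !mul1r.
  - move=> c x y; rewrite -[RHS]addr0 -[X in _ = _ + X](mul0r (L i x y)); apply: lin => n.
    by have [_ _ _ h] := bform_sesq (w n) i; rewrite h mul0r addr0.
exists (BForm Lb); apply/cvgrPdist_le => e e0.
have [K hK] := near e e0; exists K => // n /= Kn.
rewrite sub0r normrN ger0_norm ?fnorm_ge0//.
apply: fnorm_le; first exact: ltW.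
by move=> i x y; exact: hK.
Qed.

Definition form_alg : cstarAlg R :=
  CStarAlg fstarK fstarD fstarZ fstarM fnorm_eq0 fnormD fnormZ fnormM
    fnorm_star fnorm_complete.

End FormCStar.

(** * GNS spaces and the universal representation *)

Section UniversalRep.
Variables (R : realType) (A : cstarAlg R).
Notation nc := (@Normc.normc R).
Implicit Types a x y : A.

Definition state := {f : A -> R[i] | is_state f}.

Section OneState.
Variables (f : A -> R[i]) (hf : is_state f).

Let ip_f x y := f (star x * y).

Fact gns_ipDr x y z : ip_f x (y + z) = ip_f x y + ip_f x z.
Proof. by have [fD _ _ _ _] := hf; rewrite /ip_f mulrDr fD. Qed.

Fact gns_ipZr c x y : ip_f x (c *: y) = c * ip_f x y.
Proof. by have [_ fZ _ _ _] := hf; rewrite /ip_f -scalerAr fZ. Qed.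

Fact gns_ipC x y : ip_f y x = conjc (ip_f x y).
Proof. by have [_ _ _ fs _] := hf; rewrite /ip_f -fs starM starK. Qed.

Fact gns_ip_ge0 x : 0 <= ip_f x x.
Proof. by have [_ _ _ _ fp] := hf; exact: fp. Qed.

Definition gns := SemiInner gns_ipDr gns_ipZr gns_ipC gns_ip_ge0.

Lemma gnsE x y : gns x y = f (star x * y). Proof. by []. Qed.

Lemma gns_star a x y : gns x (a * y) = gns (star a * x) y.
Proof. by rewrite !gnsE starM starK mulrA. Qed.

(** For [k] a root of [|a|^2 + e - a^* a], positivity of [f] at [star (k * y) * (k * y)] is the
    squared inequality up to a multiple of [e]. *)
Lemma gns_nrm_mul a y : nrm gns (a * y) <= cnorm a * nrm gns y.
Proof.
have [fD fZ f1 fs fp] := hf.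
rewrite -ler_sqr ?nnegrE ?mulr_ge0 ?nrm_ge0 ?cnorm_ge0// exprMn !sqr_nrm !gnsE.
rewrite -subr_ge0 -oppr_le0.
apply: (@le0_of_le_small _ _ (complex.Re (f (star y * y)))) => e e0.
have [||//|k [hk kk _]] := @pos_sqrt _ _ ((cnorm a ^+ 2)%:C%:A - star a * a) e.
- by apply: saB; [exact: sa_scalar|exact: sa_sq].
- by rewrite opprB -scaleNrr mu_shift mu_star_mul_cnorm subrr.
have : 0 <= complex.Re (f (star (k * y) * (k * y))).
  by have := fp (k * y); rewrite lecE => /andP[].
rewrite starM hk -mulrA (mulrA k k) kk.
have -> : star y * (((cnorm a ^+ 2)%:C%:A - star a * a + e%:C%:A) * y) =
    (cnorm a ^+ 2 + e)%:C *: (star y * y) + (-1) *: (star (a * y) * (a * y)).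
  rewrite addrAC -scalerDlr mulrBl mulrBr -scalerAl mul1r -scalerAr scaleN1r.
  by rewrite starM !mulrA.
rewrite fD !fZ mulN1r raddfB/=.
have ReZ (t : R) (c : R[i]) : complex.Re (t%:C * c) = t * complex.Re c.
  by case: c => ? ? /=; ring.
rewrite ReZ; lra.
Qed.

Lemma gns_nrm1 : nrm gns 1 = 1.
Proof.
have [fD fZ f1 fs fp] := hf.
by rewrite /nrm gnsE star1 mul1r f1 /= sqrtr1.
Qed.

End OneState.

Fact gns_nontrivial : exists (i : state) v, 0 < nrm (gns (svalP i)) v.
Proof.
have [f hf] := exists_state1 A; exists (exist _ f hf), 1.
by rewrite gns_nrm1.
Qed.

Definition gns_fam : hfam A state := HFam gns_nontrivial.

Notation B := (form_alg gns_fam).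

Fact rep_bform a : (fun i x y => gns_fam i x (a * y)) \in bform_pred gns_fam.
Proof.
apply/asboolP; split.
  by move=> i; split=> *; rewrite -?scalerAr ?mulrDr ?ipDr ?ipZr ?ipDl ?ipZl.
exists (cnorm a); first exact: cnorm_ge0.
move=> i x y; apply: le_trans (cauchy_schwarz _ _ _) _.
rewrite mulrC mulrAC; apply: ler_wpM2r; first exact: nrm_ge0.
exact: gns_nrm_mul.
Qed.

Definition rep a : B := BForm (rep_bform a).

(** The lower bound for the norm comes from a state with [f (star x * x) = |x|^2], tested on the
    vectors [x] and [1]; this is why the family runs over all states. *)
Lemma rep_embedding : is_embedding rep.
Proof.
split; [split|].
- move=> c x y; apply: bform_eq => i u v.
  by rewrite bformD bformZ /= mulrDl -scalerAl; rewrite -(ipZr (gns_fam i)) -ipDr.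
- split; first by apply: bform_eq => i u v; rewrite /= mul1r.
  move=> x y; apply: bform_eq => i u v; apply/esym.
  rewrite [LHS](@fmul_exact _ _ _ _ (rep x) (rep y) i u v (y * v))//=.
  by rewrite -mulrA.
- move=> x; apply: bform_eq => i u v.
  rewrite -[RHS]/(conjc (gns (svalP i) v (x * u))) -ipC.
  by rewrite -[LHS]/(gns (svalP i) u (star x * v)) gns_star starK.
move=> x; apply/eqP; rewrite eq_le; apply/andP; split.
  apply: fnorm_le; first exact: cnorm_ge0.
  move=> i u v; apply: le_trans (cauchy_schwarz _ _ _) _.
  rewrite mulrC mulrAC; apply: ler_wpM2r; first exact: nrm_ge0.
  exact: gns_nrm_mul.
have [f hf fx] := exists_state x.
pose i : state := exist _ f hf.
have e : nrm (gns_fam i) x = cnorm x.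
  by rewrite /nrm -[gns_fam i x x]/(f (star x * x)) fx /= sqrtr_sqr ger0_norm ?cnorm_ge0.
have := fnormP (rep x) i x 1; rewrite e (gns_nrm1 (svalP i)) mulr1.
rewrite -[rep x i x 1]/(f (star x * (x * 1))) mulr1 fx normc_real ger0_norm ?sqr_ge0//.
have [->|n0] := eqVneq (cnorm x) 0; first by move=> _; exact: fnorm_ge0.
by rewrite expr2 ler_pM2r// lt_neqAle eq_sym n0 cnorm_ge0.
Qed.

End UniversalRep.

(** * From matrix bounds to dominating forms *)

Section Dot.
Variable R : realType.
Notation C := R[i].
Notation nc := (@Normc.normc R).

Section DotN.
Variable n : nat.

Let dot_f (u v : 'rV[C]_n) := \sum_l conjc (u 0 l) * v 0 l.

Fact dotDr u v w : dot_f u (v + w) = dot_f u v + dot_f u w.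
Proof. by rewrite -big_split; apply: eq_bigr => l _; rewrite mxE mulrDr. Qed.

Fact dotZr c u v : dot_f u (c *: v) = c * dot_f u v.
Proof. by rewrite mulr_sumr; apply: eq_bigr => l _; rewrite mxE mulrCA. Qed.

Fact dotC u v : dot_f v u = conjc (dot_f u v).
Proof.
by rewrite raddf_sum; apply: eq_bigr => l _; rewrite /= rmorphM/= conjcK mulrC.
Qed.

Fact dot_ge0 u : 0 <= dot_f u u.
Proof. by apply: sumr_ge0 => l _; rewrite mulrC mulcJ_ge0. Qed.

Definition dot := SemiInner dotDr dotZr dotC dot_ge0.

Lemma dotE u v : dot u v = \sum_l conjc (u 0 l) * v 0 l. Proof. by []. Qed.

Lemma nrm_dot u : nrm dot u ^+ 2 = \sum_l nc (u 0 l) ^+ 2.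
Proof.
rewrite sqr_nrm dotE raddf_sum; apply: eq_bigr => l _.
by rewrite mulrC mulc_conj.
Qed.

Lemma nrm_dot_eq0 u : nrm dot u = 0 -> u = 0.
Proof.
move=> h; have := nrm_dot u; rewrite h expr0n /= => /esym/eqP.
rewrite psumr_eq0 => [/allP h'|l _]; last exact: sqr_ge0.
apply/rowP => l; rewrite mxE; apply/Normc.eq0_normc/eqP.
by have := h' l (mem_index_enum l); rewrite sqrf_eq0.
Qed.

Lemma dot_conj_nrm (u : 'rV[C]_n) : nrm dot (map_mx conjc u) = nrm dot u.
Proof.
apply/eqP; rewrite -(@eqrXn2 _ 2)// ?nrm_ge0// !nrm_dot.
by apply/eqP/eq_bigr => l _; rewrite mxE normc_conj.
Qed.

End DotN.

(** Operator norm at most 1. The pairing is bilinear, without conjugation, so that transposes and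
    conjugates remain contractive by a change of variables. *)
Definition contr m n (M : 'M[C]_(m, n)) : Prop :=
  forall (u : 'rV[C]_m) (v : 'rV[C]_n),
  nc (\sum_l \sum_l' u 0 l * M l l' * v 0 l') <= nrm (dot m) u * nrm (dot n) v.

Lemma contrP m n (M : 'M[C]_(m, n)) :
  contr M <-> forall v : 'rV[C]_n, nrm (dot m) (\row_l \sum_l' M l l' * v 0 l') <= nrm (dot n) v.
Proof.
have e (u : 'rV[C]_m) (v : 'rV[C]_n) : \sum_l \sum_l' u 0 l * M l l' * v 0 l' =
    dot m (map_mx conjc u) (\row_l \sum_l' M l l' * v 0 l').
  rewrite dotE; apply: eq_bigr => l _; rewrite !mxE conjcK mulr_sumr.
  by apply: eq_bigr => l' _; rewrite mulrA.
split=> h.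
  move=> v; set w := \row_l _.
  have [->|n0] := eqVneq (nrm (dot m) w) 0; first exact: nrm_ge0.
  have np : 0 < nrm (dot m) w by rewrite lt_neqAle eq_sym n0 nrm_ge0.
  rewrite -(ler_pM2l np) -expr2; have := h (map_mx conjc w) v; rewrite e dot_conj_nrm.
  rewrite [X in dot m X _](_ : _ = w); last by apply/rowP => l; rewrite !mxE conjcK.
  by rewrite -/w ip_nrm normc_real ger0_norm ?sqr_ge0.
move=> u v; rewrite e; apply: le_trans (cauchy_schwarz _ _ _) _.
by rewrite dot_conj_nrm; apply: ler_wpM2l => //; exact: nrm_ge0.
Qed.

Lemma contr_tr m n (M : 'M[C]_(m, n)) : contr M -> contr M^T.
Proof.
move=> h u v; have := h v u; rewrite mulrC; congr (nc _ <= _).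
rewrite exchange_big; apply: eq_bigr => l _; apply: eq_bigr => l' _.
by rewrite mxE; ring.
Qed.

Lemma contr_conj m n (M : 'M[C]_(m, n)) : contr M -> contr (map_mx conjc M).
Proof.
move=> h u v; have := h (map_mx conjc u) (map_mx conjc v).
rewrite !dot_conj_nrm -normc_conj; congr (nc _ <= _).
rewrite raddf_sum; apply: eq_bigr => l _; rewrite raddf_sum; apply: eq_bigr => l' _.
by rewrite /= !mxE !rmorphM/= !conjcK.
Qed.

Lemma contr_mul m n p (M : 'M[C]_(m, n)) (N : 'M[C]_(n, p)) :
  contr M -> contr N -> contr (M *m N).
Proof.
move=> /contrP hM /contrP hN; apply/contrP => v.
apply: le_trans (hN v); apply: le_trans (hM _); rewrite le_eqVlt; apply/orP; left.
apply/eqP; congr (nrm _ _); apply/rowP => l; rewrite !mxE.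
under eq_bigr do rewrite mxE mulr_suml.
rewrite exchange_big; apply: eq_bigr => j _; rewrite mxE mulr_sumr.
by apply: eq_bigr => l' _; rewrite mulrA.
Qed.

End Dot.

(** * Douglas factorization in a semi-inner product space *)

Section Douglas.
Variables (R : realType) (V : lmodType R[i]) (s : semi_inner V).
Notation C := R[i].
Notation nc := (@Normc.normc R).

Lemma ip_suml n (w : 'I_n -> C) (e : 'I_n -> V) x :
  s (\sum_l w l *: e l) x = \sum_l conjc (w l) * s (e l) x.
Proof.
rewrite ipC; have -> : s x (\sum_l w l *: e l) = \sum_l w l * s x (e l).
  elim/big_ind2: _ => [|u v u' v' <- <-|l _]; [exact: ip0r|exact: ipDr|exact: ipZr].
by rewrite raddf_sum; apply: eq_bigr => l _; rewrite /= rmorphM/= -ipC.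
Qed.

Lemma ip_sumr n (w : 'I_n -> C) (e : 'I_n -> V) x :
  s x (\sum_l w l *: e l) = \sum_l w l * s x (e l).
Proof.
elim/big_ind2: _ => [|u v u' v' <- <-|l _]; [exact: ip0r|exact: ipDr|exact: ipZr].
Qed.

Section OneFamily.
Variables (n : nat) (e : 'I_n -> V).

Definition coeffs x : 'rV[C]_n := \row_l s (e l) x.
Definition synth (w : 'rV[C]_n) : V := \sum_l w 0 l *: e l.

Lemma synth_coeffs w x : s (synth w) x = dot _ n w (coeffs x).
Proof. by rewrite ip_suml dotE; apply: eq_bigr => l _; rewrite mxE. Qed.

Lemma coeffsD x y : coeffs (x + y) = coeffs x + coeffs y.
Proof. by apply/rowP => l; rewrite !mxE ipDr. Qed.

Lemma coeffsB x y : coeffs (x - y) = coeffs x - coeffs y.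
Proof. by apply/rowP => l; rewrite !mxE ipBr. Qed.

Lemma coeffs_sum m (v : 'I_m -> C) (f : 'I_m -> V) :
  coeffs (\sum_j v j *: f j) = \sum_j v j *: coeffs (f j).
Proof.
by apply/rowP => l; rewrite !mxE ip_sumr summxE; apply: eq_bigr => j _; rewrite !mxE.
Qed.

Lemma synthD w w' : synth (w + w') = synth w + synth w'.
Proof. by rewrite -big_split; apply: eq_bigr => l _; rewrite mxE scalerDl. Qed.

Lemma synthZ c w : synth (c *: w) = c *: synth w.
Proof. by rewrite scaler_sumr; apply: eq_bigr => l _; rewrite mxE scalerA. Qed.

(** Adding [d] makes the Gram matrix, which is singular for dependent families, positive
    definite. *)
Lemma gram_solve (d : R) (b : 'rV[C]_n) : 0 < d ->
  exists w, coeffs (synth w) + d%:C *: w = b.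
Proof.
move=> d0; pose A : 'M[C]_n := \matrix_(l', l) (s (e l) (e l') + d%:C *+ (l' == l)).
have AE w : w *m A = coeffs (synth w) + d%:C *: w.
  apply/rowP => l; rewrite !mxE ip_sumr.
  under eq_bigr do rewrite mxE mulrDr.
  rewrite big_split /=; congr (_ + _).
  rewrite (bigD1 l)//= eqxx mulr1n big1 ?addr0; first by rewrite mulrC.
  by move=> l' l'l; rewrite (negbTE l'l) mulr0n mulr0.
have Au : A \in unitmx.
  rewrite -row_free_unit -kermx_eq0; apply/rowV0P => w /sub_kermxP.
  rewrite AE => h; apply: nrm_dot_eq0.
  have := congr1 (dot _ n w) h; rewrite ipDr ipZr ip0r -synth_coeffs !ip_nrm.
  move=> /(congr1 (@complex.Re R)); rewrite -rmorphM -rmorphD /= => h1.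
  have h2 := sqr_ge0 (nrm s (synth w)); have h3 := sqr_ge0 (nrm (dot R n) w).
  have : nrm (dot R n) w ^+ 2 = 0.
    by apply/eqP; rewrite eq_le h3 andbT -(pmulr_rle0 _ d0); lra.
  by move/eqP; rewrite sqrf_eq0 => /eqP.
by exists (b *m invmx A); rewrite -AE mulmxKV.
Qed.

End OneFamily.

Lemma nrm_anal n (e : 'I_n -> V) x :
  nrm (dot R n) (coeffs e x) ^+ 2 = \sum_l nc (s x (e l)) ^+ 2.
Proof.
by rewrite nrm_dot; apply: eq_bigr => l _; rewrite mxE ipC normc_conj.
Qed.

(* [W] is [(G + d)^-1 X] for the Gram matrix [G] of [e] and [X] of the
   pairings of [e] with [f]. *)
Lemma douglas n m (e : 'I_n -> V) (f : 'I_m -> V) (d : R) : 0 < d ->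
  (forall x, \sum_j nc (s x (f j)) ^+ 2 <= \sum_l nc (s x (e l)) ^+ 2) ->
  exists W : 'M[C]_(n, m), contr W /\
    forall j, nrm s (f j - \sum_l W l j *: e l) ^+ 2 <= d.
Proof.
move=> d0 hfe.
have hfe' x : nrm (dot R m) (coeffs f x) <= nrm (dot R n) (coeffs e x).
  by rewrite -ler_sqr ?nnegrE ?nrm_ge0// !nrm_anal.
have /choice[w wP] : forall j, exists w, coeffs e (synth e w) + d%:C *: w = coeffs e (f j).
  by move=> j; exact: gram_solve.
pose W : 'M[C]_(n, m) := \matrix_(l, j) w j 0 l.
pose Wv (v : 'rV[C]_m) : 'rV[C]_n := \sum_j v 0 j *: w j.
have WvP v : coeffs e (synth e (Wv v)) + d%:C *: Wv v = coeffs e (synth f v).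
  rewrite [RHS](coeffs_sum _ (fun j => v 0 j)).
  rewrite -(eq_bigr _ (fun j _ => congr1 ( *:%R (v 0 j)) (wP j))) /Wv.
  elim/big_ind2: _ => [|x y x' y' <- <-|j _].
  - rewrite scaler0 addr0; apply/rowP => l; rewrite !mxE /synth big1 ?ip0r//.
    by move=> l' _; rewrite mxE scale0r.
  - by rewrite synthD coeffsD scalerDr addrACA.
  - rewrite synthZ scalerDr scalerA mulrC -scalerA; congr (_ + _).
    by apply/rowP => l; rewrite !mxE ipZr.
have pair v r : nc (s r (synth f v)) <= nrm (dot R m) v * nrm (dot R n) (coeffs e r).
  rewrite ipC normc_conj synth_coeffs; apply: le_trans (cauchy_schwarz _ _ _) _.
  by apply: ler_wpM2l; [exact: nrm_ge0|exact: hfe'].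
(* If [(G + d) u = W v], then [|W v|^2] is the pairing of [synth e u] with [synth f v], which is at
   most [|v| |G u| <= |v| |W v|]. *)
have Wc v : nrm (dot R n) (Wv v) <= nrm (dot R m) v.
  have [u uP] := @gram_solve n e d (Wv v) d0.
  have [->|n0] := eqVneq (nrm (dot R n) (Wv v)) 0; first exact: nrm_ge0.
  have np : 0 < nrm (dot R n) (Wv v) by rewrite lt_neqAle eq_sym n0 nrm_ge0.
  rewrite -(ler_pM2r np) -expr2.
  have Gu : nrm (dot R n) (coeffs e (synth e u)) <= nrm (dot R n) (Wv v).
    rewrite -ler_sqr ?nnegrE ?nrm_ge0// -uP sqr_nrmD ipZr.
    have -> : complex.Re (d%:C * dot R n (coeffs e (synth e u)) u) =
        d * nrm s (synth e u) ^+ 2.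
      rewrite ipC -synth_coeffs ip_nrm conjc_real -rmorphM /=. by [].
    have := sqr_ge0 (nrm s (synth e u)); have := sqr_ge0 (nrm (dot R n) (d%:C *: u)).
    nra.
  have h : s (synth e u) (synth f v) = (nrm (dot R n) (Wv v) ^+ 2)%:C.
    rewrite synth_coeffs -WvP ipDr ipZr -synth_coeffs.
    rewrite -ip_nrm -[X in _ = dot R n X _]uP ipDl ipZl conjc_real; congr (_ + _).
    by rewrite ipC synth_coeffs -ipC.
  have := pair v (synth e u).
  rewrite h normc_real ger0_norm ?sqr_ge0// => /le_trans; apply.
  by apply: ler_wpM2l; [exact: nrm_ge0|].
exists W; split.
  apply/contrP => v; rewrite [X in nrm _ X <= _](_ : _ = Wv v)//.
  by apply/rowP => l; rewrite !mxE summxE; apply: eq_bigr => j _; rewrite !mxE mulrC.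
move=> j; pose v : 'rV[C]_m := \row_j' (j' == j)%:R.
have vf : synth f v = f j.
  rewrite /synth (bigD1 j)//= mxE eqxx scale1r big1 ?addr0// => j' jj.
  by rewrite mxE (negbTE jj) scale0r.
have vW : synth e (Wv v) = \sum_l W l j *: e l.
  apply: eq_bigr => l _; congr (_ *: _); rewrite summxE (bigD1 j)//= !mxE eqxx mul1r.
  by rewrite big1 ?addr0// => j' jj; rewrite !mxE (negbTE jj) mul0r.
have v1 : nrm (dot R m) v ^+ 2 = 1.
  rewrite nrm_dot (bigD1 j)//= mxE eqxx Normc.normc1 expr1n big1 ?addr0// => j' jj.
  by rewrite mxE (negbTE jj) Normc.normc0 expr0n.
(* The residual [r] has coefficients [d W v], hence [|r|^2 = <r, synth f v> - d |W v|^2 <= d |v| |W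
   v| <= d]. *)
rewrite -vW -vf; set r := synth f v - _.
have Tr : coeffs e r = d%:C *: Wv v by rewrite coeffsB -WvP addrC addrA addNr add0r.
have nTr : nrm (dot R n) (coeffs e r) = d * nrm (dot R n) (Wv v).
  by rewrite Tr nrmZ normc_real gtr0_norm.
rewrite sqr_nrm {2}/r ipBr raddfB/=.
have -> : s r (synth e (Wv v)) = (d * nrm (dot R n) (Wv v) ^+ 2)%:C.
  by rewrite ipC synth_coeffs Tr ipZr ip_nrm -rmorphM conjc_real.
have h1 := le_trans (Re_le_normc _) (pair v r).
have h2 := Wc v; have h3 := sqr_ge0 (nrm (dot R n) (Wv v)).
rewrite nTr in h1; have h4 : nrm (dot R m) v = 1.
  by apply/eqP; rewrite -(@eqrXn2 _ 2)// ?nrm_ge0// v1 expr1n.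
rewrite h4 in h1 h2; have h5 : d * nrm (dot R n) (Wv v) <= d by rewrite ger_pMr.
rewrite /=; nra.
Qed.

End Douglas.

(** * Matrix-norm bounds as inequalities between rank-one forms *)

Section KeyInequality.
Variables (R : realType) (V : lmodType R[i]) (s : semi_inner V).
Notation C := R[i].
Notation nc := (@Normc.normc R).
Notation re := (@complex.Re R).
Variables (k : nat) (a : 'I_k -> V -> V) (c0 : R).
Hypothesis aD : forall i x y, a i (x + y) = a i x + a i y.
Hypothesis aZ : forall i c x, a i (c *: x) = c *: a i x.
Hypothesis a_nrm : forall i x, nrm s (a i x) = nrm s x.

(* The estimate [|\sum_i c i (x) a i| <= c0] for contractive matrices [c i], in
   AM-GM form. *)
Definition cb_bound : Prop := forall n n' (e : 'I_n -> V) (x : 'I_n' -> V)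
  (c : 'I_k -> 'M[C]_(n, n')), (forall i, contr (c i)) ->
  re (\sum_i \sum_l \sum_l' c i l l' * s (e l) (a i (x l'))) <=
  c0 / 2 * (\sum_l nrm s (e l) ^+ 2 + \sum_l nrm s (x l) ^+ 2).

Hypothesis cb : cb_bound.

(** Quadratic form at [z] of the rank-one operator attached to [e]. *)
Definition brk (e : V) (z : V) : R := nc (s z e) ^+ 2.

Implicit Types (es xs : seq V) (js : seq (('I_k -> V) * ('I_k -> V))).

Definition nrm2s es : R := \sum_(e <- es) nrm s e ^+ 2.

Definition pairing js : R := \sum_(j <- js) \sum_i 2 * re (s (j.1 i) (a i (j.2 i))).

Let a_sum n i (w : 'I_n -> C) (x : 'I_n -> V) :
  a i (\sum_l w l *: x l) = \sum_l w l *: a i (x l).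
Proof.
elim/big_ind2: _ => [|u v u' v' <- <-|l _]; [|exact: aD|exact: aZ].
by rewrite -(scale0r (0 : V)) aZ !scale0r.
Qed.

(** For each [i], Douglas factorization writes the vectors [j.1 i] and [j.2 i], up to small errors,
    as combinations of [es] and [xs] with contractive coefficients [W i] and [Z i]. The pairing then
    has the coefficient matrices [conj (W i) *m (Z i)^T], again contractive, so [cb_bound] applies.
    As there, one pair of lists serves all [i]. *)
Lemma key_inequality es xs js :
  (forall i z, \sum_(j <- js) brk (j.1 i) z <= \sum_(e <- es) brk e z) ->
  (forall i z, \sum_(j <- js) brk (j.2 i) z <= \sum_(x <- xs) brk x z) ->
  pairing js <= c0 * (nrm2s es + nrm2s xs).
Proof.
pose d0 : ('I_k -> V) * ('I_k -> V) := (fun=> 0, fun=> 0).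
have bn T (d : T) (u : seq T) (F : T -> R) :
    \sum_(x <- u) F x = \sum_(j < size u) F (nth d u j).
  by rewrite (big_nth d) big_mkord.
rewrite /pairing /nrm2s (bn _ d0 js) (bn _ 0 es) (bn _ 0 xs) => he hx.
set m := size js in he hx *; set n := size es in he *; set n' := size xs in hx *.
pose f (j : 'I_m) i := (nth d0 js j).1 i; pose g (j : 'I_m) i := (nth d0 js j).2 i.
pose e (l : 'I_n) := nth 0 es l; pose x (l : 'I_n') := nth 0 xs l.
pose K := \sum_(j < m) \sum_i 2 * (nrm s (g j i) + nrm s (f j i) + 1).
rewrite -subr_le0; apply: (@le0_of_le_small _ _ K) => d' d'0.
pose d := Num.min d' 1; have dp : 0 < d by rewrite lt_min d'0 ltr01.
have dd' : d <= d' by rewrite ge_min lexx.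
have d1 : d <= 1 by rewrite ge_min lexx orbT.
have d2 : 0 < d ^+ 2 by rewrite exprn_gt0.
have /choice[W WP] : forall i, exists W : 'M[C]_(n, m), contr W /\
    forall j, nrm s (f j i - \sum_l W l j *: e l) ^+ 2 <= d ^+ 2.
  move=> i; apply: (@douglas _ _ s n m e (f ^~ i)) => // z.
  by have := he i z; rewrite (bn _ d0 js) (bn _ 0 es).
have /choice[Z ZP] : forall i, exists Z : 'M[C]_(n', m), contr Z /\
    forall j, nrm s (g j i - \sum_l Z l j *: x l) ^+ 2 <= d ^+ 2.
  move=> i; apply: (@douglas _ _ s n' m x (g ^~ i)) => // z.
  by have := hx i z; rewrite (bn _ d0 js) (bn _ 0 xs).
pose ft j i := \sum_l W i l j *: e l; pose gt j i := \sum_l Z i l j *: x l.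
have hf j i : nrm s (f j i - ft j i) <= d.
  by rewrite -ler_sqr ?nnegrE ?nrm_ge0 ?(ltW dp)//; exact: (WP i).2.
have hg j i : nrm s (g j i - gt j i) <= d.
  by rewrite -ler_sqr ?nnegrE ?nrm_ge0 ?(ltW dp)//; exact: (ZP i).2.
have err j i : re (s (f j i) (a i (g j i))) <=
    re (s (ft j i) (a i (gt j i))) + d * (nrm s (g j i) + nrm s (f j i) + 1).
  have -> : s (f j i) (a i (g j i)) = s (ft j i) (a i (gt j i)) +
     (s (f j i - ft j i) (a i (g j i)) + s (ft j i) (a i (g j i - gt j i))).
    have aB y z : a i (y - z) = a i y - a i z.
      by rewrite aD -scaleN1r aZ scaleN1r.
    by rewrite aB ipBr ipDl ipNl; ring.
  rewrite raddfD /= lerD2l.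
  apply: le_trans (Re_le_normc _) _; apply: le_trans (le_normcD _ _) _.
  have h1 := cauchy_schwarz s (f j i - ft j i) (a i (g j i)).
  have h2 := cauchy_schwarz s (ft j i) (a i (g j i - gt j i)).
  rewrite !a_nrm in h1 h2; have h3 := hf j i; have h4 := hg j i.
  have h5 : nrm s (ft j i) <= nrm s (f j i) + d.
    rewrite -(subrK (f j i) (ft j i)) addrC; apply: le_trans (nrmD _ _ _) _.
    by rewrite lerD2l -opprB -scaleN1r nrmZ normcN Normc.normc1 mul1r.
  have := ler_wpM2r (nrm_ge0 s (g j i)) h3.
  have := ler_wpM2l (nrm_ge0 s (ft j i)) h4.
  have := ler_wpM2r (ltW dp) h5; have := ler_wpM2r (ltW dp) d1; lra.
have main : \sum_(j < m) \sum_i 2 * re (s (ft j i) (a i (gt j i))) <=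
    c0 * (\sum_l nrm s (e l) ^+ 2 + \sum_l nrm s (x l) ^+ 2).
  have := @cb n n' e x (fun i => map_mx conjc (W i) *m (Z i)^T).
  have h i : contr (map_mx conjc (W i) *m (Z i)^T).
    by apply: contr_mul; [apply: contr_conj; exact: (WP i).1|apply: contr_tr; exact: (ZP i).1].
  move=> /(_ h).
  have -> : \sum_i \sum_l \sum_l' (map_mx conjc (W i) *m (Z i)^T) l l' * s (e l) (a i (x l')) =
      \sum_(j < m) \sum_i s (ft j i) (a i (gt j i)).
    rewrite [RHS]exchange_big; apply: eq_bigr => i _.
    under [RHS]eq_bigr do rewrite a_sum ip_suml.
    rewrite [RHS]exchange_big; apply: eq_bigr => l _.
    under [RHS]eq_bigr do rewrite ip_sumr mulr_sumr.
    rewrite [RHS]exchange_big; apply: eq_bigr => l' _.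
    by rewrite mxE mulr_suml; apply: eq_bigr => j _; rewrite !mxE mulrA.
  rewrite !raddf_sum /=.
  under eq_bigr do rewrite raddf_sum.
  have -> : \sum_(j < m) \sum_i 2 * re (s (ft j i) (a i (gt j i))) =
      2 * \sum_(j < m) \sum_i re (s (ft j i) (a i (gt j i))).
    by rewrite mulr_sumr; apply: eq_bigr => j _; rewrite mulr_sumr.
  lra.
have : \sum_(j < m) \sum_i 2 * re (s (f j i) (a i (g j i))) <=
    \sum_(j < m) \sum_i 2 * re (s (ft j i) (a i (gt j i))) + K * d.
  rewrite /K mulr_suml -big_split; apply: ler_sum => j _ /=.
  rewrite mulr_suml -big_split; apply: ler_sum => i _ /=.
  have := err j i; lra.
have : K * d <= K * d'.
  apply: ler_wpM2l => //; apply: sumr_ge0 => j _; apply: sumr_ge0 => i _.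
  by rewrite mulr_ge0// !addr_ge0// nrm_ge0.
rewrite /f /g /e /x in main * ; lra.
Qed.

End KeyInequality.

(** * Duality: dominating forms from the matrix-norm bound *)

Section Dominating.
Variables (R : realType) (V : lmodType R[i]) (s : semi_inner V).
Notation C := R[i].
Notation nc := (@Normc.normc R).
Notation re := (@complex.Re R).
Variables (k : nat) (a : 'I_k -> V -> V) (c0 : R).
Hypothesis aD : forall i x y, a i (x + y) = a i x + a i y.
Hypothesis aZ : forall i c x, a i (c *: x) = c *: a i x.
Hypothesis a_nrm : forall i x, nrm s (a i x) = nrm s x.
Hypothesis cb : cb_bound s a c0.

Notation W := ('I_k * bool -> V -> R[i]).
Notation brk := (brk s).
Notation nrm2s := (nrm2s s).
Notation pairing := (pairing s a).
Implicit Types (g : W) (es xs : seq V) (js : seq (('I_k -> V) * ('I_k -> V))).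

Definition dominated g : Prop := exists es, forall p z, nc (g p z) <= \sum_(e <- es) brk e z.

(** The components [(i, true)] will produce the forms [p i], the components [(i, false)] auxiliary
    forms [q i]. In [cost] the vectors of [es] and [xs] are charged at the rate [c0], and [js] earns
    its pairing. *)
Definition admissible g es xs js : Prop :=
  (forall i z, re (g (i, true) z) + \sum_(j <- js) brk (j.1 i) z <= \sum_(e <- es) brk e z) /\
  (forall i z, re (g (i, false) z) + \sum_(j <- js) brk (j.2 i) z <= \sum_(e <- xs) brk e z).

Definition cost es xs js : R := c0 * (nrm2s es + nrm2s xs) - pairing js.

(* [key_inequality] says that the gauge is nonnegative at 0, hence sublinear; a
   linear functional below it sends the rank-one brackets to the required forms. *)
Definition gauge g : R :=
  inf [set r | exists es xs js, admissible g es xs js /\ r = cost es xs js].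

Let brk_ge0 e z : 0 <= brk e z. Proof. exact: sqr_ge0. Qed.

Let brkZ c e z : brk (c *: e) z = nc c ^+ 2 * brk e z.
Proof. by rewrite /brk ipZr Normc.normcM exprMn. Qed.

Let brk_map c es z : \sum_(e <- map ( *:%R c) es) brk e z = nc c ^+ 2 * \sum_(e <- es) brk e z.
Proof. by rewrite big_map mulr_sumr; apply: eq_bigr => e _; rewrite brkZ. Qed.

Let dom_ge0 es z : 0 <= \sum_(e <- es) brk e z.
Proof. by apply: sumr_ge0 => e _. Qed.

Let nsq t : 0 <= t -> nc ((Num.sqrt t)%:C) ^+ 2 = t.
Proof. by move=> t0; rewrite normc_real real_normK ?num_real// sqr_sqrtr. Qed.

Lemma dominatedD g g' : dominated g -> dominated g' -> dominated (g + g').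
Proof.
move=> [es h] [es' h']; exists (es ++ es') => p z; rewrite big_cat /=.
by apply: le_trans (le_normcD _ _) _; exact: lerD.
Qed.

Lemma dominatedZ c g : dominated g -> dominated (c *: g).
Proof.
move=> [es h]; exists (map ( *:%R (Num.sqrt (nc c))%:C) es) => p z.
rewrite brk_map nsq ?normc_ge0// -[(c *: g) p z]/(c * g p z) Normc.normcM.
by apply: ler_wpM2l => //; exact: normc_ge0.
Qed.

Let pairing_cat js js' : pairing (js ++ js') = pairing js + pairing js'.
Proof. by rewrite /pairing big_cat. Qed.

Let nrm2s_cat es es' : nrm2s (es ++ es') = nrm2s es + nrm2s es'.
Proof. by rewrite /nrm2s big_cat. Qed.

Let nrm2s_map c es : nrm2s (map ( *:%R c) es) = nc c ^+ 2 * nrm2s es.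
Proof.
rewrite /nrm2s big_map mulr_sumr; apply: eq_bigr => e _.
by rewrite nrmZ exprMn.
Qed.

Let scale_js (c : C) (j : ('I_k -> V) * ('I_k -> V)) : ('I_k -> V) * ('I_k -> V) :=
  (fun i => c *: j.1 i, fun i => c *: j.2 i).

Let pairing_map (t : R) js : pairing (map (scale_js t%:C) js) = t ^+ 2 * pairing js.
Proof.
rewrite /pairing big_map mulr_sumr; apply: eq_bigr => j _.
rewrite mulr_sumr; apply: eq_bigr => i _ /=.
rewrite ipZl aZ ipZr conjc_real.
by case: (s _ _) => u v /=; ring.
Qed.

(** Adding [es0] to both lists absorbs [g] and reduces to [key_inequality]; the resulting lower
    bound makes the gauge finite. *)
Lemma cost_ge g es0 es xs js :
  (forall p z, nc (g p z) <= \sum_(e <- es0) brk e z) ->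
  admissible g es xs js -> - (2 * c0 * nrm2s es0) <= cost es xs js.
Proof.
move=> hg [h1 h2].
have := @key_inequality _ _ _ _ _ _ aD aZ a_nrm cb (es ++ es0) (xs ++ es0) js.
rewrite !nrm2s_cat /cost => h.
have : pairing js <= c0 * (nrm2s es + nrm2s es0 + (nrm2s xs + nrm2s es0)).
  apply: h => i z; rewrite big_cat /=.
    have := h1 i z; have := hg (i, true) z; have := Re_le_norm_normc (g (i, true) z).
    rewrite ler_norml => /andP[]; lra.
  have := h2 i z; have := hg (i, false) z; have := Re_le_norm_normc (g (i, false) z).
  rewrite ler_norml => /andP[]; lra.
lra.
Qed.

Lemma gauge_has_inf g : dominated g ->
  has_inf [set r | exists es xs js, admissible g es xs js /\ r = cost es xs js].
Proof.
move=> [es0 h]; split.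
  exists (cost es0 es0 [::]), es0, es0, [::]; split=> //.
  by split=> i z; rewrite big_nil addr0; apply: le_trans (h _ z); exact: Re_le_normc.
exists (- (2 * c0 * nrm2s es0)) => _ [es [xs [js [hadm ->]]]].
exact: cost_ge hadm.
Qed.

Lemma gauge_le g es xs js : dominated g -> admissible g es xs js ->
  gauge g <= cost es xs js.
Proof.
move=> hg hadm; apply: ge_inf; first exact: (gauge_has_inf hg).2.
by exists es, xs, js.
Qed.

Lemma le_gauge g r : dominated g ->
  (forall es xs js, admissible g es xs js -> r <= cost es xs js) -> r <= gauge g.
Proof.
move=> hg h; apply: lb_le_inf; first exact: (gauge_has_inf hg).1.
by move=> _ [es [xs [js [hadm ->]]]]; exact: h.
Qed.

Lemma gauge_sublinear : sublinear [set g : W | dominated g] gauge.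
Proof.
have le (t : R) g : 0 < t -> dominated g -> gauge (t%:C *: g) <= t * gauge g.
  move=> t0 hg; rewrite -ler_pdivrMl//; apply: le_gauge => // es xs js [h1 h2].
  rewrite ler_pdivrMl//.
  pose r := (Num.sqrt t)%:C.
  have rt : Num.sqrt t ^+ 2 = t by rewrite sqr_sqrtr// ltW.
  have -> : t * cost es xs js = cost (map ( *:%R r) es) (map ( *:%R r) xs) (map (scale_js r) js).
    rewrite /cost !nrm2s_map pairing_map nsq ?(ltW t0)// rt; ring.
  have ReZ (c : R[i]) : re (t%:C * c) = t * re c by case: c => ? ? /=; ring.
  apply: gauge_le; first exact: dominatedZ.
  split=> i z; rewrite brk_map nsq ?(ltW t0)// big_map.
    rewrite -[(t%:C *: g) _ z]/(t%:C * g (i, true) z) ReZ.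
    under eq_bigr do rewrite /= brkZ nsq ?(ltW t0)//.
    by rewrite -mulr_sumr -mulrDr ler_pM2l.
  rewrite -[(t%:C *: g) _ z]/(t%:C * g (i, false) z) ReZ.
  under eq_bigr do rewrite /= brkZ nsq ?(ltW t0)//.
  by rewrite -mulr_sumr -mulrDr ler_pM2l.
split=> [g g' hg hg'|t g t0 hg].
  rewrite -lerBlDr; apply: le_gauge => // es xs js [h1 h2].
  rewrite lerBlDr -lerBlDl; apply: le_gauge => // es' xs' js' [h1' h2'].
  rewrite lerBlDl.
  have -> : cost es xs js + cost es' xs' js' = cost (es ++ es') (xs ++ xs') (js ++ js').
    rewrite /cost !nrm2s_cat pairing_cat; ring.
  apply: gauge_le; first exact: dominatedD.
  split=> i z; rewrite !big_cat /=.
    rewrite -[(g + g') _ z]/(g (i, true) z + g' (i, true) z) raddfD/=.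
    by rewrite addrACA; exact: lerD.
  rewrite -[(g + g') _ z]/(g (i, false) z + g' (i, false) z) raddfD/=.
  by rewrite addrACA; exact: lerD.
apply/eqP; rewrite eq_le le//=.
have ti : 0 < t^-1 by rewrite invr_gt0.
have := le t^-1 (t%:C *: g) ti (dominatedZ _ hg).
by rewrite scalerrA mulVf ?gt_eqF// scale1rr ler_pdivlMl.
Qed.

Definition bracket i (b : bool) (x y : V) : W :=
  fun p z => if p == (i, b) then s z y * conjc (s z x) else 0.

Lemma bracket_dominated i b x y : dominated (bracket i b x y).
Proof.
exists [:: x; y] => p z; rewrite /bracket; case: ifP => _; last first.
  by rewrite Normc.normc0; exact: dom_ge0.
rewrite Normc.normcM normc_conj 2!big_cons big_nil addr0 /brk.
set u := nc _; set v := nc _.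
have := sqr_ge0 (u - v); have := sqr_ge0 u; have := sqr_ge0 v; nra.
Qed.

(** The functional gives values [p_i] and [q_i] on the brackets marked [true] and [false], with
    [sum_i p_i (x) <= c0 |x|^2], [sum_i q_i (x) <= c0 |x|^2] and [p_i (a_i x) + q_i (x) >= 2 |x|^2].
    Summing the last inequality over [i] and eliminating the [q_i] gives the second estimate. *)
Lemma dominating_forms : exists p : 'I_k -> semi_inner V,
  (forall x, \sum_i nrm (p i) x ^+ 2 <= c0 * nrm s x ^+ 2) /\
  (forall x, 2 * (k%:R - c0) * nrm s x ^+ 2 <=
     \sum_i (nrm (p i) (a i x) ^+ 2 - nrm (p i) x ^+ 2)).
Proof.
have [||L [LS LD LZ]] := @hahn_banach R _ [set g : W | dominated g] _ _ gauge gauge_sublinear.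
- by move=> g g'; exact: dominatedD.
- by move=> t g; exact: dominatedZ.
have domN g : dominated g -> dominated (- g).
  by move=> hg; rewrite -scaleN1r; exact: dominatedZ.
have LN g : dominated g -> L (- g) = - L g.
  by move=> hg; have := LZ (-1) g hg; rewrite rmorphN1 scaleN1r mulN1r.
have L0 g : dominated g -> (forall p z, re (g p z) <= 0) -> L g <= 0.
  move=> hg h; apply: le_trans (LS _ hg) _.
  have <- : cost [::] [::] [::] = 0.
    by rewrite /cost /nrm2s /pairing !big_nil addr0 mulr0 subr0.
  by apply: gauge_le => //; split=> i z; rewrite !big_nil addr0.
(* Admissibility sees only real parts, hence so does [L]; the conjugate symmetry of the forms rests
   on this. *)
have Lre g g' : dominated g -> dominated g' -> (forall p z, re (g p z) = re (g' p z)) ->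
    L g = L g'.
  have le h h' : dominated h -> dominated h' -> (forall p z, re (h p z) = re (h' p z)) ->
      L h <= L h'.
    move=> dh dh' e; rewrite -subr_le0 -LN// -LD//; last exact: domN.
    apply: L0; first by apply: dominatedD => //; exact: domN.
    move=> p z; rewrite -[(h - h') p z]/(h p z - h' p z) raddfB /=.
    by rewrite e subrr.
  by move=> dg dg' e; apply/eqP; rewrite eq_le !le.
pose F g : C := L g +i* - L ('i *: g).
have FD g g' : dominated g -> dominated g' -> F (g + g') = F g + F g'.
  by move=> dg dg'; rewrite /F scalerDr !LD ?opprD//; exact: dominatedZ.
have FZ c g : dominated g -> F (c *: g) = c * F g.
  case: c => u v dg; rewrite /F.
  have e : (u +i* v) *: g = u%:C *: g + v%:C *: ('i *: g).
    rewrite scalerA -scalerDl; congr (_ *: _).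
    by apply/eqP; rewrite eq_complex /=; apply/andP; split; apply/eqP; ring.
  have e' : 'i *: ((u +i* v) *: g) = u%:C *: ('i *: g) + (- v)%:C *: g.
    rewrite !scalerA -scalerDl; congr (_ *: _).
    by apply/eqP; rewrite eq_complex /=; apply/andP; split; apply/eqP; ring.
  have dig : dominated ('i *: g) by exact: dominatedZ.
  rewrite e' e !LD ?LZ//; try exact: dominatedZ.
  by apply/eqP; rewrite eq_complex /=; apply/andP; split; apply/eqP; ring.
have brD i b x y z : bracket i b x (y + z) = bracket i b x y + bracket i b x z.
  apply/funext => p; apply/funext => w.
  rewrite -[RHS]/(bracket i b x y p w + bracket i b x z p w) /bracket.
  by case: ifP => _; [rewrite ipDr mulrDl|rewrite addr0].
have brZ i b x c y : bracket i b x (c *: y) = c *: bracket i b x y.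
  apply/funext => p; apply/funext => w.
  rewrite -[RHS]/(c * bracket i b x y p w) /bracket.
  by case: ifP => _; [rewrite ipZr mulrA|rewrite mulr0].
have brC i b x y p w : bracket i b y x p w = conjc (bracket i b x y p w).
  rewrite /bracket; case: ifP => _; last by rewrite conjc0.
  by rewrite rmorphM/= conjcK mulrC.
have bd := bracket_dominated.
pose P b i x y := F (bracket i b x y).
have PD b i x y z : P b i x (y + z) = P b i x y + P b i x z by rewrite /P brD FD.
have PZ b i c x y : P b i x (c *: y) = c * P b i x y by rewrite /P brZ FZ.
have PC b i x y : P b i y x = conjc (P b i x y).
  rewrite /P /F; apply/eqP; rewrite eq_complex /=; apply/andP; split; apply/eqP.
    by apply: Lre => // p z; rewrite brC; case: (bracket _ _ _ _ _ _).
  congr (- _); rewrite -LN; last exact: dominatedZ.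
  apply: Lre; [exact: dominatedZ|exact/domN/dominatedZ|] => p z.
  rewrite -[(- _) p z]/(- ('i * bracket i b x y p z)).
  rewrite -[('i *: _) p z]/('i * bracket i b y x p z) brC.
  by case: (bracket _ _ _ _ _ _) => u v /=; ring.
have brxx i b x p z : bracket i b x x p z = if p == (i, b) then (brk x z)%:C else 0.
  by rewrite /bracket; case: ifP => // _; rewrite mulc_conj.
have PE b i x : P b i x x = (L (bracket i b x x))%:C.
  rewrite /P /F; apply/eqP; rewrite eq_complex /= eqxx /= oppr_eq0.
  have -> : L ('i *: bracket i b x x) = L (0%:C *: bracket i b x x).
    apply: Lre; try exact: dominatedZ.
    move=> p z; rewrite -[('i *: _) p z]/('i * bracket i b x x p z).
    rewrite -[(0%:C *: _) p z]/(0%:C * bracket i b x x p z) brxx.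
    by case: ifP => _ /=; ring.
  by rewrite LZ ?mul0r//; exact: bd.
have Lxx b i x : 0 <= L (bracket i b x x).
  rewrite -oppr_le0 -LN//; apply: L0; first exact: domN.
  move=> p z; rewrite -[(- _) p z]/(- bracket i b x x p z) brxx.
  by case: ifP => _ /=; rewrite ?oppr0// oppr_le0 brk_ge0.
have P0 b i x : 0 <= P b i x x by rewrite PE ler0c.
pose pf i := SemiInner (PD true i) (PZ true i) (PC true i) (P0 true i).
have nP i x : nrm (pf i) x ^+ 2 = L (bracket i true x x).
  by rewrite sqr_nrm -[pf i x x]/(P true i x x) PE.
have dom0 : dominated 0 by exists [::] => p z; rewrite big_nil Normc.normc0.
have dsum b x : dominated (\sum_i bracket i b x x) /\
    L (\sum_i bracket i b x x) = \sum_i L (bracket i b x x).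
  apply: (big_rec2 (fun u v => dominated v /\ L v = u)) => [|i u v _ [dv <-]].
    by split=> //; have := LZ 0 0 dom0; rewrite scaler0 mul0r.
  by split; [apply: dominatedD => //; exact: bd|rewrite LD//; exact: bd].
have bsum b x p z : (\sum_i bracket i b x x) p z = if p.2 == b then (brk x z)%:C else 0.
  have -> : (\sum_i bracket i b x x) p z = \sum_i bracket i b x x p z.
    by apply: (big_morph (fun g : W => g p z)).
  rewrite (bigD1 p.1)//= brxx big1 ?addr0.
    by case: p => j c /=; rewrite xpair_eqE eqxx.
  move=> i ip; rewrite brxx; case: p ip => j c /= ij.
  by rewrite xpair_eqE eq_sym (negbTE ij).
(* A single vector dominates the brackets for all [i] at once, which is why the bound has no factor
   [k]. *)
have bound b x : \sum_i L (bracket i b x x) <= c0 * nrm s x ^+ 2.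
  rewrite -(dsum b x).2; apply: le_trans (LS _ (dsum b x).1) _.
  pose es := if b then [:: x] else [::]; pose xs := if b then [::] else [:: x].
  have <- : cost es xs [::] = c0 * nrm s x ^+ 2.
    rewrite /cost /pairing big_nil subr0 /nrm2s /es /xs.
    by case: b {es xs}; rewrite big_seq1 big_nil ?addr0 ?add0r.
  apply: gauge_le; first exact: (dsum b x).1.
  by split=> i z; rewrite bsum big_nil addr0 /es /xs; case: b {es xs};
    rewrite /= ?big_seq1 ?big_nil.
(* The pair [j], equal to [(a i x, x)] at [i] and 0 elsewhere, exactly offsets [- g1 - g2], and its
   pairing is [2 |a_i x|^2 = 2 |x|^2]. *)
have low i x : 2 * nrm s x ^+ 2 <= L (bracket i true (a i x) (a i x)) + L (bracket i false x x).
  set g1 := bracket i true _ _; set g2 := bracket i false _ _.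
  pose j : ('I_k -> V) * ('I_k -> V) :=
    (fun i' => if i' == i then a i x else 0, fun i' => if i' == i then x else 0).
  have cj : cost [::] [::] [:: j] = - (2 * nrm s x ^+ 2).
    rewrite /cost /nrm2s /pairing !big_nil addr0 mulr0 sub0r big_seq1; congr (- _).
    rewrite (bigD1 i)//= eqxx ip_nrm a_nrm big1 ?addr0// => i' ii.
    by rewrite (negbTE ii) ipC ip0r conjc0 mulr0.
  have dg : dominated (- g1 - g2) by apply: dominatedD; apply: domN; exact: bd.
  have : L (- g1 - g2) <= - (2 * nrm s x ^+ 2).
    rewrite -cj; apply: le_trans (LS _ dg) _; apply: gauge_le => //.
    split=> i' z; rewrite big_nil big_seq1.
      rewrite -[(- g1 - g2) _ z]/(- g1 (i', true) z - g2 (i', true) z) /g1 /g2 !brxx.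
      rewrite !xpair_eqE /= andbF andbT; case: ifP => _.
        by rewrite subr0 /= addNr.
      by rewrite !oppr0 addr0 /= add0r /brk ip0r Normc.normc0 expr0n.
    rewrite -[(- g1 - g2) _ z]/(- g1 (i', false) z - g2 (i', false) z) /g1 /g2 !brxx.
    rewrite !xpair_eqE /= andbF andbT; case: ifP => _.
      by rewrite oppr0 add0r /= addNr.
    by rewrite !oppr0 addr0 /= add0r /brk ip0r Normc.normc0 expr0n.
  have d1 : dominated g1 by exact: bd.
  have d2 : dominated g2 by exact: bd.
  rewrite LD ?LN//; [lra|exact: domN|exact: domN].
exists pf; split; first by move=> x; under eq_bigr do rewrite nP; exact: bound.
move=> x; have h1 := bound true x; have h2 := bound false x.
have : \sum_(i < k) 2 * nrm s x ^+ 2 <= \sum_(i < k) (L (bracket i true (a i x) (a i x)) + L (bracket i false x x)).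
  by apply: ler_sum => i _; exact: low.
rewrite sumr_const card_ord -mulr_natl.
under [in X in _ -> X]eq_bigr do rewrite !nP.
rewrite !big_split sumrN /=; lra.
Qed.

End Dominating.

(** * Contractions close to solving the commutator equation *)

Section Witness.
Variables (R : realType) (A : cstarAlg R).
Notation C := R[i].
Notation nc := (@Normc.normc R).
Notation B := (form_alg (gns_fam A)).

Lemma mul_rep (u : B) (a : A) i x y : (u * rep a : B) i x y = u i x (a * y).
Proof. exact: fmul_exact. Qed.

Lemma star_rep_mul (u : B) (a : A) i x y : (star (rep a) * u : B) i x y = u i (a * x) y.
Proof.
rewrite -(starK (star (rep a) * u)) starM starK.
by rewrite -[LHS]/(conjc ((star u * rep a : B) i y x)) mul_rep /= conjcK.
Qed.

Lemma form_sum k (F : 'I_k -> B) i x y : (\sum_j F j : B) i x y = \sum_j F j i x y.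
Proof. by apply: (big_morph (fun g : B => g i x y)). Qed.

(** In each GNS space [y_j] is [p_j / (k c0)]. The element [z = 1 - sum_j (a_j^* y_j a_j - y_j)] is
    positive because each [p_j (a_j x)] is at most [c0 |x|^2], and [dominating_forms] bounds it by
    [1 - 2 (k - c0) / (k c0) < 1]. Both bounds are uniform over the states, so they hold in the
    algebra of bounded families. *)
Lemma witness_in_extension k (a : 'I_k -> A) (c0 : R) :
  (forall j, star (a j) * a j = 1) -> 0 < c0 -> c0 < k%:R ->
  (forall f : state A, cb_bound (gns (svalP f)) (fun j x => a j * x) c0) ->
  exists y : 'I_k -> B, (forall j, cnorm (y j) <= 1) /\
    cnorm (1 - \sum_j (star (rep (a j)) * y j * rep (a j) - y j)) < 1.
Proof.
move=> ua c0p c0k cb.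
have k0 : 0 < k%:R :> R by exact: lt_trans c0k.
have kc : 0 < k%:R * c0 by exact: mulr_gt0.
have anrm (f : state A) j x : nrm (gns (svalP f)) (a j * x) = nrm (gns (svalP f)) x.
  by rewrite /nrm !gnsE starM -mulrA (mulrA _ (a j)) ua mul1r.
have aD j x y : a j * (x + y) = a j * x + a j * y by rewrite mulrDr.
have aZ j c x : a j * (c *: x) = c *: (a j * x) by rewrite scalerAr.
have /choice[P PP] : forall f : state A, exists p : 'I_k -> semi_inner A,
  (forall x, \sum_j nrm (p j) x ^+ 2 <= c0 * nrm (gns (svalP f)) x ^+ 2) /\
  (forall x, 2 * (k%:R - c0) * nrm (gns (svalP f)) x ^+ 2 <=
     \sum_j (nrm (p j) (a j * x) ^+ 2 - nrm (p j) x ^+ 2)).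
  by move=> f; exact: (@dominating_forms R A _ _ (fun j x => a j * x) c0).
pose r : R := (k%:R * c0)^-1; have r0 : 0 < r by rewrite invr_gt0.
have Pj f j x : nrm (P f j) x ^+ 2 <= c0 * nrm (gns (svalP f)) x ^+ 2.
  apply: le_trans ((PP f).1 x); rewrite (bigD1 j)//= lerDl.
  by apply: sumr_ge0 => j' _; exact: sqr_ge0.
have Pb f j x y : nc (P f j x y) <= c0 * nrm (gns (svalP f)) x * nrm (gns (svalP f)) y.
  apply: le_trans (cauchy_schwarz _ _ _) _.
  have h u : nrm (P f j) u <= Num.sqrt c0 * nrm (gns (svalP f)) u.
    rewrite -ler_sqr ?nnegrE ?mulr_ge0 ?nrm_ge0 ?sqrtr_ge0// exprMn.
    by rewrite (sqr_sqrtr (ltW c0p)).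
  apply: le_trans (ler_pM (nrm_ge0 _ _) (nrm_ge0 _ _) (h x) (h y)) _.
  by rewrite mulrACA -expr2 (sqr_sqrtr (ltW c0p)) mulrA.
have yb j : (fun f x y => r%:C * P f j x y) \in bform_pred (gns_fam A).
  apply/asboolP; split.
    by move=> f; split=> *; rewrite ?ipDr ?ipZr ?ipDl ?ipZl; ring.
  exists (r * c0); first by rewrite mulr_ge0// ltW.
  move=> f x y; rewrite Normc.normcM normc_real gtr0_norm// -!mulrA.
  by rewrite ler_pM2l// mulrA; exact: Pb.
pose y j : B := BForm (yb j).
have ynorm j : cnorm (y j) <= 1.
  apply: (@le_trans _ _ (r * c0)); last first.
    rewrite /r invfM mulfVK ?gt_eqF// invf_le1// ler1n.
    by rewrite -(ltr0n R).
  apply: fnorm_le; first by rewrite mulr_ge0// ltW.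
  move=> f x z; rewrite Normc.normcM normc_real gtr0_norm// -!mulrA.
  by rewrite ler_pM2l// mulrA; exact: Pb.
exists y; split=> //; set z := 1 - _.
(* The maximum with 0 provides the square root used in the Cauchy-Schwarz estimate for the form
   [z]. *)
pose kap := Num.max 0 (1 - 2 * (k%:R - c0) * r).
have kap1 : kap < 1.
  rewrite gt_max ltr01/=; have : 0 < 2 * (k%:R - c0) * r.
    by rewrite mulr_gt0// mulr_gt0//; lra.
  lra.
apply: le_lt_trans kap1; have kap0 : 0 <= kap by rewrite le_max lexx.
apply: fnorm_le => // f u v.
have zE x x' : z f x x' = gns (svalP f) x x' -
    \sum_j (r%:C * P f j (a j * x) (a j * x') - r%:C * P f j x x').
  rewrite -[z f x x']/((1 : B) f x x' - (\sum_j (star (rep (a j)) * y j * rep (a j) - y j) : B) f x x').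
  rewrite form_sum; congr (_ - _); apply: eq_bigr => j _.
  by rewrite bformB -mulrA star_rep_mul mul_rep.
have zS := bform_sesq z f; have [z1 z2 z3 z4] := zS.
have zC x x' : z f x' x = conjc (z f x x').
  have conjB (c d : C) : conjc (c - d) = conjc c - conjc d by exact: rmorphB.
  have conjM (c d : C) : conjc (c * d) = conjc c * conjc d by exact: rmorphM.
  have conjS (F : 'I_k -> C) : conjc (\sum_j F j) = \sum_j conjc (F j).
    by exact: raddf_sum.
  rewrite !zE conjB -ipC conjS; congr (_ - _); apply: eq_bigr => j _.
  by rewrite conjB !conjM -!ipC conjc_real.
have zz x : z f x x = (nrm (gns (svalP f)) x ^+ 2 -
    r * \sum_j (nrm (P f j) (a j * x) ^+ 2 - nrm (P f j) x ^+ 2))%:C.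
  rewrite zE ip_nrm rmorphB mulr_sumr; congr (_ - _).
  rewrite raddf_sum; apply: eq_bigr => j _.
  by rewrite !ip_nrm -!rmorphM -rmorphB mulrBr.
have zpos x : 0 <= z f x x.
  rewrite zz ler0c subr_ge0 /r mulrC ler_pdivrMr//.
  have -> : nrm (gns (svalP f)) x ^+ 2 * (k%:R * c0) = \sum_(j < k) c0 * nrm (gns (svalP f)) x ^+ 2.
    by rewrite sumr_const card_ord -mulr_natl; ring.
  apply: ler_sum => j _; have := Pj f j (a j * x); rewrite anrm.
  by have := sqr_ge0 (nrm (P f j) x); lra.
pose s := SemiInner z1 z2 zC zpos.
have sn x : nrm s x ^+ 2 <= kap * nrm (gns (svalP f)) x ^+ 2.
  rewrite sqr_nrm -[s x x]/(z f x x) zz /=.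
  have h : 1 - 2 * (k%:R - c0) * r <= kap by rewrite le_max lexx orbT.
  have h2 := ler_wpM2r (sqr_ge0 (nrm (gns (svalP f)) x)) h.
  have h3 := ler_wpM2l (ltW r0) ((PP f).2 x); lra.
have h u' : nrm s u' <= Num.sqrt kap * nrm (gns (svalP f)) u'.
  rewrite -ler_sqr ?nnegrE ?mulr_ge0 ?nrm_ge0 ?sqrtr_ge0// exprMn.
  by rewrite (sqr_sqrtr kap0).
apply: le_trans (cauchy_schwarz s u v) _.
apply: le_trans (ler_pM (nrm_ge0 _ _) (nrm_ge0 _ _) (h u) (h v)) _.
by rewrite mulrACA -expr2 (sqr_sqrtr kap0) mulrA.
Qed.

End Witness.

(** * Los's theorem *)

Section UltraSup.
Variables (R : realType) (U : set_system nat).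
Hypothesis UU : UltraFilter U.

(** Near-maximizers of the [E m] converge into [F], and a near-maximizer of [F] lifts to the [E m];
    each selection hypothesis gives one inequality. *)
Lemma sup_cvg (E : nat -> set R) (F : set R) :
  (forall m, has_sup (E m)) -> has_sup F ->
  (forall z, (forall m, E m (z m)) -> exists2 l, F l & z @ U --> l) ->
  (forall l, F l -> exists2 z, (forall m, E m (z m)) & z @ U --> l) ->
  (fun m => sup (E m)) @ U --> sup F.
Proof.
move=> hE hF up down; apply/cvgrPdist_lt => eps eps0.
have eps2 : 0 < eps / 2 by rewrite divr_gt0.
have [l Fl lF] := sup_adherent eps2 hF.
have [z zE /cvgrPdist_lt/(_ _ eps2) zl] := down _ Fl.
have /choice[w wP] : forall m, exists x, E m x /\ sup (E m) - eps / 2 < x.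
  by move=> m; have [x] := sup_adherent eps2 (hE m); exists x.
have [l' Fl' /cvgrPdist_lt/(_ _ eps2) wl'] : exists2 l', F l' & w @ U --> l'.
  by apply: up => m; have [] := wP m.
near=> m.
have h1 : z m <= sup (E m) by apply: ub_le_sup; [case: (hE m)|exact: zE].
have h2 : l' <= sup F by apply: ub_le_sup => //; case: hF.
have [_ h3] := wP m.
have h4 : `|l - z m| < eps / 2 by near: m.
have h5 : `|l' - w m| < eps / 2 by near: m.
move: h4 h5; rewrite !ltr_norml => /andP[h4 h4'] /andP[h5 h5'].
by apply/andP; split; lra.
Unshelve. all: by end_near.
Qed.

Lemma inf_cvg (E : nat -> set R) (F : set R) :
  (forall m, has_inf (E m)) -> has_inf F ->
  (forall z, (forall m, E m (z m)) -> exists2 l, F l & z @ U --> l) ->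
  (forall l, F l -> exists2 z, (forall m, E m (z m)) & z @ U --> l) ->
  (fun m => inf (E m)) @ U --> inf F.
Proof.
move=> hE hF up down; apply: cvgN; apply: sup_cvg.
- by move=> m; apply/has_inf_supN.
- exact/has_inf_supN.
- move=> z zE; have /choice[w wP] : forall m, exists x, E m x /\ - x = z m.
    by move=> m; have [x] := zE m; exists x.
  have [|l Fl wl] := up w; first by move=> m; case: (wP m).
  exists (- l); first by exists l.
  rewrite (_ : z = fun m => - w m); first exact: cvgN.
  by apply/funext => m; have [] := wP m.
- move=> _ [l Fl <-]; have [z zE zl] := down _ Fl.
  exists (fun m => - z m); [by move=> m; exists (z m)|exact: cvgN].
Qed.

End UltraSup.

Section Los.
Variable R : realType.

Lemma norm_sup_le (E : set R) (K : R) :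
  E !=set0 -> (forall x, E x -> `|x| <= K) -> `|sup E| <= K.
Proof.
move=> E0 h; have hub : ubound E K by move=> x /h; rewrite ler_norml => /andP[].
rewrite ler_norml; apply/andP; split; last exact: ge_sup.
have [x Ex] := E0; have := h x Ex; rewrite ler_norml => /andP[h1 _].
by apply: le_trans h1 _; apply: ub_le_sup => //; exists K.
Qed.

Lemma norm_inf_le (E : set R) (K : R) :
  E !=set0 -> (forall x, E x -> `|x| <= K) -> `|inf E| <= K.
Proof.
move=> E0 h; rewrite normrN; apply: norm_sup_le => [|_ [x /h hx <-]]; last by rewrite normrN.
by have [x Ex] := E0; exists (- x), x.
Qed.

Lemma ball_image0 (B : cstarAlg R) T (f : B -> T) m : [set f x | x in cball B m] !=set0.
Proof. by exists (f 0), 0 => //; rewrite /cball /= cnorm0 ler0n. Qed.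

Lemma tnth_cons_le (B : cstarAlg R) n (e : n.-tuple B) (r : R) m x :
  (forall i, cnorm (tnth e i) <= r) -> cball B m x ->
  forall i, cnorm (tnth [tuple of x :: e] i) <= Num.max r m%:R.
Proof.
move=> he hx i; rewrite le_max; apply/orP.
by case: (unliftP ord0 i) => [j|] ->; [left; rewrite tnthS|right; rewrite tnth0].
Qed.

Lemma speval_bounded n (t : starpoly R n) (r : R) : exists K : R,
  forall (B : cstarAlg R) (e : n.-tuple B), (forall i, cnorm (tnth e i) <= r) ->
  cnorm (speval t e) <= K.
Proof.
elim: t => [i|c|t1 [K1 h1] t2 [K2 h2]|t1 [K1 h1] t2 [K2 h2]|t [K h]].
- by exists r => B e he; exact: he.
- by exists (Normc.normc c) => B e _ /=; rewrite cnormZ cnorm1 mulr1.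
- exists (K1 + K2) => B e he /=; apply: le_trans (cnormD _ _) _.
  by apply: lerD; [exact: h1|exact: h2].
- exists (K1 * K2) => B e he /=; apply: le_trans (cnormM _ _) _.
  by apply: ler_pM; rewrite ?cnorm_ge0 ?h1 ?h2.
- by exists K => B e he /=; rewrite cnorm_star_eq h.
Qed.

(** The constant depends only on the formula and the radius, which carries the induction through
    quantifiers; connectives are bounded on the compact box of possible arguments. It makes the
    suprema and infima in [feval] genuine rather than default values. *)
Lemma feval_bounded n (phi : formula R n) (r : R) : exists K : R,
  forall (B : cstarAlg R) (e : n.-tuple B), (forall i, cnorm (tnth e i) <= r) ->
  `|feval phi e| <= K.
Proof.
elim: phi r => {n} [n t|n k h hc args ih|n m psi ih|n m psi ih] r.
- have [K hK] := speval_bounded t r.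
  by exists K => B e he; rewrite /= ger0_norm ?cnorm_ge0 ?hK.
- have [K hK] := choice (fun i => ih i r).
  pose S : set 'rV[R]_k := [set v | forall i, [set` `[- K i, K i]] (v 0 i)].
  have cS : compact S := rV_compact (fun i : 'I_k => @segment_compact R (- K i) (K i)).
  have /compact_bounded[M [_ hM]] :=
    continuous_compact (continuous_subspaceT (hc : continuous h)) cS.
  exists (M + 1) => B e he; apply: (hM (M + 1)); first by rewrite ltrDl.
  exists (\row_i feval (args i) e) => // i /=; rewrite mxE in_itv /= -ler_norml.
  exact: hK.
- have [K hK] := ih (Num.max r m%:R); exists K => B e he /=.
  by apply: norm_sup_le => [|_ [x hx <-]]; [exact: ball_image0|apply: hK; exact: tnth_cons_le].
- have [K hK] := ih (Num.max r m%:R); exists K => B e he /=.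
  by apply: norm_inf_le => [|_ [x hx <-]]; [exact: ball_image0|apply: hK; exact: tnth_cons_le].
Qed.

Lemma tuple_bounded (B : cstarAlg R) n (e : n.-tuple B) :
  exists r : R, forall i, cnorm (tnth e i) <= r.
Proof.
exists (\sum_i cnorm (tnth e i)) => i; rewrite (bigD1 i) //= lerDl.
by apply: sumr_ge0 => j _; exact: cnorm_ge0.
Qed.

Lemma ball_values_bounded (B : cstarAlg R) n (psi : formula R n.+1) m (e : n.-tuple B) :
  has_sup [set feval psi [tuple of x :: e] | x in cball B m] /\
  has_inf [set feval psi [tuple of x :: e] | x in cball B m].
Proof.
have [r hr] := tuple_bounded e; have [K hK] := feval_bounded psi (Num.max r m%:R).
have h x : cball B m x -> `|feval psi [tuple of x :: e]| <= K.
  by move=> hx; apply: hK; exact: tnth_cons_le.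
split; split; try exact: ball_image0.
  by exists K => _ [x /h hx <-]; move: hx; rewrite ler_norml => /andP[].
by exists (- K) => _ [x /h hx <-]; move: hx; rewrite ler_norml => /andP[].
Qed.

Section Transfer.
Variables (A : cstarAlg R) (U : set_system nat) (UU : UltraFilter U).
Notation P := (ultrapower A UU).

Definition at_index m n (e : n.-tuple (linf A)) : n.-tuple A :=
  map_tuple (fun x : linf A => linf_val x m) e.
Definition in_power n (e : n.-tuple (linf A)) : n.-tuple P :=
  map_tuple (@upi R A U UU : linf A -> P) e.

Lemma at_index_cons m n x (e : n.-tuple (linf A)) :
  at_index m [tuple of x :: e] = [tuple of linf_val x m :: at_index m e].
Proof. exact: val_inj. Qed.

Lemma in_power_cons n x (e : n.-tuple (linf A)) :
  in_power [tuple of x :: e] = [tuple of (upi UU x : P) :: in_power e].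
Proof. exact: val_inj. Qed.

Lemma speval_upi n (t : starpoly R n) (e : n.-tuple (linf A)) : exists2 x : linf A,
  speval t (in_power e) = upi UU x & forall m, x m = speval t (at_index m e).
Proof.
elim: t => [i|c|t1 [x1 u1 h1] t2 [x2 u2 h2]|t1 [x1 u1 h1] t2 [x2 u2 h2]|t [x u h]].
- by exists (tnth e i) => [|m] /=; rewrite tnth_map.
- by exists (c *: 1) => [|m] //=; rewrite upiZ.
- by exists (x1 + x2) => [|m] /=; rewrite ?upiD ?u1 ?u2 // -h1 -h2.
- by exists (x1 * x2) => [|m] /=; rewrite ?upiM ?u1 ?u2 // -h1 -h2.
- by exists (lstar x) => [|m] /=; rewrite ?u -?h // [LHS]upi_star.
Qed.

Lemma linf_of_ball r (x : nat -> A) : (forall m, cball A r (x m)) ->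
  exists2 y : linf A, (forall m, y m = x m) & cball P r (upi UU y).
Proof.
move=> hx; have xb : x \in bounded_seq (A := A) by apply/asboolP; exists r%:R.
by exists (Linf xb) => //; apply: unorm_le; apply: (@filterE _ U).
Qed.

(** A representing sequence may leave the ball, since only the limit of its norms is at most [r].
    Rescaling each entry back into the ball changes the sequence by a null sequence. *)
Lemma ball_of_ultra r (q : P) : cball P r q ->
  exists2 x : linf A, q = upi UU x & forall m, cball A r (x m).
Proof.
have [y ->] : exists y : linf A, q = upi UU y.
  by exists (urepr (q : ultra A UU)); rewrite ureprK.
rewrite /cball /= => hq {q}.
(* If [y m] has norm 0, the quotient is 0 by convention; the rescaled entry is 0 in any case. *)
pose c m : R := Num.min 1 (r%:R / cnorm (y m)).
have c0 m : 0 <= c m by rewrite le_min ler01 divr_ge0 ?cnorm_ge0.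
have hx m : cnorm ((c m)%:C *: y m) <= r%:R.
  rewrite cnormZ normc_real ger0_norm //.
  have [->|y0] := eqVneq (cnorm (y m)) 0; first by rewrite mulr0.
  have yp : 0 < cnorm (y m) by rewrite lt_neqAle eq_sym y0 cnorm_ge0.
  by rewrite -ler_pdivlMr // ge_min lexx orbT.
have xb : (fun m => (c m)%:C *: y m) \in bounded_seq (A := A).
  by apply/asboolP; exists r%:R.
exists (Linf xb) => //; apply/upi_eq/null_seqP.
have yl : (fun n => cnorm (y n)) @ U --> unorm (upi UU y) by exact: unorm_cvg.
have yr : (fun n => Num.max (cnorm (y n) - r%:R) 0) @ U --> (0 : R).
  apply/cvgrPdist_lt => eps eps0; have h : unorm (upi UU y) < r%:R + eps by lra.
  apply: filterS (cvgr_lt _ yl _ h) => m hm; rewrite sub0r normrN.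
  by rewrite ger0_norm ?le_max ?lexx ?orbT // gt_max eps0 andbT ltrBlDl.
apply: (squeeze0 UU _ yr) => m; rewrite cnorm_ge0 andTb.
have -> : (y - Linf xb) m = (1 - c m)%:C *: y m.
  by rewrite scalerBlr scale1rr.
rewrite cnormZ normc_real ger0_norm; last by rewrite subr_ge0 ge_min lexx.
rewrite /c; case: (leP 1 (r%:R / cnorm (y m))) => h.
  by rewrite subrr mul0r le_max lexx orbT.
have [e|y0] := eqVneq (cnorm (y m)) 0; first by rewrite e mulr0 le_max lexx orbT.
by rewrite mulrBl mul1r divfK // le_max lexx.
Qed.

Section Quantifier.
Variables (n : nat) (psi : formula R n.+1) (r : nat) (e : n.-tuple (linf A)).
Hypothesis ih : forall e' : n.+1.-tuple (linf A),
  (fun m => feval psi (at_index m e')) @ U --> feval psi (in_power e').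
Let E m := [set feval psi [tuple of x :: at_index m e] | x in cball A r].
Let F := [set feval psi [tuple of x :: in_power e] | x in cball P r].

Let cvg_cons (x : linf A) :
  (fun m => feval psi [tuple of x m :: at_index m e]) @ U -->
  feval psi [tuple of (upi UU x : P) :: in_power e].
Proof.
have h := @ih [tuple of x :: e]; rewrite in_power_cons in h.
by rewrite (_ : (fun m => _) = fun m => feval psi (at_index m [tuple of x :: e])) //;
  apply/funext => m; rewrite at_index_cons.
Qed.

Lemma ball_selection_cvg z : (forall m, E m (z m)) -> exists2 l, F l & z @ U --> l.
Proof.
move=> zE; have /choice[w wP] : forall m, exists x, cball A r x /\
    feval psi [tuple of x :: at_index m e] = z m.
  by move=> m; have [x] := zE m; exists x.
have [x xw xP] := linf_of_ball (fun m => (wP m).1).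
exists (feval psi [tuple of (upi UU x : P) :: in_power e]); first by exists (upi UU x).
rewrite (_ : z = fun m => feval psi [tuple of x m :: at_index m e]); first exact: cvg_cons.
by apply/funext => m; rewrite xw (wP m).2.
Qed.

Lemma ball_selection_lift l : F l -> exists2 z, (forall m, E m (z m)) & z @ U --> l.
Proof.
move=> [q hq <-]; have [x -> hx] := ball_of_ultra hq.
exists (fun m => feval psi [tuple of x m :: at_index m e]); last exact: cvg_cons.
by move=> m; exists (x m).
Qed.

End Quantifier.

(** The quantifier cases work because a closed ball of the ultrapower consists exactly of the
    classes of sequences from the same closed ball of [A]. *)
Theorem los n (phi : formula R n) (e : n.-tuple (linf A)) :
  (fun m => feval phi (at_index m e)) @ U --> feval phi (in_power e).
Proof.
elim: phi e => {n} [n t|n k h hc args ih|n r psi ih|n r psi ih] e /=.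
- have [x -> hx] := speval_upi t e.
  rewrite (_ : (fun m => _) = fun m => cnorm (x m)); first exact: unorm_cvg.
  by apply/funext => m; rewrite hx.
- apply: (@continuous_cvg _ _ _ _ _ (fun m => \row_i feval (args i) (at_index m e)) h).
    exact: hc.
  apply/cvg_mx_entourageP => E /=; rewrite -entourage_ballE => -[eps eps0 hE].
  suff: \forall m \near U, forall j : 'I_k,
      `|feval (args j) (in_power e) - feval (args j) (at_index m e)| < eps.
    by apply: filterS => m hm i j; rewrite inE !mxE; apply: hE; exact: hm.
  by apply: filter_forall => j; move/cvgrPdist_lt: (ih j e); exact.
- apply: sup_cvg.
  + by move=> m; have [] := ball_values_bounded psi r (at_index m e).
  + by have [] := ball_values_bounded psi r (in_power e).
  + exact: ball_selection_cvg.
  + exact: ball_selection_lift.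
- apply: inf_cvg.
  + by move=> m; have [] := ball_values_bounded psi r (at_index m e).
  + by have [] := ball_values_bounded psi r (in_power e).
  + exact: ball_selection_cvg.
  + exact: ball_selection_lift.
Qed.

Lemma models_ultrapower (T : theory R) : models T A -> models T P.
Proof.
move=> hT s /hT hs; have := @los 0 s [tuple].
rewrite (_ : (fun m => _) = cst 0); last first.
  by apply/funext => m; rewrite /= -hs; congr feval; exact: tuple0.
move=> h; have {}h := cvg_unique (@Rhausdorff R) h (cvg_cst (0 : R)).
by rewrite -[RHS]h; congr feval; rewrite [RHS]tuple0.
Qed.

End Transfer.
End Los.

(** * Matrices in algebras with a Cuntz pair *)

Section Codes.
Variables (R : realType) (M : cstarAlg R).
Notation C := R[i].
Notation nc := (@Normc.normc R).

(** The Cuntz relations for [r] isometries; the [E i * star (E j)] are then matrix units of a unital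
    copy of the [r] by [r] matrices. *)
Definition code r (E : 'I_r -> M) : Prop :=
  (forall i j, star (E i) * E j = (i == j)%:R) /\ \sum_i E i * star (E i) = 1.

(** A code [E] is lengthened by one to [v1], followed by the [v2 * E i]; the words form a comb. *)
Lemma comb_code (v1 v2 : M) r : cuntz_pair v1 v2 -> exists E : 'I_r.+1 -> M, code E.
Proof.
move=> [h1 h2 h12]; elim: r => [|r [E [oE sE]]].
  exists (fun=> 1); split; last by rewrite big_ord1 star1 mulr1.
  by move=> i j; rewrite !ord1 star1 mulr1.
(* Multiplying the range identity by [star v1] on the left and [v2] on the right gives twice the
   same product on one side. *)
have h21 : star v1 * v2 = 0.
  have e : star v1 * (v1 * star v1 + v2 * star v2) * v2 = star v1 * v2 by rewrite h12 mulr1.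
  move: e; rewrite mulrDr mulrDl !mulrA h1 mul1r -[_ * star v2 * v2]mulrA h2 mulr1 => /eqP.
  by rewrite -subr_eq0 addrK => /eqP.
have h12' : star v2 * v1 = 0 by rewrite -[LHS]starK starM starK h21 star0.
exists (fun i => if unlift ord0 i is Some j then v2 * E j else v1); split.
  move=> i j; case: (unliftP ord0 i) => [i'|] ->; case: (unliftP ord0 j) => [j'|] ->;
    rewrite ?liftK ?unlift_none.
  - rewrite starM mulrA -[_ * star v2 * v2]mulrA h2 mulr1 oE.
    by rewrite (inj_eq (@lift_inj _ ord0)).
  - by rewrite starM -mulrA h12' mulr0.
  - by rewrite mulrA h21 mul0r.
  - by rewrite h1 eqxx.
rewrite big_ord_recl unlift_none -h12; congr (_ + _).
under eq_bigr do rewrite liftK starM.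
rewrite -[X in _ = X * _](mulr1 v2) -[in RHS]sE mulr_sumr mulr_suml.
by apply: eq_bigr => i _; rewrite !mulrA.
Qed.

Lemma cnorm_sum_le n (F : 'I_n -> M) (c : R) :
  (forall i, cnorm (F i) <= c) -> cnorm (\sum_i F i) <= n%:R * c.
Proof.
elim: n F => [|n ih] F h; first by rewrite big_ord0 cnorm0 mul0r.
rewrite big_ord_recl; apply: le_trans (cnormD _ _) _.
by rewrite [leRHS](_ : _ = c + n%:R * c); [apply: lerD => //; exact: ih|rewrite -natr1; ring].
Qed.

Section OneCode.
Variables (r : nat) (E : 'I_r -> M).
Hypothesis cE : code E.

Lemma code_orth i j : star (E i) * E j = (i == j)%:R.
Proof. exact: cE.1. Qed.

Lemma cnorm_code i : cnorm (E i) = 1.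
Proof.
apply/eqP; rewrite -(@eqrXn2 _ 2) ?cnorm_ge0 //.
by rewrite -cnorm_star code_orth eqxx cnorm1 expr1n.
Qed.

Definition hat (u : 'M[C]_r) : M := \sum_i \sum_j u i j *: (E i * star (E j)).

Lemma hat_code u j : hat u * E j = \sum_i u i j *: E i.
Proof.
rewrite mulr_suml; apply: eq_bigr => i _; rewrite mulr_suml (bigD1 j) //=.
rewrite -scalerAl -mulrA code_orth eqxx mulr1 big1 ?addr0 // => k kj.
by rewrite -scalerAl -mulrA code_orth (negbTE kj) mulr0 scaler0.
Qed.

Lemma code_ext (x y : M) : (forall j, x * E j = y * E j) -> x = y.
Proof.
move=> h; rewrite -[x]mulr1 -[y]mulr1 -cE.2 !mulr_sumr.
by apply: eq_bigr => i _; rewrite !mulrA h.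
Qed.

Lemma star_hat u : star (hat u) = hat (map_mx conjc u^T).
Proof.
rewrite /hat exchange_big (big_morph _ (@starD _ M) (@star0 _ M)).
apply: eq_bigr => i _; rewrite (big_morph _ (@starD _ M) (@star0 _ M)).
by apply: eq_bigr => j _; rewrite starZ starM starK !mxE.
Qed.

Lemma hatM u v : hat u * hat v = hat (u *m v).
Proof.
apply: code_ext => j; rewrite -mulrA !hat_code mulr_sumr.
under eq_bigr do rewrite -scalerAr hat_code scaler_sumr.
rewrite exchange_big; apply: eq_bigr => i _; rewrite mxE scaler_suml.
by apply: eq_bigr => k _; rewrite scalerA mulrC.
Qed.

Lemma hat1 : hat 1%:M = 1.
Proof.
apply: code_ext => j; rewrite hat_code mul1r (bigD1 j) //= mxE eqxx scale1r.
by rewrite big1 ?addr0 // => i ij; rewrite mxE (negbTE ij) scale0r.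
Qed.

Lemma star_hat_hat u : map_mx conjc u^T *m u = 1%:M -> star (hat u) * hat u = 1.
Proof. by move=> h; rewrite star_hat hatM h hat1. Qed.

(* Up to the factor [r], a conditional expectation onto the commutant of the
   matrix units [E i * star (E j)]. *)
Definition code_trace (y : M) : M := \sum_j star (E j) * y * E j.

Lemma code_traceB x y : code_trace (x - y) = code_trace x - code_trace y.
Proof. by rewrite -sumrB; apply: eq_bigr => j _; rewrite mulrBr mulrBl. Qed.

Lemma code_trace_sum k (F : 'I_k -> M) : code_trace (\sum_i F i) = \sum_i code_trace (F i).
Proof.
rewrite exchange_big; apply: eq_bigr => j _.
by rewrite mulr_sumr mulr_suml.
Qed.

Lemma code_trace1 : code_trace 1 = r%:R.
Proof.
rewrite /code_trace; under eq_bigr do rewrite mulr1 code_orth eqxx.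
by rewrite sumr_const card_ord.
Qed.

Lemma cnorm_code_trace y : cnorm (code_trace y) <= r%:R * cnorm y.
Proof.
apply: cnorm_sum_le => j; apply: le_trans (cnormM _ _) _; rewrite cnorm_code mulr1.
by apply: le_trans (cnormM _ _) _; rewrite cnorm_star_eq cnorm_code mul1r.
Qed.

Lemma code_trace_conj u y : u *m map_mx conjc u^T = 1%:M ->
  code_trace (star (hat u) * y * hat u) = code_trace y.
Proof.
move=> hu; rewrite /code_trace.
have e j : star (E j) * (star (hat u) * y * hat u) * E j =
    \sum_i \sum_i' (u i' j * conjc (u i j)) *: (star (E i) * y * E i').
  rewrite !mulrA -mulrA hat_code -[star (E j) * _]starM hat_code.
  rewrite (big_morph _ (@starD _ M) (@star0 _ M)) !mulr_suml; apply: eq_bigr => i _.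
  rewrite mulr_sumr; apply: eq_bigr => i' _.
  by rewrite starZ -!scalerAl -scalerAr scalerA mulrC.
under eq_bigr do rewrite e.
rewrite exchange_big; apply: eq_bigr => i _; rewrite exchange_big (bigD1 i) //=.
have g i' : \sum_j (u i' j * conjc (u i j)) *: (star (E i) * y * E i') =
    (i' == i)%:R *: (star (E i) * y * E i').
  rewrite -scaler_suml; congr (_ *: _).
  transitivity ((1%:M : 'M[C]_r) i' i); last by rewrite mxE.
  by rewrite -hu mxE; apply: eq_bigr => j _; rewrite !mxE.
rewrite g eqxx scale1r big1 ?addr0 // => i' ne.
by rewrite g (negbTE ne) scale0r.
Qed.

(** The map [code_trace] is invariant under conjugation by unitary matrices, so it kills the sum and
    sends the whole element to [r], while it multiplies norms by at most [r]. *)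
Lemma commutator_far k (u : 'I_k -> 'M[C]_r) (y : 'I_k -> M) : (0 < r)%N ->
  (forall i, u i *m map_mx conjc (u i)^T = 1%:M) ->
  1 <= cnorm (1 - \sum_i (star (hat (u i)) * y i * hat (u i) - y i)).
Proof.
move=> r0 hu; have := cnorm_code_trace (1 - \sum_i (star (hat (u i)) * y i * hat (u i) - y i)).
rewrite code_traceB code_trace_sum big1 => [|i _]; last first.
  by rewrite code_traceB code_trace_conj // subrr.
rewrite subr0 code_trace1 -[X in cnorm X]mulr1 mulr_natl -scaler_nat cnormZ cnorm1 mulr1.
have -> : Normc.normc (r%:R : C) = r%:R.
  by rewrite -(rmorph_nat (real_complex R)) normc_real normr_nat.
by rewrite -[X in X <= _]mulr1 ler_pM2l // ltr0n.
Qed.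

End OneCode.

Lemma contr_entry m n (K : 'M[C]_(m, n)) i j : contr K -> nc (K i j) <= 1.
Proof.
move=> /(_ (delta_mx 0 i) (delta_mx 0 j)).
have h p (k : 'I_p) : nrm (dot R p) (delta_mx 0 k) = 1.
  apply/eqP; rewrite -(@eqrXn2 _ 2) ?nrm_ge0 // nrm_dot (bigD1 k) //= mxE !eqxx.
  rewrite Normc.normc1 big1 => [|l lk]; first by rewrite addr0.
  by rewrite mxE (negbTE lk) andbF Normc.normc0 expr0n.
rewrite !h mulr1; congr (nc _ <= 1).
rewrite (bigD1 i) //= (bigD1 j) //= !mxE !eqxx mul1r mulr1 !big1 ?addr0 //.
  by move=> l li; apply: big1 => l' _; rewrite mxE (negbTE li) andbF !mul0r.
by move=> l lj; rewrite !mxE (negbTE lj) andbF mulr0.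
Qed.

(** The element [star X * X] is the image of the contraction [adj K *m K], and the image of any
    contraction has norm at most [b^2], entry by entry. Applied to the powers of [star X * X], this
    crude bound improves to 1. *)
Lemma cnorm_contr a b (E : 'I_a -> M) (E' : 'I_b -> M) (K : 'M[C]_(a, b)) :
  code E -> code E' -> contr K ->
  cnorm (\sum_i \sum_j K i j *: (E i * star (E' j))) <= 1.
Proof.
move=> cE cE' cK; set X := \sum_i _.
pose L := map_mx conjc K^T *m K.
have cL : contr L by apply: contr_mul => //; exact/contr_conj/contr_tr.
have opE n m (F : 'I_n -> M) (F' : 'I_m -> M) (N : 'M[C]_(n, m)) j : code F' ->
    (\sum_i \sum_j N i j *: (F i * star (F' j))) * F' j = \sum_i N i j *: F i.
  move=> cF'; rewrite mulr_suml; apply: eq_bigr => i _; rewrite mulr_suml (bigD1 j) //=.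
  rewrite -scalerAl -mulrA (code_orth cF') eqxx mulr1 big1 ?addr0 // => k kj.
  by rewrite -scalerAl -mulrA (code_orth cF') (negbTE kj) mulr0 scaler0.
have sX : star X = \sum_j \sum_i (map_mx conjc K^T) j i *: (E' j * star (E i)).
  rewrite /X exchange_big (big_morph _ (@starD _ M) (@star0 _ M)).
  apply: eq_bigr => i _; rewrite (big_morph _ (@starD _ M) (@star0 _ M)).
  by apply: eq_bigr => j _; rewrite starZ starM starK !mxE.
have XL : star X * X = hat E' L.
  apply: (code_ext cE') => j; rewrite -mulrA opE // hat_code // mulr_sumr.
  under eq_bigr do rewrite -scalerAr sX opE // scaler_sumr.
  rewrite exchange_big; apply: eq_bigr => i _; rewrite mxE scaler_suml.
  by apply: eq_bigr => k _; rewrite scalerA mulrC.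
pose LL p := iter p (fun N : 'M[C]_b => N *m N) L.
have cLL p : contr (LL p) by elim: p => [|p ih] //=; exact: contr_mul.
have pow p : (star X * X) ^+ (2 ^ p) = hat E' (LL p).
  elim: p => [|p ih]; first by rewrite expr1.
  by rewrite expnSr exprM ih expr2 (hatM cE').
have hat_le (N : 'M[C]_b) : contr N -> cnorm (hat E' N) <= (b * b)%:R.
  move=> cN; rewrite natrM -[X in _ <= _ * X]mulr1; apply: cnorm_sum_le => i.
  apply: cnorm_sum_le => j; rewrite cnormZ -[X in _ <= X]mulr1.
  apply: ler_pM; rewrite ?normc_ge0 ?cnorm_ge0 ?contr_entry //.
  apply: le_trans (cnormM _ _) _.
  by rewrite cnorm_star_eq !(cnorm_code cE') mulr1.
suff : cnorm X ^+ 2 <= 1 by rewrite expr_le1 ?cnorm_ge0.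
apply: (@le_of_pow2_growth _ _ _ (b * b)%:R) => [|p]; first exact: ler01.
rewrite expr1n mulr1 -cnorm_star -cnorm_sa_pow; last exact: sa_sq.
rewrite pow; apply: le_trans (hat_le _ (cLL p)) _.
by rewrite ler_peMr ?ler0n // ler1n expn_gt0.
Qed.

End Codes.

(** * A quantum expander *)

Section Characters.
Variable R : realType.
Notation C := R[i].
Notation nc := (@Normc.normc R).

Definition cis (x : R) : C := cos x +i* sin x.

Lemma cisD x y : cis (x + y) = cis x * cis y.
Proof. by rewrite /cis cosD sinD; apply/eqP; rewrite eq_complex /= eqxx addrC eqxx. Qed.

Lemma cisX x k : cis x ^+ k = cis (k%:R * x).
Proof.
elim: k => [|k ih]; first by rewrite mul0r /cis cos0 sin0.
by rewrite exprSr ih -cisD -natr1 mulrDl mul1r.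
Qed.

Lemma normc_cis x : nc (cis x) = 1.
Proof. by rewrite /cis /= cos2Dsin2 sqrtr1. Qed.

Lemma sqr_normc_1B_cis x : nc (1 - cis x) ^+ 2 = 2 - 2 * cos x.
Proof.
rewrite /cis /= sqr_sqrtr ?addr_ge0 ?sqr_ge0 //.
have h := cos2Dsin2 x; rewrite add0r sqrrN sqrrB expr1n mul1r.
by rewrite -addrA h; ring.
Qed.

Lemma cos_le_34 (x : R) : pi / 4 <= x <= 7 * (pi / 4) -> cos x <= 3 / 4.
Proof.
have pi0 : 0 < pi :> R := pi_gt0 R.
have q : cos (pi / 4) <= 3 / 4 :> R.
  have h := cos_mulr2n (pi / 4 : R).
  have e : (pi / 4) *+ 2 = pi / 2 :> R by rewrite mulr2n; field.
  by rewrite e cos_pihalf mulr2n in h; rewrite leNgt; apply/negP => lt; nra.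
have small (y : R) : pi / 4 <= y <= pi -> cos y <= 3 / 4.
  move=> hy; apply: le_trans q; rewrite leNgt; apply/negP => lt.
  have : y < pi / 4.
    by rewrite -ltr_cos // in_itv /=; apply/andP; split; lra.
  lra.
move=> hx; have [h|h] := leP x pi; first by apply: small; lra.
have -> : cos x = cos (pi *+ 2 - x).
  by rewrite -cosN -(cosD2pi (- x)) addrC.
by apply: small; rewrite mulr2n; lra.
Qed.

Lemma cos_lt1 (x : R) : 0 < x < pi *+ 2 -> cos x < 1.
Proof.
have pi0 : 0 < pi :> R := pi_gt0 R.
have small (y : R) : 0 < y <= pi -> cos y < 1.
  by move=> hy; rewrite -cos0 ltr_cos ?in_itv /=; lra.
move=> hx; have [h|h] := leP x pi; first by apply: small; lra.
have -> : cos x = cos (pi *+ 2 - x).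
  by rewrite -cosN -(cosD2pi (- x)) addrC.
by apply: small; move: hx; rewrite mulr2n; lra.
Qed.

Variable p : nat.
Notation n := p.+2.
Notation Z := 'I_p.+2.

Definition chi (j : Z) : C := cis (2 * pi / n%:R) ^+ j.

Let w_n : cis (2 * pi / n%:R) ^+ n = 1.
Proof.
rewrite cisX mulrCA mulfV ?pnatr_eq0 // mulr1 /cis mulr_natl cos2pi sin2pi.
by [].
Qed.

Lemma chiD i j : chi (i + j) = chi i * chi j.
Proof. by rewrite /chi /= (expr_mod _ w_n) exprD. Qed.

Lemma chi0 : chi 0 = 1. Proof. by rewrite /chi expr0. Qed.

Lemma normc_chi i : nc (chi i) = 1.
Proof. by rewrite /chi cisX normc_cis. Qed.

Lemma conj_chi i : conjc (chi i) = chi (- i).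
Proof.
have h : chi i * chi (- i) = 1 by rewrite -chiD subrr chi0.
rewrite -[LHS]mulr1 -h mulrA [conjc _ * _]mulrC mulc_conj normc_chi expr1n.
by rewrite mul1r.
Qed.

Lemma chi_neq1 i : i != 0 -> chi i != 1.
Proof.
move=> i0; have ip : (0 < i)%N by rewrite lt0n; apply: contra i0 => /eqP h; apply/eqP/val_inj.
have pi0 : 0 < pi :> R := pi_gt0 R.
apply/eqP; rewrite /chi cisX => /(congr1 (@complex.Re R)) /= h.
suff : cos (i%:R * (2 * pi / n%:R) : R) < 1 by rewrite h ltxx.
have n0 : 0 < n%:R :> R by rewrite ltr0n.
have iR : 0 < i%:R :> R by rewrite ltr0n.
have inR : i%:R < n%:R :> R by rewrite ltr_nat.
apply: cos_lt1; rewrite mulrA ltr_pdivrMr // divr_gt0 //; last by rewrite !mulr_gt0.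
by rewrite mulr2n; nra.
Qed.

Lemma sum_chi i : \sum_(t : Z) chi (t * i) = (i == 0)%:R * n%:R.
Proof.
have [->|i0] := eqVneq i 0.
  under eq_bigr do rewrite mulr0 chi0.
  by rewrite sumr_const card_ord mul1r.
rewrite mul0r; have h : chi i * (\sum_(t : Z) chi (t * i)) = \sum_(t : Z) chi (t * i).
  rewrite [RHS](reindex_inj (addrI 1)) mulr_sumr; apply: eq_bigr => t _.
  by rewrite mulrDl mul1r chiD.
have : (chi i - 1) * (\sum_(t : Z) chi (t * i)) = 0 by rewrite mulrBl mul1r h subrr.
by move=> /eqP; rewrite mulf_eq0 subr_eq0 (negbTE (chi_neq1 i0)) => /eqP.
Qed.

Definition zabs (s : Z) : nat := minn s (n - s).

(** The angle of [chi s] is then at least [pi / 4] away from 0, where the cosine is at most [3 / 4],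
    and [2 - 2 (3 / 4) = 1 / 2]. *)
Lemma chi_far s : (n <= 8 * zabs s)%N -> 1 / 2 <= nc (1 - chi s) ^+ 2.
Proof.
rewrite /zabs => h; rewrite /chi cisX sqr_normc_1B_cis.
have pi0 : 0 < pi :> R := pi_gt0 R.
have n0 : 0 < n%:R :> R by rewrite ltr0n.
have h1 : n%:R <= 8 * s%:R :> R by rewrite -natrM ler_nat; lia.
have h2 : 8 * s%:R <= 7 * n%:R :> R by rewrite -!natrM ler_nat; lia.
suff : cos (s%:R * (2 * pi / n%:R) : R) <= 3 / 4 by lra.
apply: cos_le_34; rewrite mulrA; apply/andP; split.
  by rewrite ler_pdivlMr //; nra.
by rewrite ler_pdivrMr //; nra.
Qed.

Lemma parseval_chi (y : Z -> C) :
  \sum_t nc (\sum_l chi (- (t * l)) * y l) ^+ 2 = n%:R * \sum_l nc (y l) ^+ 2.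
Proof.
apply: (@complexI R).
rewrite (rmorphM (real_complex R)) !(raddf_sum (real_complex R)) /=.
under eq_bigr do rewrite -mulc_conj raddf_sum /= mulr_suml.
rewrite exchange_big (rmorph_nat (real_complex R)) mulr_sumr; apply: eq_bigr => l _.
under eq_bigr do rewrite mulr_sumr.
rewrite exchange_big /= (bigD1 l) //= [X in _ + X]big1 => [|l' ll']; last first.
  transitivity (y l * conjc (y l') * \sum_t chi (t * (l' - l))).
    rewrite mulr_sumr; apply: eq_bigr => t _.
    by rewrite rmorphM /= conj_chi opprK mulrBr chiD; ring.
  by rewrite sum_chi subr_eq0 (negbTE ll') mul0r mulr0.
rewrite addr0 -mulc_conj.
under eq_bigr => t _.
  rewrite rmorphM /= conj_chi opprK mulrACA -chiD addNr chi0 mul1r; over.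
by rewrite sumr_const card_ord mulr_natl.
Qed.

End Characters.

(** * Ping-pong for a shear and a quarter turn modulo [n] *)

Section PingPong.
Variables (R : realType) (p : nat).
Notation n := p.+2.
Notation Z := 'I_p.+2.
Variables (q : Z * Z -> R) (d : R).

Let mass (P : pred (Z * Z)) : R := \sum_(w | P w) q w ^+ 2.
Let shear (w : Z * Z) : Z * Z := (w.1, w.2 - w.1 - w.1).
Let shear' (w : Z * Z) : Z * Z := (w.1, w.2 + w.1 + w.1).
Let turn (w : Z * Z) : Z * Z := (w.2, - w.1).

Hypothesis d0 : 0 <= d.
Hypothesis near_shear : \sum_w (q w - q (shear w)) ^+ 2 <= d.
Hypothesis near_turn : \sum_w (q w - q (turn w)) ^+ 2 <= d.
Hypothesis mass_far : mass (fun w => (n <= 8 * zabs w.1)%N) <= 2 * d.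
Hypothesis mass_origin : q (0, 0) ^+ 2 <= mass predT / 4.

Let err : R := mass predT / 100 + 101 * d.

Let le_mass (P Q : pred (Z * Z)) : (forall w, P w -> Q w) -> mass P <= mass Q.
Proof.
move=> PQ; rewrite /mass [X in _ <= X](bigID P) /= [X in _ <= X + _](eq_bigl P); last first.
  by move=> w; case: (boolP (P w)) => [/PQ ->|_]; rewrite ?andbF.
by rewrite lerDl; apply: sumr_ge0 => w _; exact: sqr_ge0.
Qed.

Let mass_or (P Q : pred (Z * Z)) : mass (fun w => P w || Q w) <= mass P + mass Q.
Proof.
rewrite /mass (bigID P) /=; apply: lerD.
  by rewrite (eq_bigl P) // => w; case: (P w) => //=; rewrite andbF.
apply: (@le_mass (fun w => (P w || Q w) && ~~ P w) Q) => w.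
by case: (P w) => //=; rewrite andbT.
Qed.

(** From [2 b (a - b) <= b^2 / 100 + 100 (a - b)^2], which explains both constants in [err]. The
    weight [1 / 100] is small enough for [pingpong] to absorb all its error terms. *)
Let transport (f g : Z * Z -> Z * Z) (P : pred (Z * Z)) : cancel f g -> cancel g f ->
  \sum_w (q w - q (f w)) ^+ 2 <= d ->
  mass P <= mass (P \o f) + err /\ mass (P \o f) <= mass P + err.
Proof.
move=> fg gf hd.
have e : mass P = \sum_(w | P (f w)) q (f w) ^+ 2.
  by rewrite /mass (reindex f) //; exists g => w _.
have sub (a b : Z * Z -> R) : \sum_w (a w - b w) ^+ 2 <= d ->
    \sum_w b w ^+ 2 <= mass predT ->
    \sum_(w | P (f w)) a w ^+ 2 <= \sum_(w | P (f w)) b w ^+ 2 + err.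
  move=> hab hb.
  have h1 : \sum_(w | P (f w)) a w ^+ 2 <=
      \sum_(w | P (f w)) (b w ^+ 2 + (b w ^+ 2 / 100 + 101 * (a w - b w) ^+ 2)).
    apply: ler_sum => w _; have := sqr_ge0 (b w / 10 - 10 * (a w - b w)); nra.
  apply: le_trans h1 _; rewrite big_split /= lerD2l.
  apply: (@le_trans _ _ (\sum_w (b w ^+ 2 / 100 + 101 * (a w - b w) ^+ 2))).
    rewrite [X in _ <= X](bigID (fun w => P (f w))) /= lerDl.
    apply: sumr_ge0 => w _; have := sqr_ge0 (b w); have := sqr_ge0 (a w - b w); lra.
  rewrite big_split /= -mulr_suml -mulr_sumr /err; lra.
have all : \sum_w q (f w) ^+ 2 = mass predT.
  by rewrite /mass [RHS](reindex f) //; exists g => w _.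
split; rewrite e; apply: sub => //; last by rewrite all.
by rewrite (eq_bigr (fun w => (q w - q (f w)) ^+ 2)) // => w _; rewrite -sqrrN opprB.
Qed.

Let valN (s : Z) : (- s : Z) = (if s == 0 :> nat then 0 else n - s)%N :> nat.
Proof.
rewrite /=; case: eqP => [->|/eqP s0]; first by rewrite subn0 modnn.
by rewrite modn_small //; lia.
Qed.

Let valD (s t : Z) : (s + t : Z) = (if s + t < n then s + t else s + t - n)%N :> nat.
Proof.
rewrite /=; case: ltnP => h; first by rewrite modn_small.
have := ltn_ord s; have := ltn_ord t => h1 h2.
rewrite -[X in (X %% _)%N](subnK h) modnDr modn_small //; lia.
Qed.

Let valB (t s : Z) : (t - s : Z) = (if s <= t then t - s else t + n - s)%N :> nat.
Proof.
rewrite valD valN; have := ltn_ord s; have := ltn_ord t.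
by case: ifP; case: ifP; case: ifP; lia.
Qed.

(** The cutoff at [n / 8] keeps shears by twice the first coordinate from wrapping around modulo
    [n], so that the integer ping-pong argument remains valid. *)
Let narrow (w : Z * Z) := (8 * zabs w.1 < n)%N && (zabs w.2 < zabs w.1)%N.
Let tall (w : Z * Z) := (zabs w.1 < zabs w.2)%N.
Let diagonal (w : Z * Z) :=
  [&& (8 * zabs w.1 < n)%N, zabs w.1 == zabs w.2 & w.1 != 0%N :> nat].
Let far (w : Z * Z) := (n <= 8 * zabs w.1)%N.

Let shear_narrow w : narrow (shear w) -> tall w.
Proof.
case: w => s t; rewrite /narrow /tall /zabs /shear /shear' /turn; cbn [fst snd].
move: (valB t s) (valB (t - s) s) (ltn_ord s) (ltn_ord t).
by do 2 case: ifP; lia.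
Qed.

Let shear'_narrow w : narrow (shear' w) -> tall w.
Proof.
case: w => s t; rewrite /narrow /tall /zabs /shear /shear' /turn; cbn [fst snd].
move: (valD t s) (valD (t + s) s) (ltn_ord s) (ltn_ord t).
by do 2 case: ifP; lia.
Qed.

Let shear_shear'_narrow w : narrow (shear w) -> ~~ narrow (shear' w).
Proof.
case: w => s t; rewrite /narrow /zabs /shear /shear' /turn; cbn [fst snd].
move: (valB t s) (valB (t - s) s) (valD t s) (valD (t + s) s) (ltn_ord s) (ltn_ord t).
by do 4 case: ifP; lia.
Qed.

Let turn_tall w : tall w -> narrow (turn w) || far (turn w).
Proof.
case: w => s t; rewrite /narrow /tall /far /zabs /shear /shear' /turn; cbn [fst snd].
by move: (valN s) (ltn_ord s) (ltn_ord t); case: ifP; lia.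
Qed.

Let diagonal_tall w : diagonal w -> tall (shear w) || tall (shear' w).
Proof.
case: w => s t; rewrite /diagonal /tall /zabs /shear /shear' /turn; cbn [fst snd].
move: (valB t s) (valB (t - s) s) (valD t s) (valD (t + s) s) (ltn_ord s) (ltn_ord t).
by do 4 case: ifP; lia.
Qed.

Let cover w : [|| far w, narrow w, tall w, diagonal w | w == (0, 0)].
Proof.
case: w => s t; rewrite /far /narrow /tall /diagonal /zabs xpair_eqE; cbn [fst snd].
have -> : (s == 0) = (s == 0 :> nat) by [].
have -> : (t == 0) = (t == 0 :> nat) by [].
by move: (ltn_ord s) (ltn_ord t); lia.
Qed.

(* [shear] maps the cone [narrow] into [tall] in two disjoint ways and [turn]
   exchanges the two cones, so neither can carry mass. *)
Lemma pingpong : mass predT <= 100 * (100 * d).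
Proof.
have c1 : cancel shear shear' by case=> s t; rewrite /shear /shear' /= !subrK.
have c2 : cancel shear' shear by case=> s t; rewrite /shear /shear' /= !addrK.
have c3 : cancel turn (fun w => (- w.2, w.1)) by case=> s t; rewrite /turn /= opprK.
have c4 : cancel (fun w => (- w.2, w.1)) turn by case=> s t; rewrite /turn /= opprK.
have n1 : mass narrow <= mass (narrow \o shear) + err.
  by have [] := transport narrow c1 c2 near_shear.
have shK (P : pred (Z * Z)) : mass (P \o shear' \o shear) = mass P.
  by apply: eq_bigl => w /=; rewrite c1.
have n2 : mass narrow <= mass (narrow \o shear') + err.
  by have [_] := transport (narrow \o shear') c1 c2 near_shear; rewrite shK.
have n3 : mass (narrow \o shear) + mass (narrow \o shear') <= mass tall.
  rewrite /mass [X in _ <= X](bigID (narrow \o shear)) /=; apply: lerD.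
    apply: (@le_mass _ (fun w => tall w && narrow (shear w))) => w h.
    by rewrite (shear_narrow h).
  apply: (@le_mass _ (fun w => tall w && ~~ narrow (shear w))) => w h.
  by rewrite (shear'_narrow h); apply/negP => /shear_shear'_narrow; rewrite h.
have n4 : mass tall <= mass narrow + err + (mass far + err).
  apply: le_trans (le_mass turn_tall) _.
  apply: le_trans (mass_or (narrow \o turn) (far \o turn)) _.
  by apply: lerD; [have [] := transport narrow c3 c4 near_turn
    |have [] := transport far c3 c4 near_turn].
have n5 : mass diagonal <= mass tall + err + (mass tall + err).
  apply: le_trans (le_mass diagonal_tall) _.
  apply: le_trans (mass_or (tall \o shear) (tall \o shear')) _.
  apply: lerD; first by have [] := transport tall c1 c2 near_shear.
  by have [+ _] := transport (tall \o shear') c1 c2 near_shear; rewrite shK.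
have n6 : mass predT <= mass far + (mass narrow + (mass tall + (mass diagonal + mass (pred1 (0, 0))))).
  apply: le_trans (@le_mass predT _ (fun w _ => cover w)) _.
  do 3 (apply: le_trans (mass_or _ _) _; rewrite lerD2l).
  exact: mass_or.
have n7 : mass (pred1 (0, 0)) <= mass predT / 4 by rewrite /mass big_pred1_eq.
have n8 : mass far <= 2 * d := mass_far.
(* The shears give [2 narrow <= tall + 2 err], the turn gives [tall <= narrow + far + 2 err]. *)
have h1 : mass narrow <= mass far + 4 * err by lra.
have h2 : mass tall <= 2 * mass far + 6 * err by lra.
(* Here [24 err] contains [24 / 100] of the total mass. Together with [1 / 4] this leaves [51 / 100]
   of it, bounded by [2440 d]. *)
have h3 : mass predT <= 16 * d + 24 * err + mass predT / 4 by lra.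
have e : err = mass predT / 100 + 101 * d by [].
by have := d0; lra.
Qed.

End PingPong.

(** * Spectral gap of the clock, chirp and Fourier matrices *)

Section Gap.
Variable R : realType.
Notation C := R[i].
Notation nc := (@Normc.normc R).

Definition adj m n (A : 'M[C]_(m, n)) : 'M[C]_(n, m) := map_mx conjc A^T.

Lemma adjM m n k (A : 'M[C]_(m, n)) (B : 'M[C]_(n, k)) : adj (A *m B) = adj B *m adj A.
Proof. by rewrite /adj trmx_mul map_mxM. Qed.

Lemma adjK m n (A : 'M[C]_(m, n)) : adj (adj A) = A.
Proof. by apply/matrixP => i j; rewrite !mxE conjcK. Qed.

Definition hsq m n (x : 'M[C]_(m, n)) : R := \sum_i \sum_j nc (x i j) ^+ 2.

Section Generators.
Variable p : nat.
Notation n := p.+2.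
Notation Z := 'I_p.+2.
Notation chi := (@chi R p).

(* The inner product of [x] with the Weyl operator of [w], up to normalization.
   Conjugation by the clock, chirp and Fourier matrices acts on these
   coefficients by a character, a shear and a quarter turn. *)
Definition wt (x : 'M[C]_n) (w : Z * Z) : C := \sum_l chi (- (w.2 * l)) * x (l + w.1) l.

Lemma wtB x y w : wt (x - y) w = wt x w - wt y w.
Proof. by rewrite -sumrB; apply: eq_bigr => l _; rewrite !mxE mulrBr. Qed.

Lemma parseval_wt x : \sum_w nc (wt x w) ^+ 2 = n%:R * hsq x.
Proof.
rewrite -(pair_bigA _ (fun s t => nc (wt x (s, t)) ^+ 2)) /=.
under eq_bigr => s _ do rewrite (parseval_chi (fun l => x (l + s) l)).
rewrite -mulr_sumr /hsq; congr (_ * _).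
rewrite exchange_big [RHS]exchange_big; apply: eq_bigr => l _ /=.
by rewrite [RHS](reindex_inj (addrI l)).
Qed.

Definition clock : 'M[C]_n := diag_mx (\row_j chi j).
Definition chirp : 'M[C]_n := diag_mx (\row_j chi (j * j)).
Definition fourier : 'M[C]_n := \matrix_(j, l) ((Num.sqrt n%:R)^-1%:C * chi (j * l)).

Lemma adj_diag_mx (d : 'rV[C]_n) : adj (diag_mx d) = diag_mx (map_mx conjc d).
Proof. by rewrite /adj tr_diag_mx map_diag_mx. Qed.

Lemma diag_conjE (d : 'rV[C]_n) x a b :
  (diag_mx d *m x *m adj (diag_mx d)) a b = d 0 a * x a b * conjc (d 0 b).
Proof.
by rewrite adj_diag_mx mul_diag_mx mul_mx_diag !mxE.
Qed.

Lemma wt_clock x w : wt (clock *m x *m adj clock) w = chi w.1 * wt x w.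
Proof.
rewrite mulr_sumr; apply: eq_bigr => l _; rewrite diag_conjE !mxE conj_chi chiD.
have : chi l * chi (- l) = 1 by rewrite -chiD subrr chi0.
by move=> h; rewrite -[RHS]mul1r -h; ring.
Qed.

(** The shear is by [2 s] because [(l + s)^2 - l^2 = s^2 + 2 s l]. *)
Lemma wt_chirp x w :
  wt (chirp *m x *m adj chirp) w = chi (w.1 * w.1) * wt x (w.1, w.2 - w.1 - w.1).
Proof.
rewrite mulr_sumr; apply: eq_bigr => l _; rewrite diag_conjE !mxE conj_chi /=.
have e : chi (- (w.2 * l)) * chi ((l + w.1) * (l + w.1)) * chi (- (l * l)) =
    chi (w.1 * w.1) * chi (- ((w.2 - w.1 - w.1) * l)) by rewrite -!chiD; congr chi; ring.
by rewrite [RHS]mulrA -e; ring.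
Qed.

Let sq : (Num.sqrt n%:R)^-1%:C * (Num.sqrt n%:R)^-1%:C = n%:R^-1 :> C.
Proof.
rewrite -(rmorphM (real_complex R)) -invfM -expr2 sqr_sqrtr ?ler0n //.
by rewrite -(rmorph_nat (real_complex R)) /= fmorphV.
Qed.

Let cM (u v : C) : conjc (u * v) = conjc u * conjc v.
Proof. by rewrite rmorphM. Qed.

(** Orthogonality of characters leaves only the entries [x a b] with [a = b + t], so shift and
    frequency are exchanged up to sign. *)
Lemma wt_fourier x w :
  wt (fourier *m x *m adj fourier) w = chi (w.1 * w.2) * wt x (w.2, - w.1).
Proof.
case: w => s t /=; rewrite /wt /=.
have n0 : (n%:R : C) != 0 by rewrite pnatr_eq0.
have entry j l : (fourier *m x *m adj fourier) j l =
    n%:R^-1 * \sum_a \sum_b chi (j * a) * x a b * chi (- (l * b)).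
  rewrite mxE exchange_big mulr_sumr; apply: eq_bigr => b _.
  rewrite mxE mulr_suml mulr_sumr; apply: eq_bigr => a _.
  rewrite !mxE cM conj_chi conjc_real -sq; ring.
under eq_bigr do rewrite entry mulrCA mulr_sumr.
rewrite -mulr_sumr exchange_big.
transitivity (n%:R^-1 * \sum_b \sum_a
    (chi (s * a) * x a b * \sum_l chi (l * (a - b - t)))).
  congr (_ * _); rewrite [RHS]exchange_big; apply: eq_bigr => a _.
  under eq_bigr do rewrite mulr_sumr.
  rewrite exchange_big; apply: eq_bigr => b _; rewrite mulr_sumr; apply: eq_bigr => l _.
  have -> : chi ((l + s) * a) = chi (l * a) * chi (s * a) by rewrite -chiD mulrDl.
  have -> : chi (l * (a - b - t)) = chi (l * a) * chi (- (l * b)) * chi (- (t * l)).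
    by rewrite -!chiD; congr chi; ring.
  ring.
rewrite !mulr_sumr; apply: eq_bigr => b _.
under eq_bigr do rewrite sum_chi.
rewrite (bigD1 (b + t)) // big1 => [|a ab]; last first.
  rewrite (_ : (a - b - t == 0) = false) ?mul0r ?mulr0 //.
  by rewrite -addrA -opprD subr_eq0; apply/negbTE.
rewrite [X in _ * X]addr0 (_ : b + t - b - t = 0) ?eqxx ?mul1r; last by ring.
rewrite mulrCA mulVf // mulr1 [RHS]mulrA -chiD.
congr (chi _ * _); ring.
Qed.

Lemma adj_diag (d : 'rV[C]_n) : (forall j, nc (d 0 j) = 1) ->
  diag_mx d *m adj (diag_mx d) = 1%:M.
Proof.
move=> h; apply/matrixP => i j; rewrite adj_diag_mx mul_diag_mx !mxE.
have [->|ij] := eqVneq i j; last by rewrite mulr0.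
by rewrite !mulr1n mulc_conj h expr1n.
Qed.

Lemma fourier_unitary : fourier *m adj fourier = 1%:M.
Proof.
have n0 : (n%:R : C) != 0 by rewrite pnatr_eq0.
apply/matrixP => i j; rewrite !mxE.
transitivity (n%:R^-1 * \sum_l chi (l * (i - j))).
  rewrite mulr_sumr; apply: eq_bigr => l _; rewrite !mxE cM conj_chi conjc_real -sq.
  have -> : l * (i - j) = i * l + - (j * l) by ring.
  by rewrite chiD; ring.
rewrite sum_chi subr_eq0 mulrCA mulVf // mulr1.
by case: eqP.
Qed.

(** The identity is included for the sake of [polarized_gap], where its term is the squared distance
    between the two matrices compared. *)
Definition gens (i : 'I_4) : 'M[C]_n := nth 1%:M [:: 1%:M; clock; chirp; fourier] i.

Lemma gens_unitary i : gens i *m adj (gens i) = 1%:M.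
Proof.
case: i => [[|[|[|[|?]]]] ?] //; rewrite /gens /=.
- by rewrite /adj trmx1 map_mx1 mulmx1.
- by apply: adj_diag => j; rewrite mxE normc_chi.
- by apply: adj_diag => j; rewrite mxE normc_chi.
- exact: fourier_unitary.
Qed.

Lemma adj_gens_unitary i : adj (gens i) *m gens i = 1%:M.
Proof. exact/mulmx1C/gens_unitary. Qed.

Lemma hsq_ge0 m k (x : 'M[C]_(m, k)) : 0 <= hsq x.
Proof. by apply: sumr_ge0 => i _; apply: sumr_ge0 => j _; exact: sqr_ge0. Qed.

Definition defect (x : 'M[C]_n) : R := \sum_i hsq (x - gens i *m x *m adj (gens i)).

(** The generators permute the coefficients [wt x] up to phases, so the absolute values are nearly
    invariant, as [pingpong] requires. The clock acts by a character and controls the mass far from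
    [w.1 = 0]. The coefficient at the origin is the trace, which by the hypothesis carries at most a
    quarter of the mass. *)
Lemma defect_gap x : nc (\tr x) ^+ 2 <= n%:R / 4 * hsq x ->
  hsq x <= 100 * (100 * defect x).
Proof.
move=> htr; have n0 : 0 < n%:R :> R by rewrite ltr0n.
have le_defect i : hsq (x - gens i *m x *m adj (gens i)) <= defect x.
  by rewrite /defect (bigD1 i) //= lerDl; apply: sumr_ge0 => j _; exact: hsq_ge0.
have wt_le i : \sum_w nc (wt x w - wt (gens i *m x *m adj (gens i)) w) ^+ 2 <= n%:R * defect x.
  under eq_bigr do rewrite -wtB.
  by rewrite parseval_wt ler_pM2l.
have amp (f : Z * Z -> Z * Z) (ph : Z * Z -> C) i :
    (forall w, nc (ph w) = 1) ->
    (forall w, wt (gens i *m x *m adj (gens i)) w = ph w * wt x (f w)) ->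
    \sum_w (nc (wt x w) - nc (wt x (f w))) ^+ 2 <= n%:R * defect x.
  move=> hph hf; apply: le_trans (wt_le i); apply: ler_sum => w _; rewrite hf.
  rewrite -[X in (_ - X) ^+ 2]mul1r -(hph w) -Normc.normcM.
  move: (wt x w) (ph w * _) => a b.
  have h1 := le_normcD (a - b) b; have h2 := le_normcD (b - a) a.
  rewrite subrK in h1; rewrite subrK normcB in h2.
  have := normc_ge0 (a - b); nra.
rewrite -(@ler_pM2l _ n%:R) // -parseval_wt.
have -> : n%:R * (100 * (100 * defect x)) = 100 * (100 * (n%:R * defect x)) by ring.
apply: (@pingpong R p (fun w => nc (wt x w))).
- by rewrite mulr_ge0 // ?ler0n // (le_trans _ (le_defect 0)) // hsq_ge0.
- by apply: (amp _ (fun w => chi (w.1 * w.1)) (inord 2)) => w; [exact: normc_chi|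
    rewrite /gens inordK //; exact: wt_chirp].
- by apply: (amp _ (fun w => chi (w.1 * w.2)) (inord 3)) => w; [exact: normc_chi|
    rewrite /gens inordK //; exact: wt_fourier].
- have e1 : gens (inord 1) = clock by rewrite /gens inordK.
  have h := wt_le (inord 1); rewrite e1 in h.
  rewrite -ler_pdivrMl // mulrC mulr_suml; apply: le_trans h.
  rewrite [X in _ <= X](bigID (fun w : Z * Z => (n <= 8 * zabs w.1)%N)) /=.
  rewrite -[X in X <= _]addr0; apply: lerD; last by apply: sumr_ge0 => w _; exact: sqr_ge0.
  apply: ler_sum => w /chi_far hw; rewrite wt_clock.
  rewrite -[X in nc (X - _)]mul1r -mulrBl Normc.normcM exprMn.
  have := hw R; have := sqr_ge0 (nc (wt x w)); nra.
- have -> : wt x (0, 0) = \tr x.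
    by apply: eq_bigr => l _; rewrite /= mul0r oppr0 chi0 mul1r addr0.
  by rewrite parseval_wt mulrAC.
Qed.

End Generators.
End Gap.

(** * Hilbert-Schmidt norms and the polarized gap *)

Section HilbertSchmidt.
Variable R : realType.
Notation C := R[i].
Notation nc := (@Normc.normc R).

Lemma tr_adj m (x : 'M[C]_m) : \tr (adj x) = conjc (\tr x).
Proof. by rewrite /adj raddf_sum; apply: eq_bigr => i _; rewrite !mxE. Qed.

Section Form.
Variables m n : nat.
Implicit Types x y z : 'M[C]_(m, n).

Let hip x y : C := \tr (adj x *m y).

Fact hipDr x y z : hip x (y + z) = hip x y + hip x z.
Proof. by rewrite /hip mulmxDr mxtraceD. Qed.

Fact hipZr c x y : hip x (c *: y) = c * hip x y.
Proof. by rewrite /hip -scalemxAr mxtraceZ. Qed.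

Fact hipC x y : hip y x = conjc (hip x y).
Proof. by rewrite /hip -tr_adj adjM adjK. Qed.

Let hipE x : hip x x = (hsq x)%:C.
Proof.
rewrite (raddf_sum (real_complex R)) /hip /mxtrace.
under eq_bigr do rewrite mxE.
rewrite exchange_big; apply: eq_bigr => i _.
rewrite (raddf_sum (real_complex R)); apply: eq_bigr => j _.
by rewrite !mxE /= -mulc_conj mulrC.
Qed.

Fact hip_ge0 x : 0 <= hip x x.
Proof. by rewrite hipE ler0c hsq_ge0. Qed.

Definition hs := SemiInner hipDr hipZr hipC hip_ge0.

Lemma hsqE x : (hsq x)%:C = \tr (adj x *m x).
Proof. by rewrite -hipE. Qed.

Lemma nrm_hs x : nrm hs x ^+ 2 = hsq x.
Proof. by rewrite sqr_nrm -[hs x x]/(hip x x) hipE. Qed.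

Lemma two_Re_hs x y :
  2 * complex.Re (\tr (adj x *m y)) = hsq x + hsq y - hsq (x - y).
Proof.
rewrite -[\tr _]/(hs x y) -!nrm_hs sqr_nrmD ipNr.
have -> : nrm hs (- y) ^+ 2 = nrm hs y ^+ 2 by rewrite -scaleN1r nrmZ normcN Normc.normc1 mul1r.
case: (hs x y) => a b /=; ring.
Qed.

Lemma hsqN x : hsq (- x) = hsq x.
Proof. by rewrite -!nrm_hs -scaleN1r nrmZ normcN Normc.normc1 mul1r. Qed.

Lemma hsqB_le x y z : hsq (x - z) <= 2 * hsq (x - y) + 2 * hsq (y - z).
Proof.
have h := two_Re_hs (x - y) (z - y); have h' := two_Re_hs (x - y) (y - z).
have e : x - y - (z - y) = x - z by rewrite opprB addrA subrK.
rewrite e in h; rewrite -(hsqN (z - y)) opprB in h.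
have e2 : \tr (adj (x - y) *m (z - y)) = - \tr (adj (x - y) *m (y - z)).
  by rewrite -(raddfN mxtrace) -mulmxN opprB.
have := hsq_ge0 (x - y - (y - z)).
have e3 (c : C) : complex.Re (- c) = - complex.Re c by case: c.
rewrite e2 e3 in h; lra.
Qed.

Lemma Re_hs_le x y : 2 * complex.Re (\tr (adj x *m y)) <= hsq x + hsq y.
Proof. by rewrite two_Re_hs gerBl hsq_ge0. Qed.

End Form.

Lemma hsq_conj n (g x : 'M[C]_n) : adj g *m g = 1%:M ->
  hsq (g *m x *m adj g) = hsq x.
Proof.
move=> hg; apply: (@complexI R); rewrite !hsqE !adjM adjK !mulmxA.
by rewrite mxtrace_mulC !mulmxA hg mul1mx -[_ *m adj g *m g]mulmxA hg mulmx1.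
Qed.

Lemma polarized_gap p (x' x : 'M[C]_p.+2) : nc (\tr x) ^+ 2 <= p.+2%:R / 4 * hsq x ->
  \sum_i 2 * complex.Re (\tr (adj x' *m (gens R p i *m x *m adj (gens R p i)))) <=
  4 * hsq x' + 4 * hsq x - hsq x / (100 * (100 * 10)).
Proof.
move=> /defect_gap h.
pose a i := hsq (x' - gens R p i *m x *m adj (gens R p i)).
have e i : 2 * complex.Re (\tr (adj x' *m (gens R p i *m x *m adj (gens R p i)))) =
    hsq x' + hsq x - a i.
  by rewrite two_Re_hs hsq_conj //; exact: adj_gens_unitary.
under eq_bigr do rewrite e.
have a0 : a 0 = hsq (x - x').
  by rewrite /a /gens /= mul1mx /adj trmx1 map_mx1 mulmx1 -hsqN opprB.
(* Each term of the defect is compared through [x'] and is at most [2 a_0 + 2 a_i]. The defect is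
   thus at most [10 sum_i a_i], the source of the factor 10. *)
have hd : defect x <= 8 * a 0 + 2 * \sum_i a i.
  apply: (@le_trans _ _ (\sum_(i < 4) (2 * a 0 + 2 * a i))).
    by apply: ler_sum => i _; rewrite a0; exact: hsqB_le.
  by rewrite big_split /= sumr_const card_ord -mulr_sumr -mulr_natl; lra.
have a0s : a 0 <= \sum_i a i.
  by rewrite (bigD1 ord0) //= lerDl; apply: sumr_ge0 => i _; exact: hsq_ge0.
rewrite sumrB sumr_const card_ord.
have : hsq x / (100 * (100 * 10)) <= \sum_i a i.
  rewrite ler_pdivrMr ?mulr_gt0 //; lra.
rewrite -mulr_natl; lra.
Qed.

(** Diagonalization of [adj T *m T]; the [l j] are the squared singular values of [T]. *)
Lemma orth_columns n k (T : 'M[C]_(n, k)) : exists (P : 'M[C]_k) (l : 'I_k -> R),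
  [/\ adj P *m P = 1%:M, P *m adj P = 1%:M, forall j, 0 <= l j &
      adj (T *m adj P) *m (T *m adj P) = diag_mx (\row_j (l j)%:C)].
Proof.
pose G := adj T *m T.
have tE m m' (A : 'M[C]_(m, m')) : (A ^t* = adj A)%sesqui by [].
have nG : G \is normalmx.
  by apply/normalmxP; rewrite tE /G adjM adjK.
have /orthomx_spectralP := nG; set P := spectralmx G; set sp := spectral_diag G => hG.
have uP : P \is unitarymx := spectral_unitarymx G.
have h1 : P *m adj P = 1%:M by have /unitarymxP := uP.
have h2 : adj P *m P = 1%:M := mulmx1C h1.
pose V := T *m adj P.
have hV : adj V *m V = diag_mx sp.
  rewrite adjM adjK mulmxA -[P *m _ *m _]mulmxA -/G hG invmx_unitary // tE.
  by rewrite !mulmxA h1 mul1mx -mulmxA h1 mulmx1.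
exists P, (fun j => \sum_i nc (V i j) ^+ 2); split => //.
  by move=> j; apply: sumr_ge0 => i _; exact: sqr_ge0.
rewrite -/V hV; congr diag_mx; apply/rowP => j; rewrite !mxE.
have : (adj V *m V) j j = sp 0 j by rewrite hV mxE eqxx.
move=> <-; rewrite mxE (raddf_sum (real_complex R)); apply: eq_bigr => i _.
by rewrite !mxE /= -mulc_conj mulrC.
Qed.
End HilbertSchmidt.

(** * Balanced factorizations and Haagerup's trick *)

Section Factorization.
Variable R : realType.
Notation C := R[i].
Notation nc := (@Normc.normc R).

Lemma sqr_sum_le k (a : 'I_k -> R) : (\sum_j a j) ^+ 2 <= k%:R * \sum_j a j ^+ 2.
Proof.
have h : 0 <= \sum_i \sum_j (a i - a j) ^+ 2.
  by apply: sumr_ge0 => i _; apply: sumr_ge0 => j _; exact: sqr_ge0.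
have e i : \sum_j (a i - a j) ^+ 2 =
    k%:R * a i ^+ 2 + \sum_j a j ^+ 2 - 2 * (a i * \sum_j a j).
  rewrite (eq_bigr (fun j => a i ^+ 2 + (a j ^+ 2 - 2 * (a i * a j)))); last first.
    by move=> j _; ring.
  rewrite !big_split /= sumrN -!mulr_sumr sumr_const card_ord.
  by rewrite -[a i *+ k]mulr_natl; ring.
move: h; under eq_bigr do rewrite e.
rewrite !big_split /= sumrN -!mulr_sumr sumr_const card_ord -mulr_suml -mulr_natl; lra.
Qed.

Lemma hsq_eq0 m n (x : 'M[C]_(m, n)) : hsq x = 0 -> x = 0.
Proof.
move=> /eqP; rewrite psumr_eq0 => [/allP h|i _]; last first.
  by apply: sumr_ge0 => j _; exact: sqr_ge0.
apply/matrixP => i j; rewrite mxE; apply: Normc.eq0_normc.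
have := h i (mem_index_enum i); rewrite /= psumr_eq0 => [/allP h'|l _]; last exact: sqr_ge0.
by have := h' j (mem_index_enum j); rewrite /= sqrf_eq0 => /eqP.
Qed.

Lemma hsq_mul_adj m n (A : 'M[C]_(m, n)) : hsq (A *m adj A) = hsq (adj A *m A).
Proof.
apply: (@complexI R); rewrite !hsqE !adjM adjK.
by rewrite mxtrace_mulC !mulmxA mxtrace_mulC !mulmxA.
Qed.

Section RealDiagonal.
Variable k : nat.
Implicit Types f g : 'I_k -> R.

Definition rdiag f : 'M[C]_k := diag_mx (\row_j (f j)%:C).

Lemma rdiagM f g : rdiag f *m rdiag g = rdiag (fun j => f j * g j).
Proof.
rewrite /rdiag mulmx_diag; congr diag_mx; apply/rowP => j; rewrite !mxE.
by rewrite (rmorphM (real_complex R)).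
Qed.

Lemma adj_rdiag f : adj (rdiag f) = rdiag f.
Proof.
rewrite /adj tr_diag_mx map_diag_mx; congr diag_mx; apply/rowP => j.
by rewrite !mxE; exact: conjc_real.
Qed.

Lemma tr_rdiag f : \tr (rdiag f) = (\sum_j f j)%:C.
Proof.
rewrite mxtrace_diag (raddf_sum (real_complex R)).
by apply: eq_bigr => j _; rewrite mxE.
Qed.

Lemma hsq_rdiag f : hsq (rdiag f) = \sum_j f j ^+ 2.
Proof.
apply: (@complexI R); rewrite hsqE adj_rdiag rdiagM tr_rdiag.
by congr (_%:C); apply: eq_bigr => j _; rewrite expr2.
Qed.

Lemma rdiag_eq f g : f =1 g -> rdiag f = rdiag g.
Proof. by move=> h; congr diag_mx; apply/rowP => j; rewrite !mxE h. Qed.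

End RealDiagonal.

(** The polar decomposition is split evenly: each factor takes the square roots of the singular
    values, that is the fourth roots of the [l j]. The nonzero eigenvalues of [T1 *m adj T1] and of
    [adj T2 *m T2] are the nonzero singular values of [T]. The trace is therefore the trace norm of
    [T], and Cauchy-Schwarz over [k] singular values bounds its square. *)
Lemma balanced_factorization n k (T : 'M[C]_(n, k)) :
  exists (T1 : 'M[C]_(n, k)) (T2 : 'M[C]_k),
  [/\ T = T1 *m T2, hsq (T1 *m adj T1) = hsq T, hsq (adj T2 *m T2) = hsq T &
      nc (\tr (T1 *m adj T1)) ^+ 2 <= k%:R * hsq T].
Proof.
have [P [l [h1 h2 l0 hV]]] := orth_columns T.
set V := T *m adj P in hV.
have TV : T = V *m P by rewrite /V -mulmxA h1 mulmx1.
clearbody V.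
pose b j := Num.sqrt (Num.sqrt (l j)).
have bE j : b j ^+ 2 = Num.sqrt (l j) by rewrite sqr_sqrtr ?sqrtr_ge0.
have lE j : Num.sqrt (l j) ^+ 2 = l j by rewrite sqr_sqrtr.
pose T1 := V *m rdiag (fun j => (b j)^-1).
pose T2 := rdiag b *m P.
have VV f : adj (V *m rdiag f) *m (V *m rdiag f) = rdiag (fun j => f j * l j * f j).
  rewrite adjM adj_rdiag !mulmxA -[rdiag f *m adj V *m V]mulmxA hV -/(rdiag l).
  by rewrite !rdiagM.
have hT : hsq T = \sum_j l j.
  apply: (@complexI R); rewrite hsqE TV adjM mxtrace_mulC -!mulmxA.
  rewrite [P *m (adj P *m _)]mulmxA h2 mul1mx mxtrace_mulC hV.
  exact: tr_rdiag.
have hT1 : adj T1 *m T1 = rdiag (fun j => Num.sqrt (l j)).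
  rewrite /T1 VV; apply: rdiag_eq => j.
  have [z|nz] := eqVneq (l j) 0; first by rewrite z sqrtr0 mulr0 mul0r.
  rewrite mulrAC -expr2 exprVn bE -{2}lE expr2 mulrA mulVf ?mul1r //.
  by rewrite sqrtr_eq0 -ltNge lt_neqAle eq_sym nz l0.
have hT2 : T2 *m adj T2 = rdiag (fun j => Num.sqrt (l j)).
  rewrite /T2 adjM adj_rdiag !mulmxA -[_ *m P *m _]mulmxA h2 mulmx1 rdiagM.
  by apply: rdiag_eq => j; rewrite -expr2 bE.
have hsl : hsq (rdiag (fun j => Num.sqrt (l j))) = hsq T.
  by rewrite hsq_rdiag hT; apply: eq_bigr => j _; exact: lE.
exists T1, T2; split.
- rewrite /T1 /T2 mulmxA -[V *m _ *m _]mulmxA rdiagM TV; congr (_ *m _).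
  (* Where [l j = 0], the inverse of [b j] is 0 by convention, and column [j] of [V] vanishes. *)
  apply/eqP; rewrite -subr_eq0 -[X in X - _]mulmx1 -mulmxBr; apply/eqP.
  have -> : 1%:M - rdiag (fun j => (b j)^-1 * b j) = rdiag (fun j => 1 - (b j)^-1 * b j).
    apply/matrixP => i j; rewrite !mxE; case: eqP => _; rewrite ?mulr1n ?mulr0n ?subr0 //.
    by rewrite (rmorphB (real_complex R)).
  apply: hsq_eq0; apply: (@complexI R); rewrite hsqE VV tr_rdiag big1 // => j _.
  have [z|nz] := eqVneq (l j) 0; first by rewrite z mulr0 mul0r.
  have bn : b j != 0.
    by rewrite sqrtr_eq0 -ltNge sqrtr_gt0 lt_neqAle eq_sym nz l0.
  by rewrite mulVf // subrr !mul0r.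
- by rewrite hsq_mul_adj hT1.
- by rewrite -hsq_mul_adj hT2.
- rewrite mxtrace_mulC hT1 tr_rdiag normc_real real_normK ?num_real //.
  apply: le_trans (sqr_sum_le _) _; rewrite hT.
  by under eq_bigr do rewrite lE.
Qed.

Lemma hsq_contr m k n (c : 'M[C]_(m, k)) (x : 'M[C]_(k, n)) : contr c ->
  hsq (c *m x) <= hsq x.
Proof.
move=> /contrP h; rewrite /hsq exchange_big [leRHS]exchange_big; apply: ler_sum => j _ /=.
have {}h := h (\row_i x i j).
have := lerXn2r 2 (nrm_ge0 _ _) (nrm_ge0 _ _) h; rewrite !nrm_dot.
congr (_ <= _); apply: eq_bigr => i _; rewrite !mxE //.
by congr (nc _ ^+ 2); apply: eq_bigr => i' _; rewrite mxE.
Qed.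

Lemma hsq_adj m n (x : 'M[C]_(m, n)) : hsq (adj x) = hsq x.
Proof.
rewrite /hsq exchange_big; apply: eq_bigr => i _; apply: eq_bigr => j _.
by rewrite !mxE normc_conj.
Qed.

(* Haagerup's trick: Cauchy-Schwarz after the balanced factorizations of [T] and
   [V] replaces them by positive matrices, to which the spectral gap applies. *)
Lemma expander_bound p m k (c : 'I_4 -> 'M[C]_(m, k))
    (V : 'M[C]_(p.+2, m)) (T : 'M[C]_(p.+2, k)) :
  (forall i, contr (c i)) -> (4 * k <= p.+2)%N ->
  complex.Re (\sum_i \tr (adj V *m gens R p i *m T *m (c i)^T)) <=
  2 * hsq V + (2 - 1 / (100 * (100 * 40))) * hsq T.
Proof.
move=> hc kp.
have [T1 [T2 [hT hT1 hT2 htr]]] := balanced_factorization T.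
have [V1 [V2 [hV hV1 hV2 _]]] := balanced_factorization V.
have gap : \sum_i 2 * complex.Re (\tr (adj (V1 *m adj V1) *m
     (gens R p i *m (T1 *m adj T1) *m adj (gens R p i)))) <=
  4 * hsq V + 4 * hsq T - hsq T / (100 * (100 * 10)).
  rewrite -hT1 -hV1; apply: polarized_gap; apply: le_trans htr _; rewrite hT1.
  apply: ler_wpM2r; first exact: hsq_ge0.
  rewrite ler_pdivlMr // -natrM ler_nat mulnC; exact: kp.
(* The trace is the scalar product of [X], made of the left factors and the generator, with [Y],
   made of the right factors and [c i]. The norm of [X] is the quantity in [gap], and contractivity
   of [c i] bounds the norm of [Y]. *)
have term i : 4 * complex.Re (\tr (adj V *m gens R p i *m T *m (c i)^T)) <=
    2 * complex.Re (\tr (adj (V1 *m adj V1) *m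
     (gens R p i *m (T1 *m adj T1) *m adj (gens R p i)))) + (hsq V + hsq T).
  pose X := adj (adj V1 *m gens R p i *m T1).
  pose Y := T2 *m (c i)^T *m adj V2.
  have -> : \tr (adj V *m gens R p i *m T *m (c i)^T) = \tr (adj X *m Y).
    by rewrite /X /Y adjK hT hV adjM -!mulmxA [LHS]mxtrace_mulC !mulmxA.
  have hX : hsq X = complex.Re (\tr (adj (V1 *m adj V1) *m
     (gens R p i *m (T1 *m adj T1) *m adj (gens R p i)))).
    rewrite -[hsq X]/(complex.Re (hsq X)%:C) hsqE; congr complex.Re.
    rewrite /X adjK !adjM !adjK !mulmxA.
    by rewrite [LHS]mxtrace_mulC !mulmxA.
  have hY : 2 * hsq Y <= hsq V + hsq T.
    have -> : hsq Y = complex.Re (\tr (adj (adj V2 *m V2) *m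
        (map_mx conjc (c i) *m (adj T2 *m T2) *m (c i)^T))).
      rewrite -[hsq Y]/(complex.Re (hsq Y)%:C) hsqE; congr complex.Re.
      rewrite /Y !adjM !adjK {1}/adj trmxK !mulmxA.
      by rewrite mxtrace_mulC !mulmxA.
    apply: le_trans (Re_hs_le _ _) _; rewrite hV2 lerD2l.
    rewrite -hT2 -hsq_adj adjM.
    have -> : adj (c i)^T = map_mx conjc (c i) by rewrite /adj trmxK.
    apply: le_trans (hsq_contr _ _) _; first exact: contr_conj.
    rewrite -hsq_adj adjK.
    by apply: hsq_contr; exact: contr_conj.
  have := Re_hs_le X Y; rewrite hX; lra.
(* Division by 4 turns the denominator 100000 of [gap] into the 400000 of the statement. *)
have : \sum_i 4 * complex.Re (\tr (adj V *m gens R p i *m T *m (c i)^T)) <=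
   4 * hsq V + 4 * hsq T - hsq T / (100 * (100 * 10)) + 4 * (hsq V + hsq T).
  apply: le_trans (ler_sum _ (fun i _ => term i)) _.
  rewrite big_split; apply: lerD; first exact: gap.
  by rewrite sumr_const card_ord -[X in X <= _]mulr_natl lexx.
rewrite -mulr_sumr (raddf_sum (@complex.Re R)) /=.
by move=> h; move: h; lra.
Qed.

End Factorization.

(** * The norm bound for tensor sums and its transfer to codes *)

Section TensorBound.
Variables (R : realType).
Notation C := R[i].
Notation nc := (@Normc.normc R).

(** The coefficient in [expander_bound]. The minimum of [2 (t N)^2 + b (N' / t)^2] over [t > 0] is
    [2 sqrt (2 b) N N' = 4 w N N'], attained at [t^2 = w N' / N]. *)
Let b : R := 2 - 1 / (100 * (100 * 40)).
Let w : R := Num.sqrt (b / 2).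
Definition tensor_norm : R := 4 * w.

Let b_gt0 : 0 < b.
Proof. rewrite /b subr_gt0 ltr_pdivrMr ?mulr_gt0 //; lra. Qed.

Let w2 : w ^+ 2 = b / 2.
Proof. by rewrite sqr_sqrtr // divr_ge0 // ltW. Qed.

Let w_gt0 : 0 < w.
Proof. by rewrite sqrtr_gt0 divr_gt0. Qed.

Lemma tensor_norm_gt0 : 0 < tensor_norm.
Proof. by rewrite mulr_gt0. Qed.

Lemma tensor_norm_lt4 : tensor_norm < 4.
Proof.
rewrite /tensor_norm -[X in _ < X]mulr1 ltr_pM2l // -(@ltr_pXn2r _ 2) ?nnegrE ?ltW //.
rewrite w2 expr1n ltr_pdivrMr // mul1r /b gtrBl divr_gt0 // !mulr_gt0 //.
Qed.

Let unimodular_Re (z : C) : exists2 ph : C, nc ph = 1 & complex.Re (ph * z) = nc z.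
Proof.
have [z0|z0] := eqVneq (nc z) 0.
  exists 1; rewrite ?Normc.normc1 // (Normc.eq0_normc z0) mulr0.
  by rewrite Normc.normc0.
exists ((nc z)^-1%:C * conjc z).
  rewrite Normc.normcM normc_real normc_conj ger0_norm ?invr_ge0 ?normc_ge0 //.
  by rewrite mulVf.
rewrite -mulrA [conjc z * z]mulrC mulc_conj -(rmorphM (real_complex R)) /=.
by rewrite expr2 mulrA mulVf // mul1r.
Qed.

Let balanced_bound (z : C) (N N' : R) : 0 < N -> 0 < N' ->
  (forall (ph : C) (t : R), nc ph = 1 -> 0 < t ->
    complex.Re (ph * z) <= 2 * (t * N) ^+ 2 + b * (t^-1 * N') ^+ 2) ->
  nc z <= tensor_norm * (N * N').
Proof.
move=> N0 N'0 h; have [ph ph1 <-] := unimodular_Re z.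
pose t := Num.sqrt (w * N' / N).
have t0 : 0 < t by rewrite sqrtr_gt0 divr_gt0 ?mulr_gt0.
have t2 : t ^+ 2 = w * N' / N by rewrite sqr_sqrtr // ltW // divr_gt0 ?mulr_gt0.
apply: le_trans (h ph t ph1 t0) _; rewrite !exprMn exprVn t2 /tensor_norm.
have -> : b = 2 * w ^+ 2 by rewrite w2; field.
by rewrite le_eqVlt; apply/orP; left; apply/eqP; field; rewrite !gt_eqF.
Qed.

Lemma sum_pairs (I J : finType) (V : nmodType) (F : I * J -> V) :
  \sum_a F a = \sum_l \sum_x F (l, x).
Proof. by rewrite pair_bigA; apply: eq_bigr => -[]. Qed.

(** Reshaping vectors of the tensor product into matrices turns the pairing into the traces of
    [expander_bound]. Scaling [u] by [t] and [v] by [1 / t] then replaces the sum of squares by a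
    product of norms. *)
Lemma tensor_contr p m k (c : 'I_4 -> 'M[C]_(m, k)) :
  (forall i, contr (c i)) -> (4 * k <= p.+2)%N ->
  contr (tensor_norm^-1%:C *:
    (\matrix_(a < #|{: 'I_m * 'I_p.+2}|, a' < #|{: 'I_k * 'I_p.+2}|)
      \sum_i c i (enum_val a).1 (enum_val a').1 * gens R p i (enum_val a).2 (enum_val a').2)).
Proof.
move=> hc kp u v; set K := \matrix_(_ < _, _ < _) _.
pose V (u : 'rV[C]_#|{: 'I_m * 'I_p.+2}|) : 'M[C]_(p.+2, m) :=
  \matrix_(x, l) conjc (u 0 (enum_rank (l, x))).
pose T (v : 'rV[C]_#|{: 'I_k * 'I_p.+2}|) : 'M[C]_(p.+2, k) :=
  \matrix_(x, l) v 0 (enum_rank (l, x)).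
pose z (u : 'rV_#|{: 'I_m * 'I_p.+2}|) (v : 'rV_#|{: 'I_k * 'I_p.+2}|) : C :=
  \sum_a \sum_a' u 0 a * K a a' * v 0 a'.
have zE u' v' : z u' v' = \sum_i \tr (adj (V u') *m gens R p i *m T v' *m (c i)^T).
  have e i : \tr (adj (V u') *m gens R p i *m T v' *m (c i)^T) =
      \sum_(a : 'I_m * 'I_p.+2) \sum_(a' : 'I_k * 'I_p.+2)
        u' 0 (enum_rank a) * (c i a.1 a'.1 * gens R p i a.2 a'.2) * v' 0 (enum_rank a').
    rewrite [RHS]sum_pairs; apply: eq_bigr => l _; rewrite mxE exchange_big [RHS]sum_pairs.
    apply: eq_bigr => l' _; rewrite mxE mulr_suml; apply: eq_bigr => y _.
    rewrite mxE !mulr_suml; apply: eq_bigr => x _.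
    by rewrite !mxE conjcK; ring.
  rewrite /z (reindex _ (onW_bij _ (enum_rank_bij _))) /=.
  rewrite (eq_bigr _ (fun i _ => e i)) [RHS]exchange_big; apply: eq_bigr => a _.
  rewrite (reindex _ (onW_bij _ (enum_rank_bij _))) /= [RHS]exchange_big.
  apply: eq_bigr => a' _; rewrite !mxE !enum_rankK mulr_sumr mulr_suml.
  by apply: eq_bigr.
have NV u' : hsq (V u') = nrm (dot R _) u' ^+ 2.
  rewrite nrm_dot /hsq [LHS](exchange_big) pair_bigA /=.
  rewrite [RHS](reindex _ (onW_bij _ (enum_rank_bij _))) /=.
  by apply: eq_bigr => -[l x] _; rewrite !mxE normc_conj.
have NT v' : hsq (T v') = nrm (dot R _) v' ^+ 2.
  rewrite nrm_dot /hsq [LHS](exchange_big) pair_bigA /=.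
  rewrite [RHS](reindex _ (onW_bij _ (enum_rank_bij _))) /=.
  by apply: eq_bigr => -[l x] _; rewrite !mxE.
have zZ s t u' v' : z (s *: u') (t *: v') = s * t * z u' v'.
  rewrite mulr_sumr; apply: eq_bigr => a _; rewrite mulr_sumr; apply: eq_bigr => a' _.
  by rewrite !mxE; ring.
have -> : \sum_l \sum_l' u 0 l * (tensor_norm^-1%:C *: K) l l' * v 0 l' = tensor_norm^-1%:C * z u v.
  rewrite mulr_sumr; apply: eq_bigr => a _; rewrite mulr_sumr; apply: eq_bigr => a' _.
  by rewrite mxE; ring.
rewrite Normc.normcM normc_real ger0_norm; last by rewrite invr_ge0 ltW // tensor_norm_gt0.
rewrite ler_pdivrMl ?tensor_norm_gt0 //.
have [u0|u0] := eqVneq (nrm (dot R _) u) 0.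
  rewrite (nrm_dot_eq0 u0) -(scale0r u) -(scale1r v) zZ mul0r mul0r Normc.normc0.
  by rewrite !mulr_ge0 ?nrm_ge0 // ltW // tensor_norm_gt0.
have [v0|v0] := eqVneq (nrm (dot R _) v) 0.
  rewrite (nrm_dot_eq0 v0) -(scale0r v) -(scale1r u) zZ mulr0 mul0r Normc.normc0.
  by rewrite !mulr_ge0 ?nrm_ge0 // ltW // tensor_norm_gt0.
apply: balanced_bound; try by rewrite lt_neqAle eq_sym ?u0 ?v0 nrm_ge0.
move=> ph t hph t0.
have -> : ph * z u v = z ((ph * t%:C) *: u) (t^-1%:C *: v).
  have tt : t%:C * t^-1%:C = 1 :> C.
    by rewrite -(rmorphM (real_complex R)) mulfV ?gt_eqF.
  by rewrite zZ -[ph * _ * _]mulrA tt mulr1.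
rewrite zE; apply: le_trans (expander_bound _ _ hc kp) _.
rewrite NV NT !nrmZ Normc.normcM hph mul1r !normc_real.
by rewrite (ger0_norm (ltW t0)) ger0_norm ?invr_ge0 ?(ltW t0) //; exact: lexx.
Qed.

Variables (M : cstarAlg R).

Lemma product_code m n (S : 'I_m -> M) (E : 'I_n -> M) : code S -> code E ->
  code (fun a : 'I_#|{: 'I_m * 'I_n}| => S (enum_val a).1 * E (enum_val a).2).
Proof.
move=> cS cE; split.
  move=> i j; rewrite starM mulrA -[_ * star (S _) * S _]mulrA (code_orth cS).
  have -> : (i == j) = (enum_val i == enum_val j) by rewrite (inj_eq enum_val_inj).
  case: (enum_val i) (enum_val j) => l x [l' x'] /=; rewrite xpair_eqE.
  by case: eqP => _; rewrite ?mulr1 ?(code_orth cE) // mulr0 mul0r.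
rewrite (reindex _ (onW_bij _ (enum_rank_bij _))) sum_pairs -cS.2.
apply: eq_bigr => l _; rewrite -[X in _ = X * _]mulr1 -cE.2 mulr_sumr mulr_suml.
by apply: eq_bigr => x _; rewrite enum_rankK /= starM !mulrA.
Qed.

(** The products [S l * E x] form a code indexed by pairs, in which the sum is the image of the
    matrix of [tensor_contr]. The matrices [c i] are rectangular, hence two codes [S] and [S']. *)
Lemma cnorm_tensor p m k (c : 'I_4 -> 'M[C]_(m, k))
    (S : 'I_m -> M) (S' : 'I_k -> M) (E : 'I_p.+2 -> M) :
  code S -> code S' -> code E -> (forall i, contr (c i)) -> (4 * k <= p.+2)%N ->
  cnorm (\sum_i \sum_l \sum_l' c i l l' *: (S l * hat E (gens R p i) * star (S' l'))) <=
  tensor_norm.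
Proof.
move=> cS cS' cE hc kp.
have h := cnorm_contr (product_code cS cE) (product_code cS' cE) (tensor_contr hc kp).
rewrite -[leRHS]mulr1 -ler_pdivrMl ?tensor_norm_gt0 //; apply: le_trans h.
rewrite le_eqVlt; apply/orP; left; apply/eqP.
rewrite -[X in X * _](@ger0_norm R) ?invr_ge0 ?ltW ?tensor_norm_gt0 // -normc_real -cnormZ.
congr cnorm.
have e i : \sum_l \sum_l' c i l l' *: (S l * hat E (gens R p i) * star (S' l')) =
    \sum_(a : 'I_m * 'I_p.+2) \sum_(a' : 'I_k * 'I_p.+2)
      (c i a.1 a'.1 * gens R p i a.2 a'.2) *: (S a.1 * E a.2 * star (S' a'.1 * E a'.2)).
  rewrite [RHS]sum_pairs; apply: eq_bigr => l _; rewrite exchange_big [RHS]sum_pairs.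
  apply: eq_bigr => l' _; rewrite /hat exchange_big mulr_sumr mulr_suml scaler_sumr.
  apply: eq_bigr => y _; rewrite mulr_sumr mulr_suml scaler_sumr.
  by apply: eq_bigr => x _; rewrite -scalerAr -scalerAl scalerA starM !mulrA.
rewrite (eq_bigr _ (fun i _ => e i)) exchange_big scaler_sumr.
rewrite (reindex _ (onW_bij _ (enum_rank_bij _))) /=; apply: eq_bigr => a _.
rewrite exchange_big scaler_sumr.
rewrite (reindex _ (onW_bij _ (enum_rank_bij _))) /=; apply: eq_bigr => a' _.
by rewrite !mxE !enum_rankK -scaler_suml scalerA.
Qed.

End TensorBound.

(** * The limit of the expander *)

Section UltrapowerElements.
Variables (R : realType) (M : cstarAlg R) (U : set_system nat) (UU : UltraFilter U).
Notation C := R[i].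
Notation P := (ultrapower M UU).
Notation up := (@upi R M U UU : linf M -> P).

Lemma nonprincipal_cofinite N : nonprincipal U -> U [set m | (N <= m)%N].
Proof.
move=> np; elim: N => [|N ih]; first exact: filterE.
have [UN|UN] := in_ultra_setVsetC [set N] UU; last first.
  apply: filterS2 ih UN => m /= Nm mN; rewrite ltn_neqAle Nm andbT.
  by apply/eqP => e; apply: mN; rewrite e.
exfalso; apply: (np N); apply/funext => S; apply/propext; split.
  move=> US x ->; have [y [Sy yN]] := filter_ex (filterI US UN).
  by rewrite -[N]yN.
by move=> h; apply: filterS UN.
Qed.

Lemma linf_sum_at I (r : seq I) (Q : pred I) (F : I -> linf M) m :
  (\sum_(i <- r | Q i) F i : linf M) m = \sum_(i <- r | Q i) F i m.
Proof. exact: (big_morph (fun x : linf M => linf_val x m)). Qed.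

Lemma up_sum I (r : seq I) (Q : pred I) (F : I -> linf M) :
  up (\sum_(i <- r | Q i) F i) = \sum_(i <- r | Q i) up (F i).
Proof. exact: (big_morph up (@upiD _ _ _ UU) (@upi0 _ _ _ UU)). Qed.

Lemma upB x y : up (x - y) = up x - up y. Proof. exact: upiB. Qed.
Lemma upM x y : up (x * y) = up x * up y. Proof. exact: upiM. Qed.
Lemma upZ c x : up (c *: x) = c *: up x. Proof. exact: upiZ. Qed.
Lemma star_up x : star (up x) = up (lstar x). Proof. exact: upi_star. Qed.

Lemma up_eq (x y : linf M) : (forall m, x m = y m) -> up x = up y.
Proof. by move=> h; congr upi; exact: linfP_eq. Qed.

Lemma const_bounded (x : M) : (fun=> x : M) \in bounded_seq (A := M).
Proof. by apply/asboolP; exists (cnorm x). Qed.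

Definition const (x : M) : linf M := Linf (const_bounded x).

Lemma const_code r (S : 'I_r -> M) : code S -> code (fun l => up (const (S l))).
Proof.
move=> cS; split.
  move=> i j; rewrite star_up -upM.
  rewrite (@up_eq _ (i == j)%:R) => [|m]; first by case: (i == j); rewrite ?[LHS]upi0.
  by rewrite -[LHS]/(star (S i) * S j) (code_orth cS); case: (i == j).
under eq_bigr do rewrite star_up -upM.
rewrite -up_sum -[RHS]/(up 1); apply: up_eq => m.
by rewrite linf_sum_at -[RHS]/(1 : M) -cS.2.
Qed.

End UltrapowerElements.

Section Expander.
Variables (R : realType) (M : cstarAlg R) (U : set_system nat) (UU : UltraFilter U).
Notation C := R[i].
Notation P := (ultrapower M UU).
Notation up := (@upi R M U UU : linf M -> P).
Hypothesis np : nonprincipal U.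
Variable E : forall p, 'I_p.+2 -> M.
Hypothesis cE : forall p, code (@E p).
Hypothesis has_code : forall r, exists S : 'I_r.+1 -> M, code S.

Definition hat_gens i p : M := hat (@E p) (gens R p i).

Lemma star_hat_gens i p : star (hat_gens i p) * hat_gens i p = 1.
Proof. exact: (star_hat_hat (cE p) (adj_gens_unitary R p i)). Qed.

Lemma hat_gens_bounded i : hat_gens i \in bounded_seq (A := M).
Proof.
apply/asboolP; exists 1 => p; rewrite -(@ler_pXn2r _ 2) ?nnegrE ?cnorm_ge0 //.
by rewrite -cnorm_star star_hat_gens cnorm1 expr1n.
Qed.

Definition limit_gens i : P := up (Linf (hat_gens_bounded i)).

Lemma star_limit_gens i : star (limit_gens i) * limit_gens i = 1.
Proof.
rewrite /limit_gens star_up -upM -[RHS]/(up 1); apply: up_eq => p /=.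
exact: star_hat_gens.
Qed.

Lemma limit_gens_far (y : 'I_4 -> P) :
  1 <= cnorm (1 - \sum_i (star (limit_gens i) * y i * limit_gens i - y i)).
Proof.
pose y' i : linf M := urepr (y i : ultra M UU).
have yE i : y i = up (y' i) by rewrite [RHS]ureprK.
pose g i := Linf (hat_gens_bounded i).
have -> : 1 - \sum_i (star (limit_gens i) * y i * limit_gens i - y i) =
    up (1 - \sum_i (lstar (g i) * y' i * g i - y' i)).
  rewrite upB up_sum; congr (_ - _); apply: eq_bigr => i _.
  by rewrite upB !upM -star_up -yE.
set z : linf M := _ - _; change (1 <= unorm (upi UU z)).
apply: (ler_cvg_to (@cvg_cst R 1 nat U _) (@unorm_cvg R M U UU z)).
apply: (@filterE _ U) => p.
have := commutator_far (cE p) (fun i => y' i p) (ltn0Sn _) (gens_unitary R p).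
congr (_ <= cnorm _).
by rewrite -[RHS]/(1 - (\sum_i (lstar (g i) * y' i * g i - y' i) : linf M) p) linf_sum_at.
Qed.

(** Codes amplify inside the algebra: the vectors [e l] are packed into [sum_l T l * e l], whose
    squared norm is the sum of theirs, and likewise the [x l]. The pairing becomes that of the two
    packed vectors through one element [X], whose norm [cnorm_tensor] bounds. *)
Lemma limit_gens_cb (f : state P) :
  cb_bound (gns (svalP f)) (fun i x => limit_gens i * x) (tensor_norm R).
Proof.
move=> n n' e x c hc; set s := gns _.
have s0 : 0 <= tensor_norm R / 2 * (\sum_l nrm s (e l) ^+ 2 + \sum_l nrm s (x l) ^+ 2).
  apply: mulr_ge0; first by rewrite divr_ge0 // ltW // tensor_norm_gt0.
  by apply: addr_ge0; apply: sumr_ge0 => l _; exact: sqr_ge0.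
(* Empty families are treated apart, since the codes available have at least one isometry. *)
case: n e c hc s0 => [|n] e c hc s0.
  by rewrite big1 // => i _; rewrite big_ord0.
case: n' x c hc s0 => [|n'] x c hc s0.
  by rewrite big1 // => i _; rewrite big1 // => l _; rewrite big_ord0.
have [S cS] := has_code n; have [S' cS'] := has_code n'.
have cT := const_code UU cS; have cT' := const_code UU cS'.
set T := (fun l => up (const (S l))) in cT.
set T' := (fun l => up (const (S' l))) in cT'.
pose X : P := \sum_i \sum_l \sum_l' c i l l' *: (T l * limit_gens i * star (T' l')).
have Xle : cnorm X <= tensor_norm R.
  pose Y : linf M := \sum_i \sum_l \sum_l'
    c i l l' *: (const (S l) * Linf (hat_gens_bounded i) * lstar (const (S' l'))).
  have -> : X = up Y.
    rewrite up_sum; apply: eq_bigr => i _; rewrite up_sum; apply: eq_bigr => l _.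
    rewrite up_sum; apply: eq_bigr => l' _.
    by rewrite upZ !upM -star_up.
  (* Nonprincipality makes the column condition [4 k <= p + 2] hold for almost all [p], whatever the
     size of the [c i]. *)
  apply: unorm_le; have := nonprincipal_cofinite UU (4 * n'.+1) np.
  apply: filterS => p /= hp.
  have := cnorm_tensor cS cS' (cE p) hc (leq_trans hp (leqW (leqnSn p))).
  congr (cnorm _ <= _); rewrite linf_sum_at; apply: eq_bigr => i _.
  rewrite linf_sum_at; apply: eq_bigr => l _.
  by rewrite linf_sum_at; apply: eq_bigr.
have code_coord k (W : 'I_k -> P) (z : 'I_k -> P) l : code W ->
    star (W l) * (\sum_l' W l' * z l') = z l.
  move=> cW; rewrite mulr_sumr (bigD1 l) //= big1 => [|l' ll'].
    by rewrite addr0 mulrA (code_orth cW) eqxx mul1r.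
  by rewrite mulrA (code_orth cW) eq_sym (negbTE ll') mul0r.
have nrm_code k (W : 'I_k -> P) (z : 'I_k -> P) : code W ->
    nrm s (\sum_l W l * z l) ^+ 2 = \sum_l nrm s (z l) ^+ 2.
  move=> cW; rewrite sqr_nrm gnsE.
  have -> : star (\sum_l W l * z l) * (\sum_l W l * z l) = \sum_l star (z l) * z l.
    rewrite (big_morph _ (@starD _ P) (@star0 _ P)) mulr_suml; apply: eq_bigr => l _.
    by rewrite starM -mulrA code_coord.
  have [fD fZ _ _ _] := svalP f.
  have f0 : sval f 0 = 0 by rewrite -(scale0r (0 : P)) fZ mul0r.
  rewrite (big_morph _ fD f0) raddf_sum; apply: eq_bigr => l _.
  by rewrite sqr_nrm gnsE.
pose ze := \sum_l T l * e l; pose zx := \sum_l T' l * x l.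
have key : \sum_i \sum_l \sum_l' c i l l' * s (e l) (limit_gens i * x l') = s ze (X * zx).
  have ip_sum (I : finType) (F : I -> P) z : s z (\sum_i F i) = \sum_i s z (F i).
    exact: (big_morph _ (ipDr s z) (ip0r s z)).
  rewrite mulr_suml ip_sum; apply: eq_bigr => i _.
  rewrite mulr_suml ip_sum; apply: eq_bigr => l _.
  rewrite mulr_suml ip_sum; apply: eq_bigr => l' _.
  rewrite -scalerAl ipZr -!mulrA code_coord //; congr (_ * _).
  by rewrite [RHS]gns_star (code_coord _ T e l cT).
rewrite key.
have h : complex.Re (s ze (X * zx)) <= nrm s ze * (tensor_norm R * nrm s zx).
  apply: le_trans (Re_le_normc _) _; apply: le_trans (cauchy_schwarz _ _ _) _.
  apply: ler_wpM2l; first exact: nrm_ge0.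
  by apply: le_trans (gns_nrm_mul _ _ _) _; apply: ler_wpM2r => //; exact: nrm_ge0.
rewrite -(nrm_code _ _ e cT) -(nrm_code _ _ x cT') -/ze -/zx.
have := sqr_ge0 (nrm s ze - nrm s zx); have := tensor_norm_gt0 R; nra.
Qed.

End Expander.

(** * The separating formula and the conclusion *)

Section Witness.
Variable R : realType.

(** The first four variables are the parameters [a_i], the last four the quantified [y_i];
    subtraction is encoded by the constant -1. *)
Definition commutator_poly (i : 'I_4) : starpoly R (4 + 4) :=
  SAdd (SMul (SMul (SStar (SVar R (lshift 4 i))) (SVar R (rshift 4 i))) (SVar R (lshift 4 i)))
    (SMul (SConst (4 + 4) (-1)) (SVar R (rshift 4 i))).

Definition witness_poly : starpoly R (4 + 4) :=
  SAdd (SConst (4 + 4) 1) (SMul (SConst (4 + 4) (-1))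
    (foldr (fun i t => SAdd (commutator_poly i) t) (SConst (4 + 4) 0) (index_enum 'I_4))).

Lemma speval_witness (A : cstarAlg R) (a b : 4.-tuple A) :
  speval witness_poly [tuple of a ++ b] =
  1 - \sum_i (star (tnth a i) * tnth b i * tnth a i - tnth b i).
Proof.
rewrite /witness_poly /= scaleN1r mulN1r scale1r; congr (_ - _).
rewrite unlock; elim: (index_enum _) => [|i r ih] /=; first by rewrite scale0r.
by rewrite ih !tnth_lshift !tnth_rshift scaleN1r mulN1r.
Qed.

End Witness.

Lemma embedding_comp (R : realType) (A B D : cstarAlg R) (f : A -> B) (g : B -> D) :
  is_embedding f -> is_embedding g -> is_embedding (g \o f).
Proof.
move=> [[fl [f1 fM] fs] fn] [[gl [g1 gM] gs] gn]; split; last by move=> x; rewrite /= gn fn.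
split; first by move=> c x y; rewrite /= fl gl.
- by split=> [|x y] /=; rewrite ?f1 ?g1 ?fM ?gM.
- by move=> x /=; rewrite fs gs.
Qed.

Lemma embedding_cuntz (R : realType) (A B : cstarAlg R) (f : A -> B) (v1 v2 : A) :
  is_embedding f -> cuntz_pair v1 v2 -> cuntz_pair (f v1) (f v2).
Proof.
move=> [[fl [f1 fM] fs] _] [h1 h2 h3].
have fD x y : f (x + y) = f x + f y by rewrite -[x in LHS]scale1r fl scale1r.
by split; rewrite -!fs -!fM ?h1 ?h2 // -fD h3.
Qed.

Theorem corollary5p10 (R : realType) (U : set_system nat)
    (UU : UltraFilter U) (O2 : cstarAlg R) :
  nonprincipal U -> is_cuntz2 O2 -> KEP O2 UU ->
  ~ (exists T : theory R, model_companion T (cstar_theory R)).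
Proof.
move=> np [v1 [v2 [cv _]]] _ [T [complete _ extend]].
have [M [TM [f fe]]] := extend O2 (@models_cstar_theory R O2).
have has_code r := comb_code r (embedding_cuntz fe cv).
pose E p := sval (cid (has_code p.+1)).
have cE p : code (@E p) := svalP (cid (has_code p.+1)).
pose a := limit_gens UU cE; set A := ultrapower M UU.
have TA : models T A := models_ultrapower UU TM.
have [y [y1 yfar]] := witness_in_extension (@star_limit_gens _ _ _ UU _ cE)
  (tensor_norm_gt0 R) (tensor_norm_lt4 R) (limit_gens_cb np cE has_code).
(* The algebra of forms need not be a model of [T], whereas existential closedness compares models
   only; an embedding into a model preserves the [y i] and the norm estimate. *)
have [B' [TB' [g ge]]] := extend _ (@models_cstar_theory R (form_alg (gns_fam A))).
have he := embedding_comp (@rep_embedding R A) ge.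
have [_ ec] := complete A TA.
(* Radius 1 suffices, because [witness_in_extension] produces contractions. *)
have := ec B' _ TB' he 4 4 (FNorm (witness_poly R)) I 1%N (mktuple a) isT.
set EA := [set _ | _ in _]; set EB := [set _ | _ in _] => e.
have hA : 1 <= inf EA.
  (* The zero tuple shows that the set is nonempty, so that its infimum is not a default value. *)
  apply: lb_le_inf.
    exists (feval (FNorm (witness_poly R)) [tuple of mktuple a ++ nseq_tuple 4 (0 : A)]).
    exists (nseq_tuple 4 0) => // i.
    by rewrite tnth_nseq; change (cnorm (0 : A) <= 1%:R); rewrite cnorm0 ler01.
  move=> _ [b _ <-]; change (1 <= cnorm (speval (witness_poly R) [tuple of mktuple a ++ b])).
  rewrite speval_witness.
  under eq_bigr do rewrite tnth_mktuple.
  exact: limit_gens_far.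
have hB : inf EB < 1.
  pose b := mktuple (fun j => g (y j)).
  apply: (@le_lt_trans _ _ (feval (FNorm (witness_poly R))
    [tuple of map (g \o @rep R A) (mktuple a) ++ b])).
    apply: ge_inf; first by exists 0 => _ [c _ <-] /=; exact: cnorm_ge0.
    exists b => // i; rewrite tnth_mktuple /cball /= ge.2; exact: y1.
  change (cnorm (speval (witness_poly R)
    [tuple of map_tuple (g \o @rep R A) (mktuple a) ++ b]) < 1).
  rewrite speval_witness; apply: le_lt_trans yfar.
  have [[gl [g1 gM] gs] gn] := ge.
  have gD u v : g (u + v) = g u + g v by rewrite -[u in LHS]scale1r gl scale1r.
  have gB u v : g (u - v) = g u - g v by rewrite addrC -scaleN1r gl scaleN1r addrC.
  have g0 : g 0 = 0 by rewrite -(subrr 0) gB subrr.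
  rewrite -gn gB g1 (big_morph g gD g0) le_eqVlt; apply/orP; left; apply/eqP.
  congr (cnorm (_ - _)); apply: eq_bigr => i _.
  by rewrite !tnth_mktuple tnth_map tnth_mktuple gB !gM gs.
by move: hA; rewrite e leNgt hB.
Qed.
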